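(* Let $p\equiv 1\bmod 8$ and $q\equiv 5\bmod 8$ be primes with $\left(\frac{p}{q}\right)=-1$, and write $\pi=a+bi$, where $p=a^2+b^2$ and $\pi\equiv 1\bmod 4$. Then the equation $$A^2-\pi B^2=\pi'\Gamma^2$$ has a nontrivial solution $(A,B,\Gamma)=(\alpha,\beta,\gamma)$ in $\mathbb{Z}[i]$. Setting $\mu=\alpha+\beta\sqrt{\pi}$, the extension $K=k(\sqrt{p},\sqrt{\pi},\sqrt{\mu})$ is a $C_8$-extension of $k$. We can choose $\alpha$ and $\beta$ in such a way that $\mu\equiv 1\bmod 2+2i$, and then $K/k$ is \begin{itemize} \item unramified if $p=x^2+32y^2$, \item ramified at $2$ if $p=4x^2+4xy+9y^2$. In this case, $L=k(\sqrt{p},\sqrt{\pi},\sqrt{\rho\mu})$ is an unramified $\operatorname{SD}_{16}$-extension of $k$, where $\rho=c+di\equiv 1\bmod 2+2i$ and $q=c^2+d^2$. \end{itemize}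
   Context: Here $k=\mathbb{Q}(\sqrt{-pq})$, $i=\sqrt{-1}$, $\pi'=a-bi$ is the complex conjugate of $\pi$, the numbers $a,b,c,d$ are integers, and $x,y$ are integers in the representations of $p$ by the two quadratic forms. A $G$-extension is a normal extension with Galois group isomorphic to $G$. $C_8$ is the cyclic group of order $8$, and $\operatorname{SD}_{16}=\langle\sigma,\tau:\sigma^8=\tau^2=1,\ \tau\sigma\tau=\sigma^3\rangle$ is the semi-dihedral group of order $16$. Nontrivial means that $\alpha,\beta,\gamma$ are not all zero.
   Formalization: The claim that K/k is a C_8-extension is false (K contains k(i,√p), of group C_2×C_2 over k); it is replaced by: K/k is dihedral of order 16 and K is a C_8-extension of k(√-p). The solution (α,β,γ) is taken coprime in Z[i], since scaled solutions violate the ramification claims. *)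

(* Defs.v *)
From mathcomp Require Export all_boot all_order all_algebra.
From mathcomp Require Export all_fingroup all_solvable all_field.

Set Implicit Arguments.
Unset Strict Implicit.
Unset Printing Implicit Defensive.

Import Order.TTheory GRing.Theory Num.Theory.
Local Open Scope ring_scope.

(* Number fields are the subfields of an ambient finite normal extension Om
   of Q that is large enough to contain all the elements adjoined. *)

(* Meaningful when l is an odd prime. *)
Definition legendre (n : int) (l : nat) : int :=
  if (l %| n)%Z then 0
  else if [exists x : 'I_l, (x%:Z ^+ 2 == n %[mod l])%Z] then 1 else -1.

Section NumberFields.

Variable Om : splittingFieldType rat.
Implicit Types (k K E : {subfield Om}) (I J P : Om -> Prop).

Definition algint (x : Om) : Prop := integralOver (intr : int -> Om) x.

(* Congruence in the ring of all algebraic integers of Om.  For x, y, m in a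
   subfield E with m != 0 this is the congruence modulo the ideal m O_E, since
   (x - y) / m lies in E. *)
Definition eqmod_int (x y m : Om) : Prop := algint ((x - y) / m).

Definition gaussint (im x : Om) : Prop :=
  exists c d : int, x = c%:~R + d%:~R * im.

Definition conic_solution (im pi pi' A B C : Om) : Prop :=
  [/\ gaussint im A, gaussint im B, gaussint im C
    & A ^+ 2 - pi * B ^+ 2 = pi' * C ^+ 2].

(* Every common divisor of A, B, C in Z[im] is a unit of Z[im]. *)
Definition coprime_gauss (im A B C : Om) : Prop :=
  forall t A1 B1 C1 : Om,
    gaussint im t -> gaussint im A1 -> gaussint im B1 -> gaussint im C1 ->
    A = t * A1 -> B = t * B1 -> C = t * C1 ->
    exists2 u, gaussint im u & t * u = 1.

Definition G_extension (gT : finGroupType) k K (G : {set gT}) : Prop :=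
  galois k K /\ ('Gal(K / k) \isog G)%g.

Definition ring_of_integers E (x : Om) : Prop := x \in E /\ algint x.

Definition is_prime_ideal E P : Prop :=
  [/\ [/\ forall x, P x -> ring_of_integers E x,
          P 0,
          forall x y, P x -> P y -> P (x + y)
        & forall r x, ring_of_integers E r -> P x -> P (r * x)],
      ~ P 1,
      forall x y, ring_of_integers E x -> ring_of_integers E y ->
        P (x * y) -> P x \/ P y
    & exists2 x, P x & x != 0].

Definition ideal_mul I J (x : Om) : Prop :=
  exists2 s : seq (Om * Om), (forall u, u \in s -> I u.1 /\ J u.2)
    & x = \sum_(u <- s) u.1 * u.2.

Definition ideal_exp E P (n : nat) : Om -> Prop :=
  iter n (ideal_mul P) (ring_of_integers E).

(* The ideal of O_K generated by the prime of k below P. *)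
Definition extended_prime k K P : Om -> Prop :=
  ideal_mul (fun x => P x /\ x \in k) (ring_of_integers K).

(* e is the exponent of P in the factorization of the prime of k below P. *)
Definition ramification_index k K P (e : nat) : Prop :=
  (forall x, extended_prime k K P x -> ideal_exp K P e x) /\
  ~ (forall x, extended_prime k K P x -> ideal_exp K P e.+1 x).

(* At all finite and infinite places.  Residue fields are finite, so there is
   no separability condition; every embedding of K extends to Om. *)
Definition unramified k K : Prop :=
  (forall P, is_prime_ideal K P -> ramification_index k K P 1) /\
  (forall f : {rmorphism Om -> algC},
     (forall x, x \in k -> f x \is Num.real) ->
     forall x, x \in K -> f x \is Num.real).

Definition ramified_at_2 k K : Prop :=
  exists P, [/\ is_prime_ideal K P, P 2%:R
              & exists2 e, (1 < e)%N & ramification_index k K P e].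

End NumberFields.

Arguments G_extension {Om gT} k K G%_g.

(* The library's semi-dihedral group has the usual presentation; note that
   s ^ t is the conjugate t^-1 * s * t. *)
Lemma SD16_presentation :
  ('SD_16 \isog Grp (s : t : s ^+ 8, t ^+ 2, s ^ t = s ^+ 3))%g.
Proof. exact: (@Grp_semidihedral 4 isT). Qed.

(* Main.v *)
Require Import Defs.
From mathcomp Require Import zify ring lra.
From HB Require Import structures.
From Stdlib Require Import Classical_Prop.

Set Implicit Arguments.
Unset Strict Implicit.
Unset Printing Implicit Defensive.

Import Order.TTheory GRing.Theory Num.Theory.
Local Open Scope ring_scope.

(** Notation: i^2 = -1, lam = 1 + i, pi = a + b i with conjugate pi', r^2 = pi,
   r' = sqrt p / r, mu = A + B r; a prime also marks the conjugates of A, B, C,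
   and m is the square root adjoined last, of kappa mu with kappa = 1 or
   kappa = rho.

   Solvability.  A solution t^2 + 1 = p s^2 of the negative Pell equation factors
   in Z[i]; as t + i and t - i are coprime, t + i = unit * pi * w^2, and reducing
   modulo 4 determines the unit: 2 = pi w^2 + pi' w'^2 ([half_norm_sum]).  With
   p = e^2 + 2 f^2 this gives an explicit point ([conic_exists]).  Dividing by a
   common factor, moving the point when B is odd, and multiplying by a unit
   yields a coprime solution with mu = 1 mod 2 + 2 i ([conic_normal_exists]).

   Normality.  Over k(sqrt p, r), the conjugates of mu are mu, mu~ = A - B r and
   their complex conjugates mu' and mu'~.  The conic gives mu mu~ = pi' C^2, a
   square.  For mu mu' there is the polar form R = A A' + pi' B' C + pi B C', a
   rational integer, for which 4 mu mu' R is a square ([dbl_root_sqr]); so mu mu'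
   is a square as soon as R is one up to the factor p.  That is [Rval_square]: R
   is nonnegative, and by R (R - 2 pi B C') = pi' (A' C + A B')^2 a prime l <> p
   with odd exponent in R would have a prime factor in Z[i] dividing two of A, B
   and C, against coprimality.

   Galois group.  An automorphism s over k with s(i) = -i and s(sqrt p) = - sqrt p
   has s^2(r) = -r and s^4(m) = -m whatever its other values are, hence order 8,
   and generates the group over k(i sqrt p).  Together with t fixing i and r
   and moving sqrt p it generates everything; t^2 = 1, and (s t)^2 acts on m
   through its action on a square root theta of kappa kappa'.  Here theta = 1
   for kappa = 1 and theta = sqrt q for kappa = rho, and s t changes the sign of
   the latter: this is the difference between D_16 and SD_16.

   Ramification.  If no nontrivial automorphism acts trivially modulo a prime P,
   then P is unramified: there are X_j, Y_j with sum_j X_j t(Y_j) zero for t <> 1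
   and outside P for t = 1, and taking traces of z Y_j puts every z that lies in
   all the conjugates of P in the ideal generated by the elements of P in k
   ([unramified_at_prime]).
   This is tested on i, sqrt p, r and m: halves of 1 + sqrt p, 1 + sqrt q, 1 + r
   and, when m^2 = 1 mod 4, 1 + m are integral, and away from 2 the four conjugates
   of m^2 are coprime ([inertia_trivial]).  Finally mu = 1 + (2 + 2 i) s mod 4 for
   some Gaussian integer s.  If lam divides s then mu = 1 mod 4.  Otherwise
   (m - 1) / lam is a root of an Eisenstein polynomial, showing ramification
   at 2 ([ramified_kE]), whereas rho mu = 1 mod 4, as q = 5 mod 8 makes rho
   congruent to 1 + (2 + 2 i) modulo 4.  A congruence for R modulo 8 gives
   s = (a - 1) / 4 + b / 4 modulo lam ([conic_congruence]), and the parity of the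
   right-hand side is read off from the form that represents p, by means of the
   residues modulo 8 of the primes dividing values of x^2 - 2 y^2
   ([form32_parity], [form9_parity]). *)

(** * The Gaussian integers *)

Record gint := Gint { re : int; im : int }.
Definition gint_pair (x : gint) := (re x, im x).
Definition pair_gint (u : int * int) := Gint u.1 u.2.
Lemma gint_pairK : cancel gint_pair pair_gint. Proof. by case. Qed.
HB.instance Definition _ := Choice.copy gint (can_type gint_pairK).
Lemma gintP (x y : gint) : re x = re y -> im x = im y -> x = y.
Proof. by case: x; case: y => /= ? ? ? ? -> ->. Qed.
Definition gadd x y := Gint (re x + re y) (im x + im y).
Definition gopp x := Gint (- re x) (- im x).
Definition gmul x y := Gint (re x * re y - im x * im y) (re x * im y + im x * re y).
Fact gaddA : associative gadd.
Proof. by move=> x y z; apply: gintP; rewrite /= addrA. Qed.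
Fact gaddC : commutative gadd.
Proof. by move=> x y; apply: gintP; rewrite /= addrC. Qed.
Fact gadd0 : left_id (Gint 0 0) gadd.
Proof. by move=> x; apply: gintP; rewrite /= add0r. Qed.
Fact gaddN : left_inverse (Gint 0 0) gopp gadd.
Proof. by move=> x; apply: gintP; rewrite /= addNr. Qed.
HB.instance Definition _ := GRing.isZmodule.Build gint gaddA gaddC gadd0 gaddN.
Fact gmulA : associative gmul.
Proof. by move=> x y z; apply: gintP; rewrite /=; ring. Qed.
Fact gmulC : commutative gmul.
Proof. by move=> x y; apply: gintP; rewrite /=; ring. Qed.
Fact gmul1 : left_id (Gint 1 0) gmul.
Proof. by move=> x; apply: gintP; rewrite /=; ring. Qed.
Fact gmulDl : left_distributive gmul gadd.
Proof. by move=> x y z; apply: gintP; rewrite /=; ring. Qed.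
Fact gint1_neq0 : Gint 1 0 != 0. Proof. by []. Qed.
HB.instance Definition _ :=
  GRing.Zmodule_isComNzRing.Build gint gmulA gmulC gmul1 gmulDl gint1_neq0.
Lemma reD x y : re (x + y) = re x + re y. Proof. by []. Qed.
Lemma imD x y : im (x + y) = im x + im y. Proof. by []. Qed.
Lemma reN x : re (- x) = - re x. Proof. by []. Qed.
Lemma imN x : im (- x) = - im x. Proof. by []. Qed.
Lemma reM x y : re (x * y) = re x * re y - im x * im y. Proof. by []. Qed.
Lemma imM x y : im (x * y) = re x * im y + im x * re y. Proof. by []. Qed.
Lemma re_nat n : re n%:R = n%:Z.
Proof. by elim: n => // n IH; rewrite -natr1 reD IH -addn1 PoszD. Qed.
Lemma im_nat n : im n%:R = 0.
Proof. by elim: n => // n IH; rewrite -natr1 imD IH. Qed.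
Lemma re_int n : re n%:~R = n.
Proof. by case: n => n; rewrite ?NegzE ?mulrNz ?reN re_nat. Qed.
Lemma im_int n : im n%:~R = 0.
Proof. by case: n => n; rewrite ?NegzE ?mulrNz ?imN im_nat. Qed.
Definition gi : gint := Gint 0 1.
Definition lam : gint := Gint 1 1.
Definition conj (x : gint) := Gint (re x) (- im x).
Definition norm (x : gint) : int := re x ^+ 2 + im x ^+ 2.
Fact conj_zmod_morphism : zmod_morphism conj.
Proof. by move=> x y; apply: gintP; rewrite //= opprD. Qed.
Fact conj_monoid_morphism : monoid_morphism conj.
Proof. by split=> [|x y]; apply: gintP; rewrite /=; ring. Qed.
HB.instance Definition _ := GRing.isZmodMorphism.Build gint gint conj conj_zmod_morphism.
HB.instance Definition _ := GRing.isMonoidMorphism.Build gint gint conj conj_monoid_morphism.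
Lemma conjK : involutive conj.
Proof. by move=> x; apply: gintP; rewrite //= opprK. Qed.
Lemma conj_int n : conj n%:~R = n%:~R.
Proof. by apply: gintP; rewrite /= ?re_int ?im_int. Qed.
Lemma norm_ge0 x : 0 <= norm x.
Proof. by rewrite /norm; nia. Qed.

Lemma norm_eq0 x : (norm x == 0) = (x == 0).
Proof.
apply/eqP/eqP => [|->] //; rewrite /norm => h.
by apply: gintP => /=; nia.
Qed.

Lemma normM x y : norm (x * y) = norm x * norm y.
Proof. by rewrite /norm reM imM; ring. Qed.
Lemma norm_conj x : norm (conj x) = norm x.
Proof. by rewrite /norm /=; ring. Qed.
Lemma mul_conj x : x * conj x = (norm x)%:~R.
Proof. by apply: gintP; rewrite ?re_int ?im_int /norm /=; ring. Qed.
Lemma norm_int n : norm n%:~R = n ^+ 2.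
Proof. by rewrite /norm re_int im_int; ring. Qed.
Definition gunit (x : gint) := norm x == 1.
Definition ginv (x : gint) := if gunit x then conj x else x.

Fact gmulV : {in gunit, left_inverse 1 ginv *%R}.
Proof.
move=> x ux; rewrite /ginv (_ : gunit x) // mulrC mul_conj.
by rewrite (eqP (ux : norm x == 1)).
Qed.

Fact int_mul1 (x y : int) : 0 <= x -> 0 <= y -> 1 = y * x -> x = 1.
Proof.
move=> x0 y0 e; have h : x = 0 \/ x = 1 \/ 1 < x by lia.
have h2 : y = 0 \/ 1 <= y by lia.
by case: h h2 e => [->|[->|?]] // [->|?]; nia.
Qed.

Fact gunitPl x y : y * x = 1 -> x \in gunit.
Proof.
move=> e; have := normM y x; rewrite e (_ : norm 1 = 1) // => h.
rewrite /in_mem /= /gunit; have := norm_ge0 x; have := norm_ge0 y => ? ?.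
by apply/eqP; exact: int_mul1 h.
Qed.

Fact ginv_out : {in [predC gunit], ginv =1 id}.
Proof. by move=> x /negPf nx; rewrite /ginv; case: ifP => // ux; rewrite /in_mem /= ux in nx. Qed.
HB.instance Definition _ :=
  GRing.ComNzRing_hasMulInverse.Build gint gmulV gunitPl ginv_out.

Fact gint_integral : GRing.integral_domain_axiom gint.
Proof.
move=> x y e; apply/orP; rewrite -!norm_eq0; have := normM x y; rewrite e.
by move/esym/eqP; rewrite -[norm 0]/(0 : int) mulf_eq0 => /orP.
Qed.

HB.instance Definition _ := GRing.ComUnitRing_isIntegral.Build gint gint_integral.
Lemma unit_norm x : (x \is a GRing.unit) = (norm x == 1).
Proof. by []. Qed.

Lemma gunit_cases x : norm x = 1 -> [\/ x = 1, x = -1, x = gi | x = - gi].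
Proof.
case: x => a b; rewrite /norm /= => h.
have [[-> ->]|[[-> ->]|[[-> ->]|[-> ->]]]] :
   (a = 1 /\ b = 0) \/ (a = -1 /\ b = 0) \/ (a = 0 /\ b = 1) \/ (a = 0 /\ b = -1) by nia.
- by constructor 1.
- by constructor 2.
- by constructor 3.
- by constructor 4.
Qed.

Definition gdvd (d x : gint) := exists z, x = d * z.
Lemma gdvdr d : gdvd d d. Proof. by exists 1; rewrite mulr1. Qed.
Lemma gdvd0 d : gdvd d 0. Proof. by exists 0; rewrite mulr0. Qed.
Lemma gdvdD d x y : gdvd d x -> gdvd d y -> gdvd d (x + y).
Proof. by case=> u -> [v ->]; exists (u + v); rewrite mulrDr. Qed.
Lemma gdvdN d x : gdvd d x -> gdvd d (- x).
Proof. by case=> u ->; exists (- u); rewrite mulrN. Qed.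
Lemma gdvdB d x y : gdvd d x -> gdvd d y -> gdvd d (x - y).
Proof. by move=> h /gdvdN; apply: gdvdD. Qed.
Lemma gdvdMl d x y : gdvd d x -> gdvd d (y * x).
Proof. by case=> u ->; exists (y * u); rewrite mulrCA. Qed.
Lemma gdvdMr d x y : gdvd d x -> gdvd d (x * y).
Proof. by case=> u ->; exists (u * y); rewrite mulrA. Qed.
Lemma gdvd_trans d x y : gdvd d x -> gdvd x y -> gdvd d y.
Proof. by move=> h [u ->]; apply: gdvdMr. Qed.
Lemma gdvd_conj d x : gdvd d x -> gdvd (conj d) (conj x).
Proof. by case=> u ->; exists (conj u); rewrite rmorphM. Qed.

Lemma gdvd1 d : gdvd d 1 -> norm d = 1.
Proof.
by case=> u e; have : d \is a GRing.unit; [apply/unitrPr; exists u | rewrite unit_norm => /eqP].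
Qed.

Lemma int_round (n m : int) : 0 < m -> exists q, - m <= 2%:Z * (n - q * m) <= m.
Proof.
move=> m0; exists ((2%:Z * n + m) %/ (2%:Z * m))%Z.
have m20 : (2%:Z * m != 0) by lia.
have := divz_eq (2%:Z * n + m) (2%:Z * m).
have := modz_ge0 (2%:Z * n + m) m20.
have := ltz_pmod (2%:Z * n + m) (_ : 0 < 2%:Z * m).
set q := (_ %/ _)%Z; set r := (_ %% _)%Z => /(_ ltac:(lia)) *.
lia.
Qed.

(** Rounding both coordinates of x / y leaves a remainder of norm at most half
    that of y. *)
Lemma gint_euclid x y : y != 0 -> exists q, norm (x - q * y) < norm y.
Proof.
move=> y0; have n0 : 0 < norm y by rewrite lt_neqAle eq_sym norm_eq0 y0 norm_ge0.
have [q1 h1] := int_round (re (x * conj y)) n0.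
have [q2 h2] := int_round (im (x * conj y)) n0.
exists (Gint q1 q2); set r := _ - _.
have e : r * conj y = x * conj y - Gint q1 q2 * (norm y)%:~R.
  by rewrite /r mulrBl -mulrA mul_conj.
have := normM r (conj y); rewrite norm_conj e {1}/norm.
rewrite !(reD, imD, reN, imN, reM (Gint _ _), imM (Gint _ _)) re_int im_int /=.
rewrite !mulr0 subr0 add0r.
set s := re _ - _ in h1 *; set t := im _ - _ in h2 *.
have := norm_ge0 r; set N := norm r; set M := norm y in n0 h1 h2 *; nia.
Qed.

Lemma gint_bezout x y : exists g u v, [/\ g = u * x + v * y, gdvd g x & gdvd g y].
Proof.
have [n] : exists n : nat, (absz (norm y) < n)%N by exists (absz (norm y)).+1.
elim: n x y => // n IH x y hn; case: (eqVneq y 0) => [->|y0].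
  by exists x, 1, 0; split; [ring | apply: gdvdr | apply: gdvd0].
have [q hq] := gint_euclid x y0.
have [|g [u [v [e h1 h2]]]] := IH y (x - q * y).
  have h0 := norm_ge0 (x - q * y). move: (norm _) (norm y) hq hn h0 => N M *. lia.
exists g, v, (u - v * q); split=> //; first by rewrite e; ring.
by rewrite -(subrK (q * y) x); apply: gdvdD => //; apply: gdvdMl.
Qed.

Definition gprime t := [/\ t != 0, norm t != 1
  & forall x y, gdvd t (x * y) -> gdvd t x \/ gdvd t y].

(** A divisor of least norm among the non-units is prime by Bezout, and it is
    found by descent on the norm. *)
Lemma gprime_exists x : norm x != 1 -> x != 0 -> exists2 t, gprime t & gdvd t x.
Proof.
have [n] : exists n : nat, (absz (norm x) < n)%N by exists (absz (norm x)).+1.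
elim: n x => // n IH x hn x1 x0.
case: (classic (exists2 t, gdvd t x & norm t != 1 /\ norm t < norm x)).
  case=> t tx [t1 tn].
  have t0 : t != 0 by apply: contraNneq x0 => t0; case: tx => u ->; rewrite t0 mul0r.
  have [|s sp st] := IH t _ t1 t0; first by have := norm_ge0 t; lia.
  by exists s => //; apply: gdvd_trans tx.
move=> H; exists x; last exact: gdvdr.
split=> // y z xyz; have [g [u [v [e gx gy]]]] := gint_bezout x y.
have [g1|g1] := eqVneq (norm g) 1.
  right; have : gdvd x (g * z).
    by rewrite e mulrDl; apply: gdvdD; [rewrite mulrAC; apply/gdvdMl/gdvdr | rewrite -mulrA; apply: gdvdMl].
  by move/(gdvdMl (conj g)); rewrite mulrA [conj g * g]mulrC mul_conj g1 mul1r.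
left; case: gx => w xw.
have gn : norm g = norm x.
  have := normM g w; rewrite -xw; have := norm_ge0 g; have := norm_ge0 w.
  have : norm x != 0 by rewrite norm_eq0.
  have : ~ (norm g < norm x) by move=> ?; apply: H; exists g; rewrite // xw; apply: gdvdMr; apply: gdvdr.
  move: (norm g) (norm w) (norm x) => G W X h1 h2 h3 h4 h5.
  have W0 : W <> 0 by move=> W0; rewrite W0 mulr0 in h5; rewrite h5 in h2.
  have : G <= G * W by nia.
  lia.
have w1 : norm w = 1.
  have := normM g w; rewrite -xw gn; have : norm x != 0 by rewrite norm_eq0.
  move: (norm w) (norm x) => W X h1 h2.
  by apply/eqP; rewrite -(inj_eq (mulfI h1)) mulr1 -h2.
case: gy => z' ->; exists (conj w * z').
by rewrite xw mulrA -(mulrA g) mul_conj w1 mulr1.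
Qed.

(** A prime divisor of an element of prime norm has the same norm, so that it is
    an associate. *)
Lemma gprime_norm_prime t (l : nat) : prime l -> norm t = l -> gprime t.
Proof.
move=> pl nt.
have t0 : t != 0 by rewrite -norm_eq0 nt; have := prime_gt0 pl; lia.
have t1 : norm t != 1 by rewrite nt; have := prime_gt1 pl; lia.
split=> // x y; have [s sp [w tw]] := gprime_exists t1 t0.
have [_ s1 sP] := sp.
have w1 : norm w = 1.
  have := normM s w; rewrite -tw nt => e.
  have [sn|wn] : `|norm s|%N = 1%N \/ `|norm w|%N = 1%N.
    have := congr1 absz e; rewrite abszM /= => {}e.
    have /primeP[_ /(_ `|norm s|%N)] := pl; rewrite e dvdn_mulr // => /(_ isT) /orP[] /eqP h; [by left|right].
    apply/eqP; rewrite -(eqn_pmul2l (_ : 0 < `|norm s|)%N) ?muln1 -?h //.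
    by have := prime_gt0 pl; rewrite e muln_gt0 => /andP[].
  - by have := norm_ge0 s; move: s1; lia.
  - by have := norm_ge0 w; lia.
have ts u : gdvd t u <-> gdvd s u.
  split; first by apply: gdvd_trans; exists w.
  by apply: gdvd_trans; exists (conj w); rewrite tw -mulrA mul_conj w1 mulr1.
by rewrite !ts; apply: sP.
Qed.

(** * Primes congruent to 1 modulo 8 and the form e^2 + 2 f^2 *)

Lemma int_parity (x : int) : exists y, x = 2%:Z * y \/ x = 2%:Z * y + 1.
Proof. by exists (x %/ 2)%Z; lia. Qed.

Lemma prime_sqr_mul (p : nat) (x y : int) : prime p -> x ^+ 2 = p%:Z * y ^+ 2 -> y = 0.
Proof.
move=> pp e; apply/eqP/negPn/negP => y0.
have {}e : (`|x| ^ 2 = p * `|y| ^ 2)%N by have := congr1 absz e; rewrite abszM !abszX.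
have y1 : (0 < `|y|)%N by rewrite absz_gt0.
have x1 : (0 < `|x|)%N.
  rewrite lt0n; apply/eqP => x0; have := prime_gt0 pp; move: e; rewrite x0; nia.
have := congr1 (logn p) e.
rewrite lognM ?expn_gt0 ?y1 ?prime_gt0 // !lognX (logn_prime p pp) eqxx.
by move/(congr1 odd); rewrite oddD !oddM.
Qed.

(** The witness is gcd(m, v): its square is m gcd(m, v, n), by m n = v^2. *)
Lemma coprime_mul_sqr (m n v : nat) : coprime m n -> (m * n = v ^ 2)%N -> exists s, m = (s ^ 2)%N.
Proof.
move=> c e; exists (gcdn m v).
have -> : (gcdn m v ^ 2 = gcdn (gcdn (m * m) (m * v)) (gcdn (m * v) (v * v)))%N.
  by rewrite -mulnn muln_gcdl !muln_gcdr (mulnC v m).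
rewrite -[(v * v)%N]/(v ^ 2)%N -e.
have -> : gcdn (gcdn (m * m) (m * v)) (gcdn (m * v) (m * n)) = (m * gcdn (gcdn m v) (gcdn v n))%N.
  by rewrite !muln_gcdr.
suff /eqP -> : gcdn (gcdn m v) (gcdn v n) == 1%N by rewrite muln1.
rewrite -dvdn1 -(eqP c) dvdn_gcd (dvdn_trans (dvdn_gcdl _ _)) ?dvdn_gcdl //.
by rewrite (dvdn_trans (dvdn_gcdr _ _)) ?dvdn_gcdr.
Qed.

Lemma sqrt_nat (n : nat) : exists f, (f * f <= n)%N && (n < f.+1 * f.+1)%N.
Proof.
elim: n => [|n [f /andP[h1 h2]]]; first by exists 0%N.
case: (leqP (f.+1 * f.+1) n.+1) => h; last by exists f; rewrite h ltnW.
by exists f.+1; rewrite h; lia.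
Qed.

(** Pigeonhole: there are more pairs (x, y) with 0 <= x, y <= sqrt n than
    residues of x - r y modulo n. *)
Lemma thue (n : nat) (r : int) : (0 < n)%N -> exists x y : int,
  [/\ (x != 0) || (y != 0), x ^+ 2 <= n%:Z, y ^+ 2 <= n%:Z & (n %| x - r * y)%Z].
Proof.
move=> n0; have [s /andP[h1 h2]] := sqrt_nat n.
have n0' : n%:Z != 0 by lia.
pose g (u : 'I_s.+1 * 'I_s.+1) : int := ((u.1%:Z - r * u.2%:Z) %% n)%Z.
have gP u : (`|g u| < n)%N.
  by have := modz_ge0 (u.1%:Z - r * u.2%:Z) n0'; have := ltz_pmod (u.1%:Z - r * u.2%:Z) (_ : 0 < n%:Z);
     rewrite -/(g u); lia.
pose f u := Ordinal (gP u).
have : ~~ injectiveb f by apply/injectiveP => /leq_card; rewrite card_prod !card_ord; lia.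
case/injectivePn=> -[x1 y1] [[x2 y2] ne /(congr1 val) /= ef].
have {ef} eg : g (x1, y1) = g (x2, y2).
  have := modz_ge0 (x1%:Z - r * y1%:Z) n0'; have := modz_ge0 (x2%:Z - r * y2%:Z) n0'.
  by move: ef; rewrite /g /=; lia.
exists (x1%:Z - x2%:Z), (y1%:Z - y2%:Z); split.
- apply: contraNT ne; rewrite negb_or !negbK !subr_eq0 => /andP[/eqP[e1] /eqP[e2]].
  by apply/eqP; congr (_, _); apply: val_inj.
- by have := ltn_ord x1; have := ltn_ord x2; nia.
- by have := ltn_ord y1; have := ltn_ord y2; nia.
- have -> : x1%:Z - x2%:Z - r * (y1%:Z - y2%:Z) = (x1%:Z - r * y1%:Z) - (x2%:Z - r * y2%:Z) by ring.
  by rewrite -eqz_mod_dvd; apply/eqP.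
Qed.

(** A generator of the cyclic group of units, of order p - 1 divisible by 8,
    raised to the power (p - 1) / 8. *)
Lemma ex_fourth_root (p : nat) : prime p -> (p = 1 %[mod 8])%N ->
  exists w : 'F_p, w ^+ 4 = -1.
Proof.
move=> pp p8; pose F := 'F_p : finFieldType.
have cF : #|F| = p by rewrite card_Fp.
have p1 : (0 < p.-1)%N by have := prime_gt1 pp; lia.
pose rs := [seq x <- enum F | x != 0].
have /hasP[z _ zp] : has (p.-1).-primitive_root rs.
  apply: has_prim_root; rewrite ?filter_uniq ?enum_uniq //.
    apply/allP=> x; rewrite mem_filter unity_rootE => /andP[x0 _].
    have := expf_card x; rewrite cF -(prednK (prime_gt0 pp)) exprS.
    by rewrite -[RHS]mulr1 => /(mulfI x0) ->.
    by rewrite -enumT enum_uniq.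
  have := count_predC (pred1 (0 : F)) (enum F); rewrite count_uniq_mem ?enum_uniq //.
  rewrite -cardE cF /rs size_filter => e; rewrite -subn1 leq_subLR -[X in (X <= _)%N]e.
  by rewrite leq_add // leq_b1.
exists (z ^+ (p %/ 8)); rewrite -exprM.
have h : (p %/ 8 * 4 * 2 = p.-1)%N by rewrite {2}(divn_eq p 8) p8; lia.
have : (z ^+ (p %/ 8 * 4)) ^+ 2 == 1 by rewrite -exprM h (prim_expr_order zp).
rewrite sqrf_eq1 => /orP[|/eqP //].
rewrite -(prim_order_dvd zp) => /dvdn_leq; lia.
Qed.

(** The square of w - w^-1 is -2 when w^4 = -1. *)
Lemma ex_sqrt_m2 (p : nat) : prime p -> (p = 1 %[mod 8])%N ->
  exists z : int, (p %| z ^+ 2 + 2%:Z)%Z.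
Proof.
move=> pp p8; have [w w4] := ex_fourth_root pp p8.
have w0 : w != 0 by apply: contra_eq_neq w4 => ->; rewrite expr0n /= eq_sym oppr_eq0 oner_neq0.
pose u : 'F_p := w - w^-1.
have e : u ^+ 2 + 2%:R = 0.
  have -> : u ^+ 2 + 2%:R = (w ^+ 4 + 1) / w ^+ 2 by rewrite /u; field.
  by rewrite w4 addNr mul0r.
exists (u : nat)%:Z; have /eqP := e; rewrite -[u]natr_Zp -natrX -natrD.
by rewrite -(dvdn_pcharf (pchar_Fp pp)) natr_Zp -[2%:Z]/(Posz 2) /dvdz.
Qed.

(** Lemma [thue] applied to a square root of -2 gives a multiple m p with m < 3. *)
Lemma prime_1mod8_form (p : nat) : prime p -> (p = 1 %[mod 8])%N ->
  exists e f : int, p%:Z = e ^+ 2 + 2%:Z * f ^+ 2.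
Proof.
move=> pp p8; have [z hz] := ex_sqrt_m2 pp p8.
have [x [y [xy0 hx hy]]] := thue z (prime_gt0 pp).
move=> /dvdzP[t ht]; case/dvdzP: hz => k hk.
have p0 := prime_gt0 pp.
have e : x ^+ 2 + 2%:Z * y ^+ 2 = p%:Z * (t * (x + z * y) + k * y ^+ 2).
  have -> : x ^+ 2 + 2%:Z * y ^+ 2 = (x - z * y) * (x + z * y) + (z ^+ 2 + 2%:Z) * y ^+ 2 by ring.
  by rewrite ht hk; ring.
set m := (_ + k * _) in e.
have xn : x ^+ 2 != p%:Z by apply/eqP=> h; have := @prime_sqr_mul p x 1 pp; rewrite h expr1n mulr1 => /(_ erefl).
have yn : y ^+ 2 != p%:Z by apply/eqP=> h; have := @prime_sqr_mul p y 1 pp; rewrite h expr1n mulr1 => /(_ erefl).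
have p0' : 0 < p%:Z by [].
have pos : 0 < x ^+ 2 + 2%:Z * y ^+ 2.
  by move: xy0 (sqr_ge0 x) (sqr_ge0 y); rewrite -(sqrf_eq0 x) -(sqrf_eq0 y); lia.
have m0 : 0 < m by move: pos; rewrite e pmulr_rgt0.
have m3 : m < 3%:Z by rewrite -(ltr_pM2l p0') -e; lia.
have [m1|m2] : m = 1 \/ m = 2%:Z by lia.
  by exists x, y; rewrite e m1 mulr1.
have [x' [ex|ex]] := int_parity x; rewrite m2 ex in e; clear -e; last by lia.
by exists y, x'; lia.
Qed.

(** * The two quadratic forms of discriminant -128 *)

(** The second supplement to quadratic reciprocity: [thue] makes l, up to sign,
    a value of a^2 - 2 b^2, which is 1 or 7 modulo 8 when odd. *)
Lemma prime_form2 (l : nat) (x y : int) : prime l -> odd l -> ~~ (l %| y)%Z ->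
  (l %| x ^+ 2 - 2%:Z * y ^+ 2)%Z -> (l%:Z = 1 %[mod 8])%Z \/ (l%:Z = 7 %[mod 8])%Z.
Proof.
move=> pl ol ly lxy; have l0 := prime_gt0 pl.
have [u hu] : exists u, (l %| u * y - 1)%Z.
  have : coprime l `|y|%N by rewrite prime_coprime.
  case/(coprimezP l%:Z y) => -[u v] /= e; exists v.
  by have -> : v * y - 1 = - u * l%:Z; [rewrite -e; ring | rewrite dvdz_mull].
have [a [b [ab0 ha hb]]] := thue (x * u) l0.
move=> /dvdzP[t ht]; case/dvdzP: lxy => k hk; case/dvdzP: hu => w hw.
have e : a ^+ 2 - 2%:Z * b ^+ 2 = l%:Z * (t * (a + x * u * b) + b ^+ 2 * (u ^+ 2 * k + 2%:Z * w * (u * y + 1))).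
  have -> : a ^+ 2 - 2%:Z * b ^+ 2 = (a - x * u * b) * (a + x * u * b) + b ^+ 2 * (u ^+ 2 * (x ^+ 2 - 2%:Z * y ^+ 2) + 2%:Z * (u * y - 1) * (u * y + 1)) by ring.
  by rewrite ht hk hw; ring.
set m := (t * _ + _) in e.
have an : a ^+ 2 != l%:Z by apply/eqP=> h; have := @prime_sqr_mul l a 1 pl; rewrite h expr1n mulr1 => /(_ erefl).
have bn : b ^+ 2 != l%:Z by apply/eqP=> h; have := @prime_sqr_mul l b 1 pl; rewrite h expr1n mulr1 => /(_ erefl).
have l0' : 0 < l%:Z by [].
have m1 : m < 1 by rewrite -(ltr_pM2l l0') -e; move: (sqr_ge0 b); lia.
have m2 : - 2%:Z < m by rewrite -(ltr_pM2l l0') -e; move: (sqr_ge0 a); lia.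
have m0 : m != 0.
  apply/eqP=> m0; move: e; rewrite m0 mulr0 => /eqP; rewrite subr_eq0 => /eqP e.
  have p2 : prime 2 by [].
  have b0 := prime_sqr_mul p2 e; move: ab0; rewrite -(sqrf_eq0 a) e b0.
  by rewrite expr0n mulr0 eqxx.
have {m0 m1 m2} m1 : m = -1 by lia.
rewrite m1 in e; clear -e ol.
have [a' [ea|ea]] := int_parity a; have [b' [eb|eb]] := int_parity b.
- by rewrite ea eb in e; lia.
- by rewrite ea in e; lia.
- have [c [ec|ec]] := int_parity a'; rewrite ea eb ec in e; lia.
- have [c [ec|ec]] := int_parity a'; have [d [ed|ed]] := int_parity b'; rewrite ea eb ec ed in e; lia.
Qed.

(** The residues 1 and 7 are closed under products, so prime factors l of n can
    be removed one at a time.  If l does not divide y, then 2 is a square modulo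
    l and [prime_form2] applies.  If l divides y, it divides b, hence not n',
    and l^2 divides n: dividing n, b^2 and y^2 by l^2 changes n by a factor 1
    modulo 8. *)
Lemma odd_part_mod8 (n n' b y : int) : (n %% 2)%Z = 1 -> n * n' = b ^+ 2 - 2%:Z * y ^+ 2 ->
  (forall l : nat, prime l -> (l %| n)%Z -> (l %| n')%Z -> (l %| b)%Z -> (l %| y)%Z -> False) ->
  (n = 1 %[mod 8])%Z \/ (n = 7 %[mod 8])%Z.
Proof.
have [N] : exists N : nat, (`|n| < N)%N by exists `|n|.+1.
elim: N n n' b y => // N IH n n' b y hN on e H.
case: (ltngtP `|n|%N 1%N) => [|n1|n1]; [lia | | lia].
have pl := pdiv_prime n1; set l := pdiv _ in pl.
have ln : (l %| n)%Z by exact: (pdiv_dvd `|n|%N).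
have [n1' en] := dvdzP ln.
have ol : odd l.
  have [c [ec|ec]] := int_parity l%:Z; last by clear -ec; lia.
  by move: on; rewrite en ec; clear; lia.
have l1 := prime_gt1 pl.
have lE (x : int) : (l %| x ^+ 2)%Z = (l %| x)%Z by rewrite !dvdzE abszX Euclid_dvdX ?andbT.
case: (boolP (l %| y)%Z) => ly; last first.
  have l8 : (l%:Z = 1 %[mod 8])%Z \/ (l%:Z = 7 %[mod 8])%Z.
    by apply: (@prime_form2 l b y pl ol ly); rewrite -e dvdz_mulr.
  have [||||n18|n18] := IH n1' (n' * l%:Z) b y.
  - have : (0 < `|n1'|)%N by move: on; rewrite en; clear; lia.
    move: hN; rewrite en abszM; clear -l1; rewrite (_ : `|l%:Z|%N = l) //; nia.
  - by move: on; rewrite en; clear -ol; move: n1' => u; have [c [ec|ec]] := int_parity u; rewrite ec; lia.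
  - by rewrite -e en; ring.
  - move=> l' pl' h1 h2 h3 h4; apply: (H l') => //; first by rewrite en dvdz_mulr.
    move: h2; rewrite !dvdzE abszM Euclid_dvdM // => /orP[//|].
    rewrite dvdn_prime2 // => /eqP ll; have {}ll : l' = l := ll.
    by move: h4; rewrite ll (negPf ly).
  - by rewrite en -modzMm n18 modzMm mul1r.
  - by rewrite en -modzMm n18; case: l8 => ->; [right|left].
have [y1 ey] := dvdzP ly.
have lb : (l %| b)%Z.
  rewrite -lE; apply/dvdzP; exists (n1' * n' + 2%:Z * y * y1).
  have -> : b ^+ 2 = n * n' + 2%:Z * y * y by rewrite e; ring.
  by rewrite en {2}ey; ring.
have ln' : ~~ (l %| n')%Z by apply/negP=> ?; apply: (H l).
have [b1 eb] := dvdzP lb.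
have l0 : l%:Z != 0 by lia.
have e1 : n1' * n' = l%:Z * (b1 ^+ 2 - 2%:Z * y1 ^+ 2).
  by apply: (mulfI l0); rewrite -[RHS]subr0 -[in RHS](subrr (n * n')) {1}e en eb ey; ring.
have : (l %| n1' * n')%Z by rewrite e1 dvdz_mulr.
rewrite !dvdzE abszM Euclid_dvdM // => /orP[|h]; last by rewrite dvdzE h in ln'.
move=> h; have /dvdzP[n2 en1] : (l %| n1')%Z by rewrite dvdzE.
have n20 : (0 < `|n2|)%N.
  by rewrite absz_gt0; apply/eqP=> n20; move: on; rewrite en en1 n20 !mul0r.
have l28 : (l%:Z * l%:Z = 1 %[mod 8])%Z.
  clear -ol; have [c [ec|ec]] := int_parity l%:Z; first by lia.
  have [d [ed|ed]] := int_parity c; rewrite ec ed; clear; lia.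
have E : n = n2 * (l%:Z * l%:Z) by rewrite en en1; ring.
have [||||n28|n28] := IH n2 n' b1 y1.
- move: hN n20 l1; rewrite E !abszM (_ : `|l%:Z|%N = l) //; clear => + + l1.
  have : (1 < l * l)%N by nia.
  by move: (l * l)%N `|n2|%N => u v; nia.
- move: on l28; rewrite E; move: (l%:Z * l%:Z); clear => u.
  by have [c [ec|ec]] := int_parity n2; rewrite ec; lia.
- by apply: (mulfI l0); rewrite -e1 en1; ring.
- move=> l' pl' h1 h2 h3 h4; apply: (H l') => //.
  + by rewrite E dvdz_mulr.
  + by rewrite eb dvdz_mulr.
  + by rewrite ey dvdz_mulr.
- by left; rewrite E -modzMm n28 l28.
- by right; rewrite E -modzMm n28 l28.
Qed.

Lemma odd_sqr_1mod4 (u : int) : exists v, (2%:Z * u + 1) ^+ 2 = (1 + 4%:Z * v) ^+ 2.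
Proof.
have [v [ev|ev]] := int_parity u; first by exists v; rewrite ev; ring.
by exists (- v - 1); rewrite ev; ring.
Qed.

Section FormParity.
Variables (p : nat) (a1 b1 : int).
Hypotheses (pp : prime p) (pE : p%:Z = (1 + 4%:Z * a1) ^+ 2 + (4%:Z * b1) ^+ 2).

(** With p = a^2 + b^2 = x^2 + 2 y^2 and a, x = 1 mod 4, the factors of
    (x + a)(x - a) = b^2 - 2 y^2 have no common prime with b and y, so the odd
    number (x + a) / 2 is 1 or 7 modulo 8. *)
Lemma form_factor_mod8 (x1 y : int) : p%:Z = (1 + 4%:Z * x1) ^+ 2 + 2%:Z * y ^+ 2 ->
  let n := 1 + 2%:Z * (x1 + a1) in (n = 1 %[mod 8])%Z \/ (n = 7 %[mod 8])%Z.
Proof.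
move=> e n; have on : (n %% 2)%Z = 1 by rewrite /n; lia.
apply: (@odd_part_mod8 n (8%:Z * (x1 - a1)) (4%:Z * b1) y on).
  have -> : (4%:Z * b1) ^+ 2 = p%:Z - (1 + 4%:Z * a1) ^+ 2 by rewrite pE; ring.
  by rewrite e /n; ring.
move=> l pl /dvdzP[u hu] /dvdzP[v hv] _ /dvdzP[w hw].
have lX : (l %| 1 + 4%:Z * x1)%Z.
  have : (l %| 4%:Z * (1 + 4%:Z * x1))%Z.
    apply/dvdzP; exists (4%:Z * u + v); rewrite mulrDl -mulrA -hu -hv /n; ring.
  rewrite !dvdzE abszM Euclid_dvdM // => /orP[|//].
  rewrite (_ : `|4%:Z|%N = (2 ^ 2)%N) // Euclid_dvdX // andbT dvdn_prime2 // => /eqP l2.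
  by move: on; rewrite hu (_ : l = 2%N) //; clear; lia.
have [x hx] := dvdzP lX.
have lp : l = p.
  apply/eqP; rewrite -dvdn_prime2 //.
  have : (l %| p%:Z)%Z by rewrite e hx hw; apply/dvdzP; exists (x * x * l%:Z + 2%:Z * w * w * l%:Z); ring.
  by rewrite dvdzE.
have : p%:Z * (p%:Z * (x ^+ 2 + 2%:Z * w ^+ 2)) = p%:Z * 1.
  by rewrite mulr1 [RHS]e hx hw lp; ring.
have p0 : p%:Z != 0 by have := prime_gt0 pp; lia.
move/(mulfI p0)/(congr1 absz); rewrite abszM => /eqP; rewrite muln_eq1 => /andP[/eqP].
by have := prime_gt1 pp; clear; lia.
Qed.

(** Here p = X^2 + 2 (4 y)^2, so X^2 = p = a^2 + b^2 modulo 32, which combined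
    with the residue of X + a gives a + b = 1 modulo 8. *)
Lemma form32_parity (x y : int) : p%:Z = x ^+ 2 + 32%:Z * y ^+ 2 -> ((a1 + b1) %% 2)%Z = 0.
Proof.
move=> e; have [u [eu|eu]] := int_parity x; first by move: e; rewrite pE eu; lia.
have [x1 ex] := odd_sqr_1mod4 u.
have e' : p%:Z = (1 + 4%:Z * x1) ^+ 2 + 2%:Z * (4%:Z * y) ^+ 2 by rewrite e eu ex; ring.
have /= := form_factor_mod8 e'; move: e'; rewrite pE; clear.
have [a2 ea] := int_parity a1; have [b2 eb] := int_parity b1; have [x2 exx] := int_parity x1.
by case: ea => ->; case: eb => ->; case: exx => ->; lia.
Qed.

(** Here p = (2 x + y)^2 + 8 y^2 with y odd, so the same comparison gives
    a + b = 5 modulo 8. *)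
Lemma form9_parity (x y : int) : p%:Z = 4%:Z * x ^+ 2 + 4%:Z * x * y + 9%:Z * y ^+ 2 ->
  ((a1 + b1) %% 2)%Z = 1.
Proof.
move=> e; have [y1 [ey|ey]] := int_parity y; first by move: e; rewrite pE ey; lia.
have [x1 ex] := odd_sqr_1mod4 (x + y1).
have e' : p%:Z = (1 + 4%:Z * x1) ^+ 2 + 2%:Z * (2%:Z * y) ^+ 2.
  by rewrite e -ex ey; ring.
have /= := form_factor_mod8 e'; move: e'; rewrite pE ey; clear.
have [a2 ea] := int_parity a1; have [b2 eb] := int_parity b1; have [x2 exx] := int_parity x1.
have [y2 ey] := int_parity y1.
by case: ea => ->; case: eb => ->; case: exx => ->; case: ey => ->; lia.
Qed.

End FormParity.

(** * The Pell equation and its negative *)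

Section Pell.
Variable D : nat.
Hypothesis D_nonsqr : forall x y : int, x ^+ 2 = D%:Z * y ^+ 2 -> y = 0.

(** With [sqrt_add_le]: addition of inequalities between u and sqrt E y, stated
    without square roots. *)
Lemma sqrt_add (E y z u v : int) : 0 <= E -> 0 <= y -> 0 <= z -> 0 <= u -> 0 <= v ->
  E * y ^+ 2 <= u ^+ 2 -> E * z ^+ 2 < v ^+ 2 -> E * (y + z) ^+ 2 < (u + v) ^+ 2.
Proof.
move=> E0 y0 z0 u0 v0 h1 h2.
have h : E * y * z <= u * v.
  rewrite -(@ler_pXn2r _ 2) ?nnegrE ?mulr_ge0 //.
  have -> : (E * y * z) ^+ 2 = (E * y ^+ 2) * (E * z ^+ 2) by ring.
  by rewrite exprMn ler_pM ?mulr_ge0 ?sqr_ge0 // ltW.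
have -> : E * (y + z) ^+ 2 = E * y ^+ 2 + E * z ^+ 2 + 2%:Z * (E * y * z) by ring.
have -> : (u + v) ^+ 2 = u ^+ 2 + v ^+ 2 + 2%:Z * (u * v) by ring.
by move: (E * y * z) (u * v) (E * y ^+ 2) (u ^+ 2) (E * z ^+ 2) (v ^+ 2) h h1 h2; lia.
Qed.

Lemma sqrt_add_le (E y z u v : int) : 0 <= E -> 0 <= y -> 0 <= z -> 0 <= u -> 0 <= v ->
  u ^+ 2 <= E * y ^+ 2 -> v ^+ 2 <= E * z ^+ 2 -> (u + v) ^+ 2 <= E * (y + z) ^+ 2.
Proof.
move=> E0 y0 z0 u0 v0 h1 h2.
have h : u * v <= E * y * z.
  rewrite -(@ler_pXn2r _ 2) ?nnegrE ?mulr_ge0 //.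
  have -> : (E * y * z) ^+ 2 = (E * y ^+ 2) * (E * z ^+ 2) by ring.
  by rewrite exprMn ler_pM ?sqr_ge0.
have -> : E * (y + z) ^+ 2 = E * y ^+ 2 + E * z ^+ 2 + 2%:Z * (E * y * z) by ring.
have -> : (u + v) ^+ 2 = u ^+ 2 + v ^+ 2 + 2%:Z * (u * v) by ring.
by move: (E * y * z) (u * v) (E * y ^+ 2) (u ^+ 2) (E * z ^+ 2) (v ^+ 2) h h1 h2; lia.
Qed.

(** Dirichlet approximation of sqrt D by integers.  The fractional parts of
    i sqrt D for 0 <= i <= Q fall in Q intervals of length 1 / Q; [F i] and [f
    i] are the integer parts of Q i sqrt D and i sqrt D. *)
Lemma dirichlet (Q : nat) : (0 < Q)%N -> exists x y : int,
  [/\ 0 < y, y <= Q%:Z, 0 <= x & Q%:Z * `|x ^+ 2 - D%:Z * y ^+ 2| <= 2%:Z * x].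
Proof.
move=> Q0.
have /fin_all_exists[f fP] : forall i : 'I_Q.+1, exists f, (f * f <= D * i ^ 2)%N && (D * i ^ 2 < f.+1 * f.+1)%N.
  by move=> i; apply: sqrt_nat.
have /fin_all_exists[F FP] : forall i : 'I_Q.+1, exists f, (f * f <= Q ^ 2 * (D * i ^ 2))%N && (Q ^ 2 * (D * i ^ 2) < f.+1 * f.+1)%N.
  by move=> i; apply: sqrt_nat.
have Ff i : (Q * f i <= F i)%N && (F i < Q * f i + Q)%N.
  have /andP[f1 f2] := fP i; have /andP[F1 F2] := FP i.
  move: (D * i ^ 2)%N f1 f2 F1 F2 => n f1 f2 F1 F2; apply/andP; split.
    rewrite leqNgt; apply/negP => h.
    have : ((F i).+1 * (F i).+1 <= Q ^ 2 * n)%N.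
      apply: leq_trans (leq_mul (leqnn (Q ^ 2)) f1).
      by rewrite -mulnn mulnACA leq_mul.
    by rewrite leqNgt F2.
  rewrite ltnNge; apply/negP; rewrite addnC -mulnS => h.
  have : (Q ^ 2 * n < F i * F i)%N.
    apply: leq_trans (leq_mul h h).
    by rewrite -mulnn mulnACA ltn_pmul2l ?muln_gt0 ?Q0.
  by rewrite ltnNge F1.
have tP i : (F i - Q * f i < Q)%N by have /andP[] := Ff i; clear -Q0; lia.
(* The interval of length 1 / Q that contains the fractional part of i sqrt D. *)
pose t i := Ordinal (tP i).
have : ~~ injectiveb t by apply/injectiveP => /leq_card; rewrite !card_ord ltnn.
case/injectivePn=> i [j ij /(congr1 val) /= tij].
wlog {ij} ij : i j tij / (i < j)%N => [H|].
  case: (ltngtP i j) => [|h|h]; [by apply: H | exact: (H j i) | ].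
  by case/eqP: ij; apply: val_inj.
have /andP[fi1 fi2] := Ff i; have /andP[fj1 fj2] := Ff j.
have eF : (F j)%:Z - (F i)%:Z = Q%:Z * ((f j)%:Z - (f i)%:Z).
  by move: tij fi1 fj1; clear; lia.
have ffle : (f i <= f j)%N.
  have /andP[h1 _] := fP i; have /andP[_ h2] := fP j.
  rewrite leqNgt; apply/negP => h.
  have : (f i * f i < f i * f i)%N; last by rewrite ltnn.
  apply: leq_ltn_trans h1 _; apply: leq_trans (leq_mul h h).
  apply: leq_ltn_trans h2; rewrite leq_mul2l leq_exp2r //; apply/orP; right; exact: ltnW.
have /andP[Fi1 Fi2] := FP i; have /andP[Fj1 Fj2] := FP j.
pose E : int := Q%:Z ^+ 2 * D%:Z; pose x : int := (f j)%:Z - (f i)%:Z.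
pose y : int := j%:Z - i%:Z; have E0 : 0 <= E by rewrite /E mulr_ge0 // sqr_ge0.
have y0 : 0 < y by rewrite /y; lia.
have x0 : 0 <= x by rewrite /x; lia.
have eFj : (F j)%:Z = Q%:Z * x + (F i)%:Z by rewrite -eF; ring.
have le1 (n k : nat) : (n * n <= Q ^ 2 * (D * k ^ 2))%N -> n%:Z ^+ 2 <= E * k%:Z ^+ 2.
  by rewrite -lez_nat !PoszM -!rmorphXn /= /E !mulrA.
have lt1 (n k : nat) : (Q ^ 2 * (D * k ^ 2) < n.+1 * n.+1)%N -> E * k%:Z ^+ 2 < (n%:Z + 1) ^+ 2.
  by rewrite -ltz_nat !PoszM -!rmorphXn /= /E !mulrA -addn1 PoszD.
have {}Fi1 := le1 _ _ Fi1; have {}Fj1 := le1 _ _ Fj1.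
have {}Fi2 := lt1 _ _ Fi2; have {}Fj2 := lt1 _ _ Fj2.
have ej : j%:Z = y + i%:Z by rewrite /y; ring.
exists x, y; split=> //; first by rewrite /y; have := ltn_ord j; lia.
have up : E * y ^+ 2 < (Q%:Z * x + 1) ^+ 2.
  rewrite ltNge; apply/negP => h.
  have := @sqrt_add_le E y i%:Z (Q%:Z * x + 1) (F i)%:Z E0 (ltW y0).
  rewrite -ej; have -> : Q%:Z * x + 1 + (F i)%:Z = (F j)%:Z + 1 by rewrite eFj; ring.
  move=> H; have {}H := H isT _ isT h Fi1.
  by move: Fj2; rewrite ltNge H // addr_ge0 ?mulr_ge0.
have lo : 0 < Q%:Z * x -> (Q%:Z * x - 1) ^+ 2 < E * y ^+ 2.
  move=> Qx; rewrite ltNge; apply/negP => h.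
  have := @sqrt_add E y i%:Z (Q%:Z * x - 1) ((F i)%:Z + 1) E0 (ltW y0).
  rewrite -ej; have -> : Q%:Z * x - 1 + ((F i)%:Z + 1) = (F j)%:Z by rewrite eFj; ring.
  move=> H; have {}H := H isT _ _ h Fi2.
  by move: Fj1; rewrite leNgt H //; move: Qx; clear; lia.
have Q0' : 0 < Q%:Z by [].
have xn : x <> 0.
  move=> x1; move: up; rewrite x1 mulr0 add0r expr1n => up.
  have : E * y ^+ 2 = 0.
    by apply/eqP; rewrite eq_le mulr_ge0 ?sqr_ge0 // andbT -ltzD1 add0r.
  move/eqP; rewrite mulf_eq0 sqrf_eq0 (gt_eqF y0) orbF mulf_eq0 sqrf_eq0 (gt_eqF Q0') => /eqP D0.
  by have := @D_nonsqr 0 1; rewrite D0 !mul0r expr0n => /(_ erefl).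
have Qx : 0 < Q%:Z * x by rewrite mulr_gt0 // lt_neqAle x0 andbT eq_sym; apply/eqP.
have {}lo := lo Qx.
have {up lo} : Q%:Z * (Q%:Z * `|x ^+ 2 - D%:Z * y ^+ 2|) < 2%:Z * (Q%:Z * x) + 1.
  have -> : Q%:Z * (Q%:Z * `|x ^+ 2 - D%:Z * y ^+ 2|) = `|(Q%:Z * x) ^+ 2 - E * y ^+ 2|.
    by rewrite mulrA -expr2 -{1}(gtr0_norm (exprn_gt0 2 Q0')) -normrM /E; congr `|_|; ring.
  have e1 : (Q%:Z * x + 1) ^+ 2 = (Q%:Z * x) ^+ 2 + 2%:Z * (Q%:Z * x) + 1 by ring.
  have e2 : (Q%:Z * x - 1) ^+ 2 = (Q%:Z * x) ^+ 2 - 2%:Z * (Q%:Z * x) + 1 by ring.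
  move: up lo; rewrite e1 e2; move: ((Q%:Z * x) ^+ 2) (Q%:Z * x) (E * y ^+ 2) => X Y Z.
  by clear; lia.
rewrite -(ler_pM2l Q0') => h; rewrite -ltzD1; apply: lt_le_trans h _.
by rewrite lerD2r mulrCA.
Qed.

Let nm (u : int * int) := u.1 ^+ 2 - D%:Z * u.2 ^+ 2.
Let C := (2 * (D + 2))%N.

Lemma D_gt0 : (0 < D)%N.
Proof.
by rewrite lt0n; apply/eqP=> D0; have := @D_nonsqr 0 1; rewrite D0 mul0r expr0n => /(_ erefl).
Qed.

Lemma nm_neq0 u : u.2 != 0 -> nm u != 0.
Proof. by apply: contraNneq => /eqP; rewrite subr_eq0 => /eqP /D_nonsqr ->. Qed.

(** Approximations of increasing quality have increasing denominators but
    bounded norm x^2 - D y^2. *)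
Lemma small_norm (B : nat) : exists u : int * int, [/\ B%:Z < u.2, 0 < u.2 & `|nm u| <= C%:Z].
Proof.
have D0 := D_gt0; pose Q := (C * B.+1)%N.
have [|x [y [y0 yQ x0 h]]] := @dirichlet Q; first by rewrite /Q /C; lia.
have n1 : 1 <= `|nm (x, y)| by have := nm_neq0 (lt0r_neq0 y0 : (x, y).2 != 0); lia.
have Q1 : 1 <= Q%:Z by rewrite /Q /C; lia.
have xb : x <= (D%:Z + 2%:Z) * y.
  have nx : `|nm (x, y)| <= 2%:Z * x.
    by apply: le_trans h; rewrite -/(nm (x, y)) ler_peMl.
  have : (x - 1) ^+ 2 <= (D%:Z * y + 1) ^+ 2.
    have : D%:Z * y ^+ 2 <= (D%:Z * y) ^+ 2 by rewrite exprMn ler_wpM2r ?sqr_ge0 // ler_eXnr.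
    have : 0 < D%:Z * y by rewrite mulr_gt0.
    have -> : (x - 1) ^+ 2 = x ^+ 2 - 2%:Z * x + 1 by ring.
    have -> : (D%:Z * y + 1) ^+ 2 = (D%:Z * y) ^+ 2 + 2%:Z * (D%:Z * y) + 1 by ring.
    move: nx; rewrite /nm /=; move: (x ^+ 2) (y ^+ 2) ((D%:Z * y) ^+ 2) (D%:Z * y) => X Y Z T.
    by move: (D%:Z * Y) => W; clear; lia.
  case: (lerP x 1) => [x1 _|x1].
    apply: le_trans x1 _; rewrite mulrDl; have : 0 < D%:Z * y by rewrite mulr_gt0.
    by move: (D%:Z * y) y0; clear; lia.
  have h1 : 0 <= x - 1 by clear -x1; lia.
  have h2 : 0 <= D%:Z * y + 1 by rewrite addr_ge0 // mulr_ge0 // ltW.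
  rewrite ler_pXn2r ?nnegrE //.
  by rewrite mulrDl; move: (D%:Z * y) y0; clear; lia.
have h2 : Q%:Z * `|nm (x, y)| <= C%:Z * y.
  apply: le_trans h _; rewrite /C PoszM PoszD -mulrA ler_pM2l //.
exists (x, y); split=> //=.
- have : C%:Z * B.+1%:Z <= C%:Z * y.
    by apply: le_trans h2; rewrite -PoszM -/Q ler_peMr.
  by rewrite ler_pM2l; [lia | rewrite /C; clear; lia].
- have Q0 : 0 < Q%:Z by lia.
  rewrite -(ler_pM2l Q0); apply: le_trans h2 _.
  by rewrite mulrC ler_pM2r // /C; clear; lia.
Qed.

Lemma small_norms (m : nat) : exists s : seq (int * int), [/\ size s = m,
  uniq (map snd s), exists B : nat, forall u, u \in s -> u.2 <= B%:Z
  & forall u, u \in s -> 0 < u.2 /\ `|nm u| <= C%:Z].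
Proof.
elim: m => [|m [s [sm us [B hB] hs]]]; first by exists [::]; split=> //; exists 0%N.
have [u [uB u0 uC]] := small_norm B; exists (u :: s); split; rewrite /= ?sm ?us ?andbT //.
- by apply/negP=> /mapP[v vs e]; have := hB v vs; rewrite -e leNgt uB.
- exists `|u.2|%N => v; rewrite inE => /orP[/eqP ->|/hB]; [lia|].
  by move: uB; move: (u.2) (v.2); clear; lia.
- by move=> v; rewrite inE => /orP[/eqP ->|/hs].
Qed.

(** Of sufficiently many pairs of bounded norm, two have the same norm n and are
    congruent modulo n, which makes their quotient integral; it is nontrivial
    because their second components differ. *)
Lemma pell : exists x y : int, x ^+ 2 - D%:Z * y ^+ 2 = 1 /\ y != 0.
Proof.
pose T := ('I_(2 * C).+1 * 'I_C.+1 * 'I_C.+1)%type.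
pose cls (u : int * int) : T := (inord `|(nm u + C%:Z)%R|%N,
  inord `|(u.1 %% nm u)%Z|%N, inord `|(u.2 %% nm u)%Z|%N).
have [s [sm us _ hs]] := small_norms #|{: T}|.+1.
have : ~~ uniq (map cls s).
  apply/negP=> /card_uniqP e; have := max_card (mem (map cls s)).
  by rewrite e size_map sm ltnn.
case/(uniqPn (cls (0, 0))) => i [j]; rewrite size_map => -[ij js].
rewrite !(nth_map (0, 0)) //; last by apply: ltn_trans js.
set u := nth _ _ i; set v := nth _ _ j => e.
have uS : u \in s by apply: mem_nth; apply: ltn_trans js.
have vS : v \in s by apply: mem_nth.
have uv : u.2 != v.2.
  have := nth_uniq 0 _ _ us; move/(_ i j); rewrite size_map js (ltn_trans ij js) => /(_ isT isT).
  by rewrite !(nth_map (0, 0)) ?(ltn_trans ij js) // -/u -/v (ltn_eqF ij) => ->.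
have [u0 uC] := hs u uS; have [v0 vC] := hs v vS.
have nu := nm_neq0 (lt0r_neq0 u0); have nv := nm_neq0 (lt0r_neq0 v0).
case: e => /(congr1 val) /= e1 /(congr1 val) /= e2 /(congr1 val) /= e3.
have en : nm u = nm v.
  by move: e1; rewrite !inordK; move: (nm u) (nm v) uC vC; clear => a b; lia.
have modlt (a n : int) : n != 0 -> `|n| <= C%:Z -> (`|(a %% n)%Z| < C.+1)%N.
  move=> n0 nC; have := modz_ge0 a n0; have := ltz_mod a n0.
  by move: (a %% n)%Z => r; move: nC; clear; lia.
have modeq (a b : int) : inord `|(a %% nm u)%Z|%N = inord `|(b %% nm v)%Z|%N :> 'I_C.+1 ->
   exists k, a = b + k * nm u.
  move/(congr1 val); rewrite /= !inordK ?modlt // -?en // => e.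
  have := modz_ge0 a nu; have := modz_ge0 b nu => h1 h2.
  have {}e : (a %% nm u)%Z = (b %% nm u)%Z by move: e h1 h2; clear; lia.
  exists ((a %/ nm u)%Z - (b %/ nm u)%Z).
  by rewrite {1}(divz_eq a (nm u)) {1}(divz_eq b (nm u)) e; ring.
have [k1 ek1] := modeq u.1 v.1 (val_inj e2).
have [k2 ek2] := modeq u.2 v.2 (val_inj e3).
set n := nm u in nu ek1 ek2 en *.
have nE : v.1 ^+ 2 - D%:Z * v.2 ^+ 2 = n by rewrite en.
have nE' : (v.1 + k1 * n) ^+ 2 - D%:Z * (v.2 + k2 * n) ^+ 2 = n by rewrite -ek1 -ek2.
pose X := 1 + k1 * v.1 - D%:Z * k2 * v.2; pose Y := k2 * v.1 - k1 * v.2.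
have eX : n * X = u.1 * v.1 - D%:Z * u.2 * v.2.
  by rewrite ek1 ek2 /X -{1}nE -{1 2}nE; ring.
have eY : n * Y = u.2 * v.1 - u.1 * v.2 by rewrite ek1 ek2 /Y; ring.
have uE : u.1 ^+ 2 - D%:Z * u.2 ^+ 2 = n by [].
exists X, Y; split.
  have n2 : n ^+ 2 != 0 by rewrite expf_neq0.
  have e4 : n ^+ 2 = (u.1 ^+ 2 - D%:Z * u.2 ^+ 2) * (v.1 ^+ 2 - D%:Z * v.2 ^+ 2).
    by rewrite uE nE expr2.
  apply: (mulfI n2); rewrite mulr1 [RHS]e4.
  have -> : n ^+ 2 * (X ^+ 2 - D%:Z * Y ^+ 2) = (n * X) ^+ 2 - D%:Z * (n * Y) ^+ 2 by ring.
  by rewrite eX eY; ring.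
apply/eqP=> Y0; move: eY; rewrite Y0 mulr0 => /esym/eqP; rewrite subr_eq0 => /eqP eY.
have : n * v.2 ^+ 2 = n * u.2 ^+ 2.
  rewrite -{1}uE.
  have -> : (u.1 ^+ 2 - D%:Z * u.2 ^+ 2) * v.2 ^+ 2 = (u.1 * v.2) ^+ 2 - D%:Z * (u.2 * v.2) ^+ 2 by ring.
  by rewrite -eY -nE; ring.
move/(mulfI nu)/eqP; rewrite eqrXn2 ?ltW // => /eqP h.
by rewrite h eqxx in uv.
Qed.

End Pell.

(** Descent on the positive solutions of X^2 = p Y^2 + 1.  Such an X is odd, and
    the consecutive integers (X - 1) / 2 and (X + 1) / 2 have product p v^2, so
    that one of them is s^2 and the other p t^2.  In one case this is a smaller
    solution, in the other a solution of the negative equation. *)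
Lemma neg_pell (p : nat) : prime p -> (p = 1 %[mod 4])%N ->
  exists t s : int, t ^+ 2 + 1 = p%:Z * s ^+ 2.
Proof.
move=> pp p4; have [x [y [e y0]]] := pell (fun x y => @prime_sqr_mul p x y pp).
have [X [Y [{}e {}y0]]] : exists X Y : nat, (X ^ 2 = p * Y ^ 2 + 1)%N /\ (0 < Y)%N.
  exists `|x|%N, `|y|%N; split; last by rewrite absz_gt0.
  apply/eqP; rewrite -eqz_nat PoszD PoszM -!abszX !gez0_abs ?sqr_ge0 //.
  by move/eqP: e; rewrite subr_eq addrC.
clear x y; have [n hn] : exists n, (Y < n)%N by exists Y.+1.
elim: n X Y hn e y0 => // n IH X Y hn e y0.
have p0 := prime_gt0 pp.
have [k pk] : exists k, p = (4 * k + 1)%N by exists (p %/ 4)%N; rewrite {1}(divn_eq p 4) p4; lia.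
have nat_parity (m : nat) : exists h, (m = 2 * h \/ m = 2 * h + 1)%N by exists m./2; lia.
have [a ha] := nat_parity X; have [v hv] := nat_parity Y.
have Yv : Y = (2 * v)%N.
  case: hv => // hv; move: e; rewrite pk hv.
  by case: ha => ->; clear; lia.
have [u Xu] : exists u, X = (2 * u + 1)%N.
  case: ha => ha; [|by exists a]; move: e; rewrite Yv ha; clear; lia.
have euv : (u * u.+1 = p * v ^ 2)%N by move: e; rewrite Xu Yv; clear; lia.
have cu : coprime u u.+1 by rewrite coprimenS.
have v0 : (0 < v)%N by lia.
have : (p %| u * u.+1)%N by rewrite euv dvdn_mulr.
rewrite Euclid_dvdM // => /orP[] /dvdnP[w hw].
(* Here u = p s^2 and u + 1 = t^2: a smaller solution. *)
- have ewv : (w * u.+1 = v ^ 2)%N.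
    by apply/eqP; rewrite -(eqn_pmul2l p0) -euv {2}hw; apply/eqP; ring.
  have cw : coprime w u.+1 by move: cu; rewrite {1}hw coprimeMl => /andP[].
  have [s sE] := coprime_mul_sqr cw ewv.
  have [t tE] : exists t, u.+1 = (t ^ 2)%N.
    by apply: (@coprime_mul_sqr _ w v); rewrite 1?coprime_sym // mulnC.
  apply: (IH t s); last 2 first.
  + by rewrite -tE hw sE; clear; lia.
  + by rewrite lt0n; apply/eqP=> s0; move: ewv v0; rewrite sE s0; clear; nia.
  have vst : v = (s * t)%N.
    by apply/eqP; rewrite -(eqn_exp2r _ _ (isT : (0 < 2)%N)) -ewv expnMn sE tE.
  have t0 : (0 < t)%N by rewrite lt0n; apply/eqP=> t0; move: tE; rewrite t0.
  have : (s <= v)%N by rewrite vst leq_pmulr.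
  by move: hn v0; rewrite Yv; clear; lia.
(* Here u = t^2 and u + 1 = p s^2. *)
- have ewv : (w * u = v ^ 2)%N.
    by apply/eqP; rewrite -(eqn_pmul2l p0) -euv hw; apply/eqP; ring.
  have cw : coprime w u by move: cu; rewrite hw coprimeMr coprime_sym => /andP[].
  have [s sE] := coprime_mul_sqr cw ewv.
  have [t tE] : exists t, u = (t ^ 2)%N.
    by apply: (@coprime_mul_sqr _ w v); rewrite 1?coprime_sym // mulnC.
  exists t%:Z, s%:Z; move: hw; rewrite sE tE; clear; lia.
Qed.

(** * Gaussian integers modulo powers of 1 + i *)

Lemma gi2 : gi * gi = -1. Proof. exact: gintP. Qed.
Lemma lamE : lam = 1 + gi. Proof. exact: gintP. Qed.
Lemma lam2 : lam * lam = 2%:R * gi. Proof. exact: gintP. Qed.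
Lemma two_lam : 2%:R = - gi * (lam * lam).
Proof. by rewrite lam2 mulrCA mulNr gi2 opprK mulr1. Qed.
Lemma gprime_lam : gprime lam.
Proof. exact: (@gprime_norm_prime lam 2). Qed.

Lemma gdvd_lamP x : gdvd lam x <-> ((re x + im x) %% 2)%Z = 0.
Proof.
split=> [[[u v] ->]|h]; first by rewrite reM imM /=; lia.
exists (Gint ((re x + im x) %/ 2)%Z ((im x - re x) %/ 2)%Z).
by apply: gintP; rewrite /=; lia.
Qed.

Lemma lam_dvd_dec x : gdvd lam x \/ gdvd lam (x - 1).
Proof. by rewrite !gdvd_lamP reD imD /= ; lia. Qed.
Lemma lam_ndvd1 : ~ gdvd lam 1.
Proof. by move/gdvd1. Qed.

Lemma lam_odd y : ~ gdvd lam (1 + lam * y).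
Proof.
move=> h; apply: lam_ndvd1; rewrite -(addrK (lam * y) 1).
by apply: gdvdB h (gdvdMr _ (gdvdr _)).
Qed.

Definition gint_simp := (reD, imD, reM, imM, reN, imN, re_nat, im_nat, re_int, im_int).

Lemma odd_sqr_real u v : (u %% 2)%Z = 1 -> (v %% 2)%Z = 0 ->
  exists y z, Gint u v = 1 + 2%:R * y /\ Gint u v ^+ 2 = 1 + 4%:R * lam * z.
Proof.
have half (k : int) : exists h, k * (k + 1) = 2%:Z * h.
  have [j [->|->]] := int_parity k; [exists (j * (2%:Z * j + 1)) | exists ((2%:Z * j + 1) * (j + 1))]; ring.
move=> hu hv; have [k ek] : exists k, u = 2%:Z * k + 1 by exists (u %/ 2)%Z; lia.
have [m em] : exists m, v = 2%:Z * m by exists (v %/ 2)%Z; lia.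
have [h1 e1] := half k; have [h2 e2] := half m; rewrite {}ek {}em; clear -e1 e2.
exists (Gint k m), (Gint (h1 + k * m - h2 + m) (k * m - h1 + h2)).
by split; apply: gintP; rewrite ?expr2 !gint_simp /=; lia.
Qed.

(** Modulo 2 an odd Gaussian integer is 1 or i, and modulo 4 lam its square is 1
    or -1 accordingly. *)
Lemma odd_cases x : ~ gdvd lam x ->
  (exists y z, x = 1 + 2%:R * y /\ x ^+ 2 = 1 + 4%:R * lam * z) \/
  (exists y z, x = gi + 2%:R * y /\ x ^+ 2 = - 1 + 4%:R * lam * z).
Proof.
case: x => u v; rewrite gdvd_lamP /= => h.
have [e|e] : (u %% 2)%Z = 1 /\ (v %% 2)%Z = 0 \/ (u %% 2)%Z = 0 /\ ((- v) %% 2)%Z = 1 by lia.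
  by left; apply: odd_sqr_real; case: e.
right; have [||y [z [e1 e2]]] := @odd_sqr_real (- v) u; [by case: e.. |].
have ex : Gint u v = - gi * Gint (- v) u by apply: gintP => /=; lia.
exists (- gi * y - gi), (- z); split.
  rewrite ex e1; ring.
rewrite ex exprMn e2; have -> : (- gi) ^+ 2 = -1 by rewrite sqrrN expr2 gi2.
ring.
Qed.

Lemma gi_sub1_odd2 y : gi - 1 = 2%:R * y -> False.
Proof. by move/(congr1 im); rewrite !gint_simp /=; lia. Qed.

(** * The conic A^2 - pi B^2 = conj pi C^2 *)

Section Conic.
Variables (p : nat) (pi1 : gint).
Hypotheses (pp : prime p) (p8 : (p = 1 %[mod 8])%N).
Let pi := 1 + 4%:R * pi1.
Let pi' := conj pi.
Hypothesis npi : norm pi = p%:Z.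
Lemma conj_primary : conj (1 + 4%:R * pi1) = 1 + 4%:R * conj pi1.
Proof. by rewrite rmorphD rmorphM rmorph1 rmorph_nat. Qed.
Lemma pipi' : pi * pi' = p%:R.
Proof. by rewrite /pi' mul_conj npi. Qed.
Lemma gprime_pi : gprime pi. Proof. exact: gprime_norm_prime npi. Qed.
Lemma gprime_pi' : gprime pi'.
Proof. by apply: (gprime_norm_prime pp); rewrite norm_conj. Qed.
Definition conic (A B C : gint) := A ^+ 2 - pi * B ^+ 2 = pi' * C ^+ 2.
Definition coprime3 (A B C : gint) :=
  forall t, gdvd t A -> gdvd t B -> gdvd t C -> norm t = 1.
Lemma nz3 A B C : coprime3 A B C -> ~ [/\ A = 0, B = 0 & C = 0].
Proof. by move=> h [h1 h2 h3]; have := h 0; rewrite h1 h2 h3 => /(_ (gdvd0 _) (gdvd0 _) (gdvd0 _)). Qed.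

Lemma bezout3 A B C : coprime3 A B C -> exists u v w, u * A + v * B + w * C = 1.
Proof.
move=> h; have [g [u [v [eg gA gB]]]] := gint_bezout A B.
have [f [s [t [ef fg fC]]]] := gint_bezout g C.
have f1 : norm f = 1 by apply: h => //; apply: gdvd_trans fg _.
exists (conj f * s * u), (conj f * s * v), (conj f * t).
transitivity (conj f * f); last by rewrite mulrC mul_conj f1.
by move: (conj f) => f'; rewrite ef eg; ring.
Qed.

Lemma conic_conj A B C : conic A B C -> conj A ^+ 2 - pi' * conj B ^+ 2 = pi * conj C ^+ 2.
Proof. by move/(congr1 conj); rewrite !(rmorphB, rmorphXn, rmorphM) /= conjK. Qed.

(** Coprimality of the triple forces pairwise coprimality away from p: by the
    equation, a prime dividing two terms divides the third. *)
Lemma conic_common t A B C : conic A B C -> coprime3 A B C -> gprime t -> ~ gdvd t p%:R ->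
  [/\ ~ (gdvd t A /\ gdvd t B), ~ (gdvd t A /\ gdvd t C) & ~ (gdvd t B /\ gdvd t C)].
Proof.
move=> cA co tp tnp; have [_ t1 tP] := tp.
have sq x : gdvd t (x ^+ 2) -> gdvd t x by rewrite expr2 => /tP[].
have np : ~ gdvd t pi by move=> h; apply: tnp; rewrite -pipi'; apply: gdvdMr.
have np' : ~ gdvd t pi' by move=> h; apply: tnp; rewrite -pipi'; apply: gdvdMl.
have no : ~ [/\ gdvd t A, gdvd t B & gdvd t C].
  by case=> h1 h2 h3; case/negP: t1; apply/eqP; apply: co.
have e1 : pi' * C ^+ 2 = A * A - pi * B * B by rewrite -cA; ring.
have e2 : pi * B ^+ 2 = A * A - pi' * C * C by rewrite -mulrA -expr2 -cA; ring.
have e3 : A ^+ 2 = pi * B * B + pi' * C * C by rewrite -(mulrA pi') -[C * C]expr2 -cA; ring.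
split=> -[h1 h2]; apply: no; split=> //; apply: sq.
- by case: (tP _ _ (_ : gdvd t (pi' * C ^+ 2))) => //; rewrite e1; apply: gdvdB; apply: gdvdMl.
- by case: (tP _ _ (_ : gdvd t (pi * B ^+ 2))) => //; rewrite e2; apply: gdvdB; apply: gdvdMl.
- by rewrite e3; apply: gdvdD; apply: gdvdMl.
Qed.

Lemma lam_ndvd_p : ~ gdvd lam p%:R.
Proof. by rewrite gdvd_lamP re_nat im_nat; move: p8; clear; lia. Qed.

Lemma conic_parity A B C : conic A B C -> (gdvd lam (A + B) <-> gdvd lam C).
Proof using.
rewrite /conic /pi' /pi conj_primary => /(congr1 (fun x => (re x + im x)%R)).
case: A B C => [a a'] [b b'] [c c']; rewrite !gdvd_lamP !expr2 !gint_simp /=; clear.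
have [? [->|->]] := int_parity a; have [? [->|->]] := int_parity a';
have [? [->|->]] := int_parity b; have [? [->|->]] := int_parity b';
have [? [->|->]] := int_parity c; have [? [->|->]] := int_parity c'; lia.
Qed.

End Conic.
Lemma gnat_neq0 n : (0 < n)%N -> n%:R != 0 :> gint.
Proof. by move=> n0; apply/eqP=> /(congr1 re); rewrite re_nat => -[]; lia. Qed.
Lemma gint_parity1 w : 1 = 2%:R * w :> gint -> False.
Proof. by move/(congr1 re); rewrite !gint_simp /=; lia. Qed.

(** An odd square is 1 or -1 modulo 4, so the left-hand side is 2, 0 or -2
    modulo 4.  In the cases 2 and -2, dividing by 2 makes i congruent to 1 or 0
    congruent to 1 modulo 2; in the case 0, z^2 is even and x, y have different
    residues modulo 2. *)
Lemma odd_sqr_sum u v w x y z : ~ gdvd lam x -> ~ gdvd lam y ->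
  (1 + 4%:R * u) * x ^+ 2 + (1 + 4%:R * v) * y ^+ 2 = 2%:R * gi * (1 + 4%:R * w) * z ^+ 2 ->
  gdvd lam z /\
  ((exists x1 y1, x = 1 + 2%:R * x1 /\ y = gi + 2%:R * y1) \/
   (exists x1 y1, x = gi + 2%:R * x1 /\ y = 1 + 2%:R * y1)).
Proof.
move=> ox oy; have n2 : 2%:R != 0 :> gint by apply: gnat_neq0.
have l2 t : gdvd lam (2%:R * t).
  by rewrite two_lam; apply/gdvdMr/gdvdMl/gdvdMr/gdvdr.
have opp t : 2%:R * gi * (1 + 4%:R * w) * z ^+ 2 = 4%:R * t -> gdvd lam z.
  move=> e; have {}e : gi * (1 + 4%:R * w) * z ^+ 2 = 2%:R * t.
    by apply: (mulfI n2); transitivity (4%:R * t); [rewrite -e; ring | ring].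
  have : gdvd lam (gi * (1 + 4%:R * w) * z ^+ 2) by rewrite e.
  have [_ _ lP] := gprime_lam; rewrite expr2.
  case/lP; last by case/lP.
  case/lP => [/gdvd_lamP //|h]; suff /lam_ndvd1 : gdvd lam 1 by [].
  have -> : 1 = (1 + 4%:R * w) - 2%:R * (2%:R * w) by ring.
  exact: gdvdB.
have same e t : e ^+ 2 = 1 -> 2%:R * gi * (1 + 4%:R * w) * z ^+ 2 = 2%:R * e + 4%:R * t -> False.
  move=> e1 E; have {}E : gi * (1 + 4%:R * w) * z ^+ 2 = e + 2%:R * t.
    by apply: (mulfI n2); transitivity (2%:R * e + 4%:R * t); [rewrite -E; ring | ring].
  have [s {}E] : exists s, gi * z ^+ 2 * e = 1 + 2%:R * s.
    exists (t * e - gi * 2%:R * w * z ^+ 2 * e).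
    have -> : gi * z ^+ 2 * e = gi * (1 + 4%:R * w) * z ^+ 2 * e - 4%:R * gi * w * z ^+ 2 * e by ring.
    by rewrite E mulrDl -expr2 e1; ring.
  have [zl|zo] := classic (gdvd lam z).
    case: zl E => z' ->; rewrite exprMn (expr2 lam) lam2 => E.
    apply: (@gint_parity1 (gi * (gi * z' ^+ 2) * e - s)).
    by transitivity (1 + 2%:R * s - 2%:R * s); [ring | rewrite -E; ring].
  have [f [r [f1 E2]]] : exists f r, f ^+ 2 = 1 /\ z ^+ 2 = f + 2%:R * r.
    case: (odd_cases zo) => [[_ [r [_ ->]]]|[_ [r [_ ->]]]].
      by exists 1, (2%:R * lam * r); split; ring.
    by exists (-1), (2%:R * lam * r); split; ring.
  have gE : gi * (f * e) - 1 = 2%:R * (s - gi * r * e).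
    by rewrite E2 in E; transitivity (gi * (f + 2%:R * r) * e - 1 - 2%:R * (gi * r * e)); [|rewrite E]; ring.
  have /eqP : (f * e) ^+ 2 = 1 by rewrite exprMn e1 f1 mulr1.
  rewrite sqrf_eq1 => /orP[] /eqP fe; rewrite fe in gE.
    by apply: (@gi_sub1_odd2 (s - gi * r * e)); rewrite -gE mulr1.
  by apply: (@gi_sub1_odd2 (- 1 - (s - gi * r * e))); rewrite mulrBr -gE; ring.
move=> E; case: (odd_cases ox) => [[x1 [r [ex ex2]]]|[x1 [r [ex ex2]]]];
  case: (odd_cases oy) => [[y1 [t [ey ey2]]]|[y1 [t [ey ey2]]]]; rewrite ex2 ey2 in E.
- exfalso; apply: (same 1 (u + v + (1 + 4%:R * u) * lam * r + (1 + 4%:R * v) * lam * t)).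
    by rewrite expr1n.
  by rewrite -E; ring.
- split; last by left; exists x1, y1.
  by apply: (opp (u - v + (1 + 4%:R * u) * lam * r + (1 + 4%:R * v) * lam * t)); rewrite -E; ring.
- split; last by right; exists x1, y1.
  by apply: (opp (v - u + (1 + 4%:R * u) * lam * r + (1 + 4%:R * v) * lam * t)); rewrite -E; ring.
- exfalso; apply: (same (-1) (- u - v + (1 + 4%:R * u) * lam * r + (1 + 4%:R * v) * lam * t)).
    by rewrite sqrrN expr1n.
  by rewrite -E; ring.
Qed.

Section Types.
Variables (p : nat) (pi1 : gint).
Hypotheses (pp : prime p) (p8 : (p = 1 %[mod 8])%N).
Let pi := 1 + 4%:R * pi1.
Let pi' := conj pi.
Hypothesis npi : norm pi = p%:Z.

(** If A and C are odd and B = lam B1, the equation reads A^2 + pi' (i C)^2 =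
    2 i pi B1^2, and [odd_sqr_sum] shows that B1 is divisible by lam. *)
Lemma conic_B_even A B C : conic pi1 A B C -> ~ gdvd lam A -> gdvd lam B -> exists B1, B = 2%:R * B1.
Proof.
move=> c oA [B1 eB].
have oC : ~ gdvd lam C.
  move/(conic_parity c) => h; apply: oA; rewrite -(addrK B A) eB.
  by rewrite {1}eB in h; apply: gdvdB h _; apply/gdvdMr/gdvdr.
have oiC : ~ gdvd lam (gi * C).
  by have [_ _ lP] := gprime_lam; case/lP => // /gdvd_lamP.
have [|[B2 eB2] _] := @odd_sqr_sum 0 (conj pi1) pi1 A (gi * C) B1 oA oiC.
  move: c; rewrite /conic conj_primary eB => /eqP; rewrite subr_eq => /eqP c.
  rewrite exprMn (expr2 gi) gi2 mulr0 addr0 mul1r c exprMn (expr2 lam) lam2; ring.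
by exists (gi * B2); rewrite eB eB2 mulrA lam2; ring.
Qed.

(** If A = lam A1 with B and C odd, the equation reads pi B^2 + pi' C^2 =
    2 i A1^2, and [odd_sqr_sum] determines the residues of B and C modulo 2. *)
Lemma conic_A_even A B C : conic pi1 A B C -> coprime3 A B C -> gdvd lam A ->
  [/\ ~ gdvd lam B, ~ gdvd lam C, exists A1, A = 2%:R * A1
   & exists w, B * conj C = gi + 2%:R * w].
Proof.
move=> c co lA.
have [nAB nAC _] := conic_common npi c co gprime_lam (lam_ndvd_p p8).
have oB : ~ gdvd lam B by move=> lB; apply: nAB.
have oC : ~ gdvd lam C by move=> lC; apply: nAC.
case: lA => A1 eA.
have [|[A2 eA2] H] := @odd_sqr_sum pi1 (conj pi1) 0 B C A1 oB oC.
  move: c; rewrite /conic conj_primary eA => /eqP.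
  rewrite subr_eq => /eqP; rewrite exprMn (expr2 lam) lam2 mulr0 addr0 mulr1 => ->; ring.
split=> //; first by exists (gi * A2); rewrite eA eA2 mulrA lam2; ring.
have cgi : conj gi = - gi by apply: gintP.
have c1 : gi * gi = -1 by exact: gi2.
case: H => -[x1 [y1 [-> ->]]].
  exists (- gi + conj y1 + x1 * (- gi + 2%:R * conj y1)).
  by rewrite rmorphD rmorphM rmorph_nat /= cgi; ring.
exists (x1 + (gi + 2%:R * x1) * conj y1).
by rewrite rmorphD rmorphM rmorph_nat rmorph1 /=; ring.
Qed.

End Types.

(** * The polar form of a point of the conic *)

Lemma add_conj x : x + conj x = (2%:Z * re x)%:~R.
Proof. by apply: gintP; rewrite !gint_simp /=; ring. Qed.

Lemma gdvd_int_coprime t (m n : int) : coprimez m n -> gdvd t m%:~R -> gdvd t n%:~R -> norm t = 1.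
Proof.
case/(coprimezP m n) => -[u v] /= e h1 h2; apply: gdvd1.
have -> : 1 = u%:~R * m%:~R + v%:~R * n%:~R :> gint by rewrite -!intrM -intrD e.
by apply: gdvdD; apply: gdvdMl.
Qed.

(** Otherwise t^2 is l up to a unit, making t associate to its conjugate; then t
    divides 2 re t and 2 im t, so l divides t and l^2 divides the norm l of t. *)
Lemma gprime_unramified (l : nat) t k : prime l -> odd l -> gprime t -> l%:R = t * k -> ~ gdvd t k.
Proof.
move=> pl ol [t0 t1 tP] e [s es].
have tl : gdvd t l%:R by exists k.
have nt : norm t = l%:Z.
  have := congr1 norm e; rewrite es !normM -[l%:R]/((l%:Z)%:~R) norm_int.
  have := norm_ge0 t; have := norm_ge0 s; move: t1; rewrite -norm_eq0 in t0; move: t0.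
  move: (norm t) (norm s) => T S T0 T1 S0 T2 E.
  have : (`|T| %| l)%N.
    have : (`|T| ^ 2 %| l ^ 2)%N.
      by have := congr1 absz E; rewrite abszX !abszM => ->; rewrite mulnA mulnn dvdn_mulr.
    by rewrite dvdn_pexp2r.
  case/primeP: pl => _ H /H /orP[] /eqP; move: T1 T2; clear; lia.
have ct : conj t = t * s.
  by apply: (mulfI t0); rewrite mul_conj nt -es -e.
have h1 : gdvd t (t + conj t) by apply: gdvdD; [exact: gdvdr | exists s].
have h2 : gdvd t (gi * (conj t - t)).
  by apply: gdvdMl; apply: gdvdB; [exists s | exact: gdvdr].
have lint n : gdvd t (2%:Z * n)%:~R -> (l %| n)%Z.
  move=> h; case: (boolP (l %| n)%Z) => // nl; case/eqP: t1.
  apply: (@gdvd_int_coprime t l%:Z (2%:Z * n)) => //.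
  rewrite coprimezE abszM coprimeMr !prime_coprime //.
  rewrite dvdn_prime2 // -dvdzE nl andbT.
  by apply: contraTN ol => /eqP l2; rewrite (_ : l = 2%N).
have r : (l %| re t)%Z by apply: lint; rewrite -add_conj.
have i : (l %| im t)%Z.
  apply: lint; have <- : gi * (conj t - t) = (2%:Z * im t)%:~R by apply: gintP; rewrite !gint_simp /=; ring.
  done.
case/dvdzP: r => x hx; case/dvdzP: i => y hy.
move: nt; rewrite /norm hx hy => E; have := prime_gt1 pl.
have {}E : l%:Z * (l%:Z * (x ^+ 2 + y ^+ 2)) = l%:Z * 1 by rewrite mulr1 -[RHS]E; ring.
have l0 : l%:Z != 0 by have := prime_gt0 pl; clear; lia.
move/(mulfI l0)/(congr1 absz): E; rewrite abszM => /eqP; rewrite muln_eq1 => /andP[/eqP].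
by clear; lia.
Qed.

(** Both sides agree once a^2 and a'^2 are eliminated; [Rval_sqr] and
    [Rval_sqr'] are the case of two conjugate points. *)
Lemma polar_mul_sqr (K : comNzRingType) (x y a b c a' b' c' : K) :
  a ^+ 2 - x * b ^+ 2 = y * c ^+ 2 -> a' ^+ 2 - y * b' ^+ 2 = x * c' ^+ 2 ->
  (a * a' + y * b' * c + x * b * c') * (a * a' + y * b' * c + x * b * c' - 2%:R * x * b * c')
    = y * (a' * c + a * b') ^+ 2.
Proof.
move=> /eqP + /eqP; rewrite !subr_eq => /eqP h /eqP h'.
transitivity (a ^+ 2 * a' ^+ 2 + 2%:R * a * a' * y * b' * c + y ^+ 2 * b' ^+ 2 * c ^+ 2 - x ^+ 2 * b ^+ 2 * c' ^+ 2); first by ring.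
transitivity (y * (a' ^+ 2 * c ^+ 2 + 2%:R * a * a' * b' * c + a ^+ 2 * b' ^+ 2)); last by ring.
by rewrite h h'; ring.
Qed.

Section RVal.
Variables (p : nat) (pi1 : gint).
Hypotheses (pp : prime p) (p8 : (p = 1 %[mod 8])%N).
Let pi := 1 + 4%:R * pi1.
Let pi' := conj pi.
Hypothesis npi : norm pi = p%:Z.

(** The polar form R = A A' + pi' B' C + pi B C'; its last two terms are
    conjugate. *)
Definition Rval (A B C : gint) : int := norm A + 2%:Z * re (pi * B * conj C).

Lemma RvalE A B C : (Rval A B C)%:~R = A * conj A + pi' * conj B * C + pi * B * conj C.
Proof.
rewrite /Rval intrD -add_conj !rmorphM /= conjK mul_conj -/pi'; ring.
Qed.

Lemma RvalN A B C : Rval A B (- C) = norm A - 2%:Z * re (pi * B * conj C).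
Proof. by rewrite /Rval rmorphN mulrN reN mulrN. Qed.
Lemma Rval_add A B C : Rval A B C + Rval A B (- C) = 2%:Z * norm A.
Proof. by rewrite RvalN /Rval; ring. Qed.

(** The product with the value at (A, B, -C) is (A A')^2 - (pi' B' C +
    pi B C')^2, into which the equation and its conjugate are substituted. *)
Lemma Rval_mul A B C : conic pi1 A B C ->
  Rval A B C * Rval A B (- C) = p%:Z * (norm B - norm C) ^+ 2.
Proof.
move=> c; have c' := conic_conj c.
have h (m n : int) : m%:~R = n%:~R :> gint -> m = n.
  by move/(congr1 re); rewrite !re_int.
apply: h; rewrite intrM !RvalE intrM rmorphXn rmorphB /= -!mul_conj rmorphN /=.
rewrite -[p%:Z%:~R]/(p%:R) -(pipi' npi) -/pi -/pi'; move: c c'; rewrite /conic -/pi -/pi'.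
move: (conj A) (conj B) (conj C) pi pi' => A' B' C' x y /eqP + /eqP.
rewrite !subr_eq => /eqP c /eqP c'.
transitivity (A ^+ 2 * A' ^+ 2 - (y * B' * C + x * B * C') ^+ 2); first by ring.
by rewrite c c'; ring.
Qed.

Lemma Rval_sqr A B C : conic pi1 A B C ->
  (Rval A B C)%:~R * ((Rval A B C)%:~R - 2%:R * pi * B * conj C) = pi' * (conj A * C + A * conj B) ^+ 2.
Proof. by move=> c; rewrite !RvalE; apply: polar_mul_sqr c (conic_conj c). Qed.

Lemma Rval_sqr' A B C : conic pi1 A B C ->
  (Rval A B C)%:~R * ((Rval A B C)%:~R - 2%:R * pi' * conj B * C) = pi * (A * conj C + conj A * B) ^+ 2.
Proof.
move=> c; have := polar_mul_sqr (conic_conj c) c; rewrite -/pi -/pi' => <-.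
by rewrite !RvalE; ring.
Qed.

(** The values at C and -C have nonnegative sum and product. *)
Lemma Rval_ge0 A B C : conic pi1 A B C -> 0 <= Rval A B C.
Proof.
move=> c; have h1 := Rval_add A B C; have h2 := Rval_mul c.
have h3 := norm_ge0 A; have h4 : 0 <= Rval A B C * Rval A B (- C) by rewrite h2 mulr_ge0 ?sqr_ge0.
move: (Rval _ _ _) (Rval _ _ _) h1 h3 h4 => x y h1 h3 h4.
case: (lerP 0 y) => // y0; rewrite (nmulr_rge0 _ y0) in h4.
by move: (norm A) h1 h3 => n h1 h3; clear -h1 h3 h4 y0; lia.
Qed.

End RVal.

(** * The polar form is p^e times a square *)

Lemma gdvd_sqr_mul t y e x : gprime t -> ~ gdvd t y -> t * x = y * e ^+ 2 -> gdvd t e.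
Proof.
move=> [_ _ tP] ny h; have : gdvd t (y * e ^+ 2) by exists x.
by case/tP => //; rewrite expr2 => /tP[].
Qed.

(** Parity of the valuation at t, by descent: t divides e, and t^2 can be
    cancelled on both sides. *)
Lemma gval_even t n x y e : gprime t -> ~ gdvd t x -> ~ gdvd t y ->
  t ^+ n * x = y * e ^+ 2 -> ~~ odd n.
Proof.
move=> tp nx ny; have [t0 _ _] := tp.
elim/ltn_ind: n e => -[|[|n]] IH e // h.
  rewrite expr1 in h; have [f ef] := gdvd_sqr_mul tp ny h.
  case: nx; exists (y * f ^+ 2); apply: (mulfI t0); rewrite h ef; ring.
have [f ef] := gdvd_sqr_mul tp ny (etrans (mulrA _ _ _) h : t * (t ^+ n.+1 * x) = _).
rewrite /= negbK; apply: (IH n _ f); first by [].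
apply: (mulfI (mulf_neq0 t0 t0)); transitivity (t ^+ n.+2 * x); first by rewrite !exprS; ring.
by rewrite h ef; ring.
Qed.

(** As for [gval_even], t^2 is cancelled as long as t divides the left-hand
    side. *)
Lemma gval_root t n x y e : gprime t -> ~ gdvd t y ->
  t ^+ (2 * n) * x = y * e ^+ 2 -> exists f, e = t ^+ n * f.
Proof.
move=> tp ny; have [t0 _ _] := tp.
elim: n e => [|n IH] e h; first by exists e; rewrite expr0 mul1r.
have e2 : t ^+ (2 * n.+1) = t * (t * t ^+ (2 * n)) by rewrite mulnS !exprS.
have h' : t * (t * t ^+ (2 * n) * x) = y * e ^+ 2 by rewrite -h e2; ring.
have [f ef] := gdvd_sqr_mul tp ny h'.
have [|g eg] := IH f; last by exists g; rewrite ef eg exprS mulrA.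
apply: (mulfI (mulf_neq0 t0 t0)); transitivity (t ^+ (2 * n.+1) * x); first by rewrite e2; ring.
by rewrite h ef; ring.
Qed.

Lemma sqr_part (p n : nat) : prime p -> (0 < n)%N ->
  (forall l, prime l -> l != p -> ~~ odd (logn l n)) -> exists m e, n = (p ^ e * m ^ 2)%N.
Proof.
move=> pp; elim/ltn_ind: n => n IH n0 H.
case: (leqP n 1) => n1; first by exists 1%N, 0%N; lia.
move: (pdiv n) (pdiv_prime n1) (pdiv_dvd n) => l pl.
case/dvdnP=> k ek; have k0 : (0 < k)%N by move: n0; rewrite ek muln_gt0 => /andP[].
have l1 := prime_gt1 pl.
have [lp|lp] := eqVneq l p.
  have [|||m [e em]] := IH k; first by rewrite ek ltn_Pmulr.
  - by [].
  - move=> l' pl' lp'; have := H l' pl' lp'.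
    by rewrite ek lognM ?k0 ?(prime_gt0 pl) // (logn_prime _ pl) lp (negPf lp') addn0.
  by exists m, e.+1; rewrite ek em lp (ssrnat.expnSr p) -!(mulnA (p ^ e)%N) (mulnC p).
have lk : (l %| k)%N.
  have := H l pl lp; rewrite ek lognM ?k0 ?(prime_gt0 pl) // (logn_prime _ pl) eqxx addn1 /= negbK => ol.
  by case: (posnP (logn l k)) ol => [->//|]; rewrite logn_gt0 mem_primes => /and3P[].
case/dvdnP: lk => j ej; have j0 : (0 < j)%N by move: k0; rewrite ej muln_gt0 => /andP[].
have [|||m [e em]] := IH j.
- by rewrite ek ej -mulnA ltn_Pmulr //; nia.
- by [].
- move=> l' pl' lp'; have := H l' pl' lp'.
  by rewrite ek ej !lognM ?muln_gt0 ?j0 ?(prime_gt0 pl) // -addnA oddD addnn odd_double addbF.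
by exists (m * l)%N, e; rewrite ek ej em expnMn !mulnA.
Qed.

Section RValEven.
Variables (p : nat) (pi1 : gint).
Hypotheses (pp : prime p) (p8 : (p = 1 %[mod 8])%N).
Let pi := 1 + 4%:R * pi1.
Let pi' := conj pi.
Hypothesis npi : norm pi = p%:Z.
Local Notation Rval := (Rval pi1).
Variables A B C : gint.
Hypotheses (cABC : conic pi1 A B C) (co : coprime3 A B C) (R0 : Rval A B C != 0).
Let Rnat : (Rval A B C)%:~R = (`|Rval A B C|%N)%:R :> gint.
Proof. by rewrite -[in LHS](gez0_abs (Rval_ge0 npi cABC)). Qed.

(** Let u be a Gaussian prime above l.  If l has odd exponent in R, then u
    divides the cofactor of R in [Rval_sqr], in its conjugate and in [Rval_mul],
    hence each of B C', B' C and A A'; as u and its conjugate are each unable to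
    divide two of A, B, C, this is impossible. *)
Lemma Rval_logn_odd (l : nat) : prime l -> odd l -> l != p -> ~~ odd (logn l `|Rval A B C|).
Proof.
move=> pl ol lp.
have Rp : (0 < `|Rval A B C|)%N by rewrite absz_gt0.
have [n0 cn0 eR] := pfactor_coprime pl Rp.
set t := logn _ _ in eR *; apply/negP => ot.
have nl : norm (l%:R) = l%:Z ^+ 2 by rewrite -[l%:R]/((l%:Z)%:~R) norm_int.
have l1 := prime_gt1 pl.
have [||u up lu] := @gprime_exists l%:R.
- by rewrite nl; clear -l1; nia.
- by apply: gnat_neq0; exact: prime_gt0.
have [u0 u1 uP] := up; have [k ek] := lu.
have uk : ~ gdvd u k by exact: gprime_unramified ek.
have ncop (m : nat) : coprime l m -> ~ gdvd u m%:R.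
  by move=> c h; case/eqP: u1; apply: (@gdvd_int_coprime u l%:Z m%:Z).
have unp : ~ gdvd u p%:R by apply: ncop; rewrite prime_coprime // dvdn_prime2.
have un2 : ~ gdvd u 2%:R by apply: ncop; rewrite prime_coprime // dvdn_prime2 //; apply: contraTN ol => /eqP ->.
have unpi : ~ gdvd u pi by move=> h; apply: unp; rewrite -(pipi' npi); apply: gdvdMr.
have unpi' : ~ gdvd u pi' by move=> h; apply: unp; rewrite -(pipi' npi); apply: gdvdMl.
have ux : ~ gdvd u (k ^+ t * n0%:R).
  case/uP; last exact: ncop.
  by elim: (t) => [|n IH]; [rewrite expr0 => /gdvd1 /eqP; apply/negP | rewrite exprS => /uP[]].
have eRu : (Rval A B C)%:~R = u ^+ t * (k ^+ t * n0%:R).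
  by rewrite Rnat eR natrM natrX ek exprMn mulrC mulrA.
have main S y e : (Rval A B C)%:~R * S = y * e ^+ 2 -> ~ gdvd u y -> gdvd u S.
  move=> h ny; case: (classic (gdvd u S)) => // nS.
  have h2 : u ^+ t * (k ^+ t * n0%:R * S) = y * e ^+ 2 by rewrite -h eRu; ring.
  have nx : ~ gdvd u (k ^+ t * n0%:R * S) by case/uP.
  by have := gval_even up nx ny h2; rewrite ot.
have uR : gdvd u (Rval A B C)%:~R.
  rewrite eRu; apply: gdvdMr; move: ot; case: (t) => // n _.
  by rewrite exprS; apply/gdvdMr/gdvdr.
have h1 : gdvd u B \/ gdvd u (conj C).
  have /(gdvdB uR) := main _ _ _ (Rval_sqr cABC) unpi'.
  rewrite opprB addrCA subrr addr0 => /uP[/uP[/uP[]|]|]; by [left|right|].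
have h2 : gdvd u (conj B) \/ gdvd u C.
  have /(gdvdB uR) := main _ _ _ (Rval_sqr' cABC) unpi.
  rewrite opprB addrCA subrr addr0 => /uP[/uP[/uP[]|]|]; by [left|right|].
have h3 : gdvd u A \/ gdvd u (conj A).
  have e : (Rval A B C)%:~R * (Rval A B (- C))%:~R = p%:R * ((norm B - norm C)%:~R) ^+ 2 :> gint.
    by rewrite -intrM (Rval_mul npi cABC) intrM rmorphXn.
  have /(gdvdD uR) := main _ _ _ e unp.
  rewrite -intrD Rval_add intrM -mul_conj => /uP[|/uP[]]; by [|left|right].
have [c1 c2 c3] := conic_common npi cABC co up unp.
have up' : gprime (conj u).
  split; first by rewrite -norm_eq0 norm_conj norm_eq0.
    by rewrite norm_conj.
  move=> x y /gdvd_conj; rewrite conjK rmorphM => /uP[] /gdvd_conj; rewrite conjK; by [left|right].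
have unp' : ~ gdvd (conj u) p%:R by move=> /gdvd_conj; rewrite conjK rmorph_nat.
have [d1 d2 d3] := conic_common npi cABC co up' unp'.
have cc x : gdvd u (conj x) -> gdvd (conj u) x by move/gdvd_conj; rewrite conjK.
case: h1 => h1; case: h2 => h2; case: h3 => h3; first [by apply: c1|by apply: c2 | by apply: c3|
 by apply: d1; split; apply: cc | by apply: d2; split; apply: cc | by apply: d3; split; apply: cc].
Qed.

(** R is odd unless lam divides A.  In that case R = 4 R1, where R1 times 2 (2
    R1 - pi B C') is pi' times a square and B C' = i modulo 2.  If the exponent
    of 2 in R1 were odd, removing the powers of lam would make an odd multiple
    of i congruent to a square modulo 2, while squares have an even imaginary
    part. *)
Lemma Rval_logn_2 : ~~ odd (logn 2 `|Rval A B C|).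
Proof.
have [lA|oA] := classic (gdvd lam A); last first.
  suff -> : logn 2 `|Rval A B C| = 0%N by [].
  apply/eqP; rewrite lognE /= absz_gt0 R0 /=; case: ifP => // h; case: oA.
  move: h; rewrite gdvd_lamP /Rval /norm; move: (re _) (re _) (im _) => x y z.
  have [? [->|->]] := int_parity y; have [? [->|->]] := int_parity z; clear; lia.
have [oB oC [A1 eA] [w ew]] := conic_A_even p8 npi cABC co lA.
have [R1 eR1] : exists R1, Rval A B C = 4%:Z * R1.
  exists (norm A1 + re w + 2%:Z * re (pi1 * (gi + 2%:R * w))).
  rewrite /Rval -mulrA ew eA normM (_ : norm 2%:R = 4%:Z) // !gint_simp /=; ring.
have R10 : (0 < `|R1|)%N by rewrite absz_gt0; apply: contraNneq R0 => R1z; rewrite eR1 R1z mulr0.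
have [m cm em] := pfactor_coprime (isT : prime 2) R10; set s := logn 2 _ in em.
have om : odd m by rewrite -coprime2n.
have -> : logn 2 `|Rval A B C| = s.+2.
  by rewrite eR1 abszM lognM // (_ : logn 2 `|4%:Z| = 2%N).
rewrite /= negbK; apply/negP => os.
have R1nat : R1%:~R = m%:R * 2%:R ^+ s :> gint.
  have R1ge : 0 <= R1 by have := Rval_ge0 npi cABC; rewrite eR1; clear; lia.
  by rewrite -(gez0_abs R1ge) -[_%:~R]/(`|R1|%N%:R) em natrM natrX.
pose W : gint := 2%:R * R1%:~R - pi * B * conj C.
pose E1 := conj A1 * C + A1 * conj B.
have n4 : 4%:R != 0 :> gint by apply: gnat_neq0.
have e1 : R1%:~R * (2%:R * W) = pi' * E1 ^+ 2.
  apply: (mulfI n4); transitivity (pi' * (conj A * C + A * conj B) ^+ 2).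
    rewrite -(Rval_sqr cABC) eR1 intrM -/pi /W -[4%:Z%:~R]/(4%:R); ring.
  by rewrite eA rmorphM rmorph_nat /E1; ring.
have e2 : lam ^+ (2 * s.+1) * ((- gi) ^+ s.+1 * (m%:R * W)) = pi' * E1 ^+ 2.
  rewrite -e1 R1nat mulrA exprM -exprMn expr2 [_ * - gi]mulrC -two_lam exprS; ring.
have npi'l : ~ gdvd lam pi'.
  by move=> h; apply: (lam_ndvd_p p8); rewrite -(pipi' npi); apply: gdvdMl.
have [f ef] := gval_root gprime_lam npi'l e2.
have l0 : lam ^+ (2 * s.+1) != 0 by rewrite expf_neq0 //; case: gprime_lam.
have e3 : (- gi) ^+ s.+1 * (m%:R * W) = pi' * f ^+ 2.
  apply: (mulfI l0); rewrite e2 ef exprMn -exprM (mulnC s.+1); ring.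
have [j ej] : exists j, s.+1 = (2 * j)%N by exists s.+1./2; move: os; clear; lia.
move: e3; rewrite ej exprM (_ : (- gi) ^+ 2 = -1) ?sqrrN ?expr2 ?gi2 //.
have -> : (-1) ^+ j = ((-1) ^+ j)%:~R :> gint by rewrite rmorphXn rmorphN rmorph1.
have : ((-1) ^+ j = 1 :> int) \/ ((-1) ^+ j = -1 :> int).
  by rewrite -signr_odd; case: (odd j); [right|left].
move=> sg /(congr1 im); rewrite /W -mulrA ew /pi' conj_primary !gint_simp /=.
by case: sg => ->; have [? [|]] := int_parity m%:Z => em'; [move: om|rewrite em'|move: om|rewrite em']; move: em'; clear; lia.
Qed.

Lemma Rval_square : exists (m : int) (e : nat), Rval A B C = p%:Z ^+ e * m ^+ 2.
Proof.
have [|l pl lp|m [e em]] := @sqr_part p `|Rval A B C| pp; first by rewrite absz_gt0.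
  have [l2|l2] := eqVneq l 2%N; first by rewrite l2; exact: Rval_logn_2.
  by apply: Rval_logn_odd => //; case/even_prime: pl => // h; rewrite h in l2.
exists m%:Z, e; rewrite -[LHS](gez0_abs (Rval_ge0 npi cABC)) em PoszM.
by rewrite -!rmorphXn /= -!natz; congr (_ * _); rewrite natz.
Qed.

End RValEven.

(** * Points of the conic congruent to 1 modulo 2 + 2 i *)

Lemma conj_gi : conj gi = - gi. Proof. exact: gintP. Qed.

(** The element w is a greatest common divisor of z and S. *)
Lemma gmul_sqr z z' S s t : z != 0 -> s * z + t * z' = 1 -> z * z' = S ^+ 2 ->
  exists e w, norm e = 1 /\ z = e * w ^+ 2.
Proof.
move=> z0 h1 h2; have [w [x [y [ew [z1 ez1] [S1 eS1]]]]] := gint_bezout z S.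
pose e := s * z1 ^+ 2 + t * S1 ^+ 2.
have ze : z = e * w ^+ 2.
  transitivity (s * z ^+ 2 + t * S ^+ 2); last by rewrite {1}ez1 eS1 /e; ring.
  by rewrite -h2 -[LHS]mulr1 -h1; ring.
exists e, w; split=> //.
apply: gdvd1; exists (x ^+ 2 * z + 2%:R * x * y * S + y ^+ 2 * z').
have w2 : w ^+ 2 = z * (x ^+ 2 * z + 2%:R * x * y * S + y ^+ 2 * z').
  transitivity (x ^+ 2 * z ^+ 2 + 2%:R * x * y * S * z + y ^+ 2 * S ^+ 2); first by rewrite ew; ring.
  by rewrite -h2; ring.
by apply: (mulfI z0); rewrite mulr1 {1}ze w2; ring.
Qed.

Section Normal.
Variables (p : nat) (pi1 : gint).
Hypotheses (pp : prime p) (p8 : (p = 1 %[mod 8])%N).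
Let pi := 1 + 4%:R * pi1.
Let pi' := conj pi.
Hypothesis npi : norm pi = p%:Z.

(** Of t + i and t - i, pi divides one; changing the sign of t it is
    t + i = pi z.  Since t is divisible by 4 and s is odd, z is coprime to its
    conjugate, and z times conj z is s^2, so z is a unit times a square.  The
    unit is i or -i because t + i is i modulo 4. *)
Lemma half_norm_sum : exists w, pi * w ^+ 2 + pi' * conj w ^+ 2 = 2%:R.
Proof.
have [T [S TS]] : exists T S : int, T ^+ 2 + 1 = p%:Z * S ^+ 2.
  by apply: neg_pell => //; move: p8; clear; lia.
have eN : (T%:~R + gi) * (T%:~R - gi) = pi * pi' * (S%:~R) ^+ 2.
  rewrite (pipi' npi) -[p%:R]/(p%:Z%:~R) -rmorphXn -intrM -TS intrD rmorphXn /=.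
  by transitivity (T%:~R ^+ 2 - gi * gi); [ring | rewrite gi2; ring].
wlog [z ez] : T TS eN / gdvd pi (T%:~R + gi) => [H|].
  have [_ _ piP] := gprime_pi pp npi.
  case: (piP (T%:~R + gi) (T%:~R - gi)); first by rewrite eN -mulrA; apply/gdvdMr/gdvdr.
    exact: H.
  move=> h; apply: (H (- T)).
  - by rewrite sqrrN.
  - by rewrite -eN intrN; ring.
  - by rewrite (_ : (- T)%:~R + gi = - (T%:~R - gi)); [exact: gdvdN | rewrite intrN; ring].
have p0 : pi * pi' != 0 by rewrite (pipi' npi); apply: gnat_neq0; exact: prime_gt0.
have ez' : T%:~R - gi = pi' * conj z by rewrite -rmorphM -ez rmorphD /= conj_int conj_gi.
have zz : z * conj z = (S%:~R) ^+ 2.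
  by apply: (mulfI p0); rewrite -eN ez ez'; ring.
have [k pk] : exists k : int, p%:Z = 8%:Z * k + 1 by exists (p %/ 8)%N; move: p8; clear; lia.
have [S' eS] : exists S', S = 2%:Z * S' + 1.
  have [S' [e|e]] := int_parity S; last by exists S'.
  move: TS; rewrite pk e; have [T' [->|->]] := int_parity T; clear; lia.
have [T' eT] : exists T', T = 4%:Z * T'.
  have [t [et|et]] := int_parity T; last by move: TS; rewrite pk eS et; clear; lia.
  have [T' [eT|eT]] := int_parity t; first by exists T'; rewrite et eT; ring.
  by move: TS; rewrite pk eS et eT; have [j [->|->]] := int_parity S'; clear; lia.
have [g [s [t [eg gz gz']]]] := gint_bezout z (conj z).
have g1 : norm g = 1.
  apply: (@gdvd_int_coprime g 2%:Z (S ^+ 2)); last 1 first.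
  - by rewrite rmorphXn -zz; apply: gdvdMr.
  - by rewrite eS; apply/coprimezP; exists (- (2%:Z * S' ^+ 2 + 2%:Z * S'), 1) => /=; ring.
  - have -> : 2%:Z%:~R = - gi * (pi * z - pi' * conj z).
      by rewrite -ez -ez'; transitivity (- (gi * gi) * 2%:R); [rewrite gi2 opprK mul1r | ring].
    by apply: gdvdMl; apply: gdvdB; apply: gdvdMl.
have z0 : z != 0.
  by apply/eqP=> z0; move: ez; rewrite z0 mulr0 => /(congr1 im); rewrite !gint_simp /=; clear; lia.
have h1 : (conj g * s) * z + (conj g * t) * conj z = 1.
  transitivity (g * conj g); last by rewrite mul_conj g1.
  by move: (conj g) => g'; rewrite eg; ring.
have [e [w [e1 ezw]]] := gmul_sqr z0 h1 zz.
have ow : ~ gdvd lam w.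
  case=> w1 ew; have : gdvd lam (T%:~R + gi) by rewrite ez ezw ew; exists (pi * e * w1 * (lam * w1)); ring.
  by rewrite gdvd_lamP eT !gint_simp /=; clear; lia.
suff [v hv] : exists v, T%:~R + gi = gi * (pi * v ^+ 2).
  exists v; have hv' : T%:~R - gi = - gi * (pi' * conj v ^+ 2).
    by have := congr1 conj hv; rewrite rmorphD /= conj_int conj_gi => ->; rewrite rmorphM rmorphM rmorphXn /= conj_gi.
  have gi0 : gi != 0 by [].
  apply: (mulfI gi0); transitivity ((T%:~R + gi) - (T%:~R - gi)); last by ring.
  by rewrite hv hv'; ring.
have bad (f : gint) : im f = 0 -> T%:~R + gi = pi * f * w ^+ 2 -> False.
  move=> f0 /(congr1 im); case: (odd_cases ow) => -[_ [r [_ ->]]]; rewrite /pi !gint_simp f0 /=; clear; lia.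
move: ez; rewrite ezw; case: (gunit_cases e1) => -> ez.
- by case: (bad 1) => //; rewrite ez; ring.
- by case: (bad (-1)) => //; rewrite ez; ring.
- by exists w; rewrite ez; ring.
- exists (gi * w); rewrite ez exprMn (expr2 gi) gi2; ring.
Qed.

Lemma conic_exists : exists A B C, conic pi1 A B C /\ A != 0.
Proof.
have [w hw] := half_norm_sum; have [e [f hf]] := prime_1mod8_form pp p8.
pose w' := conj w.
(* The cross terms of pi B^2 + pi' C^2 cancel because i^2 = -1, which leaves
   (e^2 - p) (pi w^2 + pi' w'^2) = - 4 f^2 = A^2. *)
exists (2%:R * gi * f%:~R), (w * e%:~R + gi * w' * pi'), (gi * (pi * w + gi * w' * e%:~R)).
split.
  have pf : pi * pi' = e%:~R ^+ 2 + 2%:R * f%:~R ^+ 2.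
    by rewrite (pipi' npi) -[p%:R]/(p%:Z%:~R) hf intrD intrM !rmorphXn.
  rewrite /conic -/pi -/pi' -/w'; move: hw; rewrite -/w'; move: pf.
  move: pi pi' w' (e%:~R) (f%:~R) => x y v E F hp hw.
  apply/eqP; rewrite -subr_eq0; apply/eqP.
  transitivity ((gi * gi) * (4%:R * F ^+ 2 - x * y * (x * w ^+ 2 + y * v ^+ 2)) - x * w ^+ 2 * E ^+ 2
    - (gi * gi) * (gi * gi) * y * v ^+ 2 * E ^+ 2 - 2%:R * gi * x * y * w * v * E * (1 + gi * gi)); first by ring.
  rewrite gi2; transitivity (- 4%:R * F ^+ 2 + (x * y - E ^+ 2) * (x * w ^+ 2 + y * v ^+ 2)); first by ring.
  by rewrite hw hp; ring.
rewrite !mulf_neq0 // ?gnat_neq0 //; apply/eqP=> /(congr1 re); rewrite re_int => f0.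
have := @prime_sqr_mul p e 1 pp; rewrite hf f0 => H; have : 1 = 0 :> int by apply: H; ring.
by [].
Qed.

Lemma coprime_part A B C : A != 0 -> exists t A1 B1 C1,
  [/\ t != 0, A = t * A1, B = t * B1, C = t * C1 & coprime3 A1 B1 C1].
Proof.
move=> A0; have [g [u [v [eg [A1 eA] gB]]]] := gint_bezout A B.
have [f [s [t [ef [g1 fg] [C1 fC]]]]] := gint_bezout g C.
case: gB => B1 eB.
have f0 : f != 0 by apply: contraNneq A0 => f0; rewrite eA fg f0 !mul0r.
exists f, (g1 * A1), (g1 * B1), C1; split=> //; rewrite ?eA ?eB ?fg ?mulrA //.
move=> d [x ex] [y ey] [z ez]; apply: gdvd1; exists (s * (u * x + v * y) + t * z).
apply: (mulfI f0); rewrite mulr1 {1}ef {1}eg eA eB fC fg.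
transitivity (f * (s * (u * (g1 * A1) + v * (g1 * B1)) + t * C1)); first by ring.
by rewrite ex ey ez; ring.
Qed.

Lemma conicZ t A B C : t != 0 -> conic pi1 (t * A) (t * B) (t * C) -> conic pi1 A B C.
Proof.
move=> t0 h; have t2 : t ^+ 2 != 0 by rewrite expf_neq0.
apply: (mulfI t2); transitivity ((t * A) ^+ 2 - pi * (t * B) ^+ 2); first by rewrite /pi; ring.
by rewrite h; ring.
Qed.

(** A^2 - pi' C^2 is the norm of A + C sqrt pi'; it is multiplied by
    1 + 2 y - sqrt pi' with y = (pi' - 1) / 4, whose norm is (2 y)^2. *)
Lemma conic_norm_mul A B C : conic pi1 A B C ->
  conic pi1 (A * (1 + 2%:R * conj pi1) - pi' * C) (2%:R * conj pi1 * B) (A - (1 + 2%:R * conj pi1) * C).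
Proof.
rewrite /conic -/pi -/pi' => /eqP; rewrite subr_eq => /eqP h.
have e : pi' = 1 + 4%:R * conj pi1 by exact: conj_primary.
move: h; rewrite e; move: pi (conj pi1) => x y h; apply/eqP; rewrite subr_eq; apply/eqP.
transitivity (A ^+ 2 * (1 + 2%:R * y) ^+ 2 + (1 + 4%:R * y) ^+ 2 * C ^+ 2 - 2%:R * A * C * (1 + 4%:R * y) * (1 + 2%:R * y)); first by ring.
transitivity ((1 + 4%:R * y) * A ^+ 2 + (1 + 4%:R * y) * (1 + 2%:R * y) ^+ 2 * C ^+ 2 + x * (2%:R * y * B) ^+ 2 - 2%:R * A * C * (1 + 4%:R * y) * (1 + 2%:R * y)); last by ring.
by rewrite h; ring.
Qed.

(** The equation gives A + B = C modulo lam.  So when B is odd exactly one of A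
    and C is odd, and the first coordinate produced by [conic_norm_mul] is odd
    while the second one is even. *)
Lemma conic_exists_even : exists A B C, [/\ conic pi1 A B C, coprime3 A B C, ~ gdvd lam A & gdvd lam B].
Proof.
have [A0 [B0 [C0 [c0 nz]]]] := conic_exists.
have [t [A [B [C [t0 eA eB eC co]]]]] := coprime_part B0 C0 nz.
have c : conic pi1 A B C by apply: (conicZ t0); rewrite -eA -eB -eC.
have [nAB nAC nBC] := conic_common npi c co gprime_lam (lam_ndvd_p p8).
have [lB|oB] := classic (gdvd lam B).
  by exists A, B, C; split=> // lA; apply: nAB.
have c2 := conic_norm_mul c.
have l2 x : gdvd lam (2%:R * x) by rewrite two_lam; apply/gdvdMr/gdvdMl/gdvdMr/gdvdr.
set A2 := A * _ - _ in c2; set B2 := _ * B in c2; set C2 := A - _ in c2.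
have oA2 : ~ gdvd lam A2.
  move=> h; apply: oB.
  have hAC : gdvd lam (A + C).
    have -> : A + C = A2 + 2%:R * (C + 2%:R * conj pi1 * C - conj pi1 * A).
      by rewrite /A2 /pi' conj_primary; ring.
    exact: gdvdD.
  have := conic_parity c; rewrite !gdvd_lamP !(reD, imD); move: hAC; rewrite gdvd_lamP !(reD, imD).
  by move: (re _) (re _) (re _) (im _) (im _) (im _); clear; lia.
have lB2 : gdvd lam B2 by rewrite /B2 -mulrA.
have A20 : A2 != 0 by apply/eqP=> h; apply: oA2; rewrite h; exact: gdvd0.
have [u [A3 [B3 [C3 [u0 e3 eB3 eC3 co3]]]]] := coprime_part B2 C2 A20.
have [_ _ lP] := gprime_lam.
exists A3, B3, C3; split=> //.
- by apply: (conicZ u0); rewrite -e3 -eB3 -eC3.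
- by move=> h; apply: oA2; rewrite e3; apply: gdvdMl.
- move: lB2; rewrite eB3; case/lP => // h; case: oA2; rewrite e3; exact: gdvdMr.
Qed.

(** A is 1 or i modulo 2, so multiplying by 1 or -i makes it 1; multiplying
    by -1 changes B1 + i T1 by an odd number, so one of the two signs makes it
    divisible by lam. *)
Lemma conic_normal_exists : exists T1 B1 C s,
  [/\ conic pi1 (1 + 2%:R * gi * T1) (2%:R * B1) C,
      coprime3 (1 + 2%:R * gi * T1) (2%:R * B1) C & B1 + gi * T1 = lam * s].
Proof.
have [A [B [C [c co oA lB]]]] := conic_exists_even.
have [B1 eB] := conic_B_even c oA lB.
have unit_scale e : norm e = 1 -> conic pi1 (e * A) (e * B) (e * C) /\ coprime3 (e * A) (e * B) (e * C).
  move=> e1; have ee : conj e * e = 1 by rewrite mulrC mul_conj e1.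
  split; first by move: c; rewrite /conic => c; transitivity (e ^+ 2 * (A ^+ 2 - pi * B ^+ 2)); [|rewrite c]; rewrite -/pi; ring.
  have k x : conj e * (e * x) = x by rewrite mulrA ee mul1r.
  by move=> t /(gdvdMl (conj e)) + /(gdvdMl (conj e)) + /(gdvdMl (conj e)); rewrite !k; apply: co.
have main e T1 : norm e = 1 -> e * A = 1 + 2%:R * gi * T1 -> gdvd lam (e * B1 + gi * T1) -> exists T1 B1 C s,
  [/\ conic pi1 (1 + 2%:R * gi * T1) (2%:R * B1) C,
      coprime3 (1 + 2%:R * gi * T1) (2%:R * B1) C & B1 + gi * T1 = lam * s].
  move=> e1 eA [s es]; have [c' co'] := unit_scale e e1.
  by exists T1, (e * B1), (e * C), s; rewrite -eA mulrCA -eB.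
have step e T1 : norm e = 1 -> e * A = 1 + 2%:R * gi * T1 -> exists T1 B1 C s,
  [/\ conic pi1 (1 + 2%:R * gi * T1) (2%:R * B1) C,
      coprime3 (1 + 2%:R * gi * T1) (2%:R * B1) C & B1 + gi * T1 = lam * s].
  move=> e1 eA; case: (lam_dvd_dec (e * B1 + gi * T1)) => h; first exact: (main e T1).
  apply: (main (- e) (gi - T1)); first by rewrite -e1 /norm !gint_simp; ring.
    rewrite mulNr eA; transitivity (1 + 2%:R * (gi * gi) - 2%:R * gi * T1); [rewrite gi2|]; ring.
  have -> : - e * B1 + gi * (gi - T1) = - (e * B1 + gi * T1 - 1) + (gi * gi - 1) by ring.
  apply: gdvdD; first exact: gdvdN.
  by rewrite gi2 gdvd_lamP.
case: (odd_cases oA) => -[y [_ [eA _]]].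
  by apply: (step 1 (- gi * y)) => //; rewrite mul1r eA; transitivity (1 - 2%:R * (gi * gi) * y); [rewrite gi2|]; ring.
apply: (step (- gi) (- y)) => //.
by rewrite eA; transitivity (- (gi * gi) - 2%:R * gi * y); [|rewrite gi2]; ring.
Qed.

(** The equation gives pi' C^2 modulo 4 lam in terms of T1 and B1; as C^2 is 1
    or -1 modulo 4 lam, this fixes pi1 modulo lam.  That R = p^e m^2 is 1 modulo
    8 relates the real parts of T1 and B1. *)
Lemma conic_congruence T1 B1 C s :
  conic pi1 (1 + 2%:R * gi * T1) (2%:R * B1) C -> coprime3 (1 + 2%:R * gi * T1) (2%:R * B1) C ->
  B1 + gi * T1 = lam * s -> ((re s + im s) %% 2)%Z = ((re pi1 + im pi1) %% 2)%Z.
Proof.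
move=> c co es.
have l2 x : gdvd lam (2%:R * x) by rewrite two_lam; apply/gdvdMr/gdvdMl/gdvdMr/gdvdr.
have nz : Rval pi1 (1 + 2%:R * gi * T1) (2%:R * B1) C != 0.
  apply/eqP=> h; have := congr1 (fun x : int => (x %% 2)%Z) h.
  rewrite /Rval; move: (re (_ * conj C)) => x; rewrite /norm !gint_simp /=; clear.
  have [? [->|->]] := int_parity (re T1); have [? [->|->]] := int_parity (im T1); lia.
have [m [e eR]] := Rval_square pp p8 npi c co nz.
have [k pk] : exists k : int, p%:Z = 8%:Z * k + 1 by exists (p %/ 8)%N; move: p8; clear; lia.
have oC : ~ gdvd lam C.
  move=> lC; have [_ nAC _] := conic_common npi c co gprime_lam (lam_ndvd_p p8).
  by apply: lam_ndvd1; have := conic_parity c; rewrite !gdvd_lamP in lC *; rewrite lC !gint_simp /=; clear; lia.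
have key : (1 + 4%:R * conj pi1) * C ^+ 2 = 1 + 4%:R * (gi * T1) - 4%:R * T1 ^+ 2 - 4%:R * (1 + 4%:R * pi1) * B1 ^+ 2.
  rewrite -conj_primary -[LHS]c; transitivity (1 + 4%:R * gi * T1 + 4%:R * (gi * gi) * T1 ^+ 2 - pi * (2%:R * B1) ^+ 2); first by rewrite -/pi; ring.
  by rewrite gi2 /pi; ring.
have n4 : 4%:R != 0 :> gint by apply: gnat_neq0.
case: (odd_cases oC) => -[y [z [eC eC2]]]; last first.
  move: key; rewrite eC2 => /(congr1 re); rewrite !gint_simp /=; clear; lia.
have key2 : conj pi1 + lam * z * (1 + 4%:R * conj pi1) = gi * T1 - T1 ^+ 2 - (1 + 4%:R * pi1) * B1 ^+ 2.
  apply: (mulfI n4); transitivity ((1 + 4%:R * conj pi1) * C ^+ 2 - 1); first by rewrite eC2; ring.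
  by rewrite key; ring.
have {}key2 : ((re pi1 + im pi1) %% 2)%Z = ((re B1 + im B1) %% 2)%Z.
  have := congr1 (fun x => re x + im x) key2; rewrite !expr2 !gint_simp /=; clear.
  have [? [->|->]] := int_parity (re T1); have [? [->|->]] := int_parity (im T1);
  have [? [->|->]] := int_parity (re B1); have [? [->|->]] := int_parity (im B1); lia.
have reTB : (re T1 %% 2)%Z = (re B1 %% 2)%Z.
  have pe j : exists k' : int, p%:Z ^+ j = 8%:Z * k' + 1.
    elim: j => [|j [k' ek]]; first by exists 0.
    by exists (8%:Z * k * k' + k + k'); rewrite exprS ek pk; ring.
  have [k' ek] := pe e.
  move: eR; rewrite ek /Rval eC rmorphD rmorphM rmorph1 rmorph_nat /norm /pi !gint_simp /=; clear.
  have [m' [->|->]] := int_parity m; first by lia.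
  have [m2 [->|->]] := int_parity m';
  have [? [->|->]] := int_parity (re T1); have [? [->|->]] := int_parity (im T1);
  have [? [->|->]] := int_parity (re B1); lia.
have e1 := congr1 re es; have e2 := congr1 im es.
move: e1 e2 key2 reTB; rewrite !gint_simp /=; clear; lia.
Qed.

(** The hypotheses say that the trace and the norm of (mu - 1) / (2 + 2 i) are
    integral; the second condition makes B, then T, then B1 + i T1 divisible by
    lam. *)
Lemma conic_normal_form A B C T N :
  conic pi1 A B C -> coprime3 A B C -> A - 1 = lam * T -> (A - 1) ^+ 2 - pi * B ^+ 2 = 8%:R * gi * N ->
  exists T1 B1 s, [/\ A = 1 + 2%:R * gi * T1, B = 2%:R * B1 & B1 + gi * T1 = lam * s].
Proof.
move=> c co eT eN; have [_ _ lP] := gprime_lam.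
have npil : ~ gdvd lam pi by move=> h; apply: (lam_ndvd_p p8); rewrite -(pipi' npi); apply: gdvdMr.
have l2 x : gdvd lam (2%:R * x) by rewrite two_lam; apply/gdvdMr/gdvdMl/gdvdMr/gdvdr.
have lB : gdvd lam B.
  have : gdvd lam (pi * B ^+ 2).
    have -> : pi * B ^+ 2 = (A - 1) * (A - 1) - 2%:R * (4%:R * gi * N).
      by transitivity ((A - 1) ^+ 2 - ((A - 1) ^+ 2 - pi * B ^+ 2)); [|rewrite eN]; ring.
    by apply: gdvdB => //; rewrite eT; apply/gdvdMr/gdvdMr/gdvdr.
  by case/lP => //; rewrite expr2 => /lP[].
have eA : A = 1 + lam * T by rewrite -eT; ring.
have oA : ~ gdvd lam A by rewrite eA; apply: lam_odd.
have [B1 eB] := conic_B_even c oA lB.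
have ll : lam * lam = 2%:R * gi := lam2.
have l0 : lam != 0 by [].
have eT2 : T ^+ 2 = lam * lam * (- (2%:R * gi * N) - pi * B1 ^+ 2).
  have n2 : 2%:R * gi != 0 :> gint by apply: mulf_neq0; [apply: gnat_neq0|].
  apply: (mulfI n2); transitivity ((A - 1) ^+ 2); first by rewrite eT -ll; ring.
  transitivity ((A - 1) ^+ 2 - pi * B ^+ 2 + pi * B ^+ 2); first by ring.
  rewrite eN eB ll; transitivity ((gi * gi) * (- 8%:R * gi * N - 4%:R * pi * B1 ^+ 2)); last by ring.
  by rewrite gi2; ring.
have [T1 eT1] : gdvd lam T.
  have : gdvd lam (T ^+ 2) by rewrite eT2; apply/gdvdMr/gdvdMr/gdvdr.
  by rewrite expr2 => /lP[].
have e2 : T1 ^+ 2 = - (2%:R * gi * N) - pi * B1 ^+ 2.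
  by apply: (mulfI (mulf_neq0 l0 l0)); rewrite -eT2 eT1; ring.
have [s es] : gdvd lam (B1 + gi * T1).
  have := congr1 (fun x => re x + im x) e2; rewrite gdvd_lamP /pi !expr2 !gint_simp /=; clear.
  have [? [->|->]] := int_parity (re T1); have [? [->|->]] := int_parity (im T1);
  have [? [->|->]] := int_parity (re B1); have [? [->|->]] := int_parity (im B1); lia.
by exists T1, B1, s; split=> //; rewrite eA eT1 mulrA ll.
Qed.

End Normal.

(** * Algebraic integers *)

Section AlgInt.
Variable Om : splittingFieldType rat.
Implicit Types x y z : Om.
Lemma Om_int_eq0 (n : int) : ((n%:~R : Om) == 0) = (n == 0).
Proof. by rewrite -scaler_int scaler_eq0 oner_eq0 orbF intr_eq0. Qed.
Lemma Om_nat_eq0 (n : nat) : ((n%:R : Om) == 0) = (n == 0)%N.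
Proof. exact: (Om_int_eq0 n). Qed.
Lemma algint_int (n : int) : algint (n%:~R : Om).
Proof. exact: (@integral_id int Om intr n). Qed.
Lemma algint_nat n : algint (n%:R : Om).
Proof. exact: (algint_int n). Qed.
Lemma algint0 : algint (0 : Om). Proof. exact: (algint_nat 0). Qed.
Lemma algint1 : algint (1 : Om). Proof. exact: (algint_nat 1). Qed.
Lemma algintD x y : algint x -> algint y -> algint (x + y).
Proof. exact: integral_add. Qed.
Lemma algintN x : algint x -> algint (- x).
Proof. exact: integral_opp. Qed.
Lemma algintB x y : algint x -> algint y -> algint (x - y).
Proof. exact: integral_sub. Qed.
Lemma algintM x y : algint x -> algint y -> algint (x * y).
Proof. exact: integral_mul. Qed.

Lemma algint_quadratic x u v : algint u -> algint v -> x ^+ 2 = u * x + v -> algint x.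
Proof.
move=> iu iv e; pose q : {poly Om} := 'X^2 - (u *: 'X + v%:P).
have sq : (size (u *: 'X + v%:P)%R < size ('X^2 : {poly Om})%R)%N.
  rewrite size_polyXn; apply: (leq_ltn_trans (size_polyD _ _)).
  rewrite gtn_max (leq_ltn_trans (size_scale_leq _ _)) ?size_polyX //.
  by rewrite (leq_ltn_trans (size_polyC_leq1 _)).
apply: (@integral_root_monic int Om intr x q).
- by rewrite monicE /q lead_coefDl ?size_polyN // lead_coefXn.
- by rewrite rootE /q !hornerE e; apply/eqP; ring.
- apply/integral_poly => i; rewrite /q !coefE.
  apply: algintB; first exact: algint_nat.
  by apply: algintD; [apply: algintM => //; exact: algint_nat | case: ifP => // _; exact: algint0].
Qed.

Lemma algint_rmorph (f : {rmorphism Om -> Om}) x : algint x -> algint (f x).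
Proof.
case=> q mq rq; exists q => //.
have -> : map_poly (intr : int -> Om) q = map_poly f (map_poly intr q).
  by rewrite -map_poly_comp; apply: eq_map_poly => n /=; rewrite rmorph_int.
by rewrite rmorph_root.
Qed.

(** The rational numbers are integrally closed; reduced to the same statement
    over the algebraic complex numbers. *)
Lemma algint_rat (r : rat) : algint (r%:A : Om) -> r \is a Num.int.
Proof.
case=> q mq rq.
have e : map_poly (intr : int -> Om) q = map_poly (in_alg Om) (map_poly intr q).
  by rewrite -map_poly_comp; apply: eq_map_poly => n /=; rewrite scaler_int.
have {rq}rq : root (map_poly (intr : int -> rat) q) r by move: rq; rewrite e fmorph_root.
have : (ratr r : algC) \in Num.int.
  apply: Cint_rat_Aint; first by apply/CratP; exists r.
  apply: (@root_monic_Aint (map_poly intr q)).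
  - have -> : map_poly (intr : int -> algC) q = map_poly ratr (map_poly (intr : int -> rat) q).
      by rewrite -map_poly_comp; apply: eq_map_poly => n /=; rewrite ratr_int.
    by rewrite fmorph_root.
  - by apply: monic_map.
  - by apply/polyOverP=> i; rewrite coef_map /= rpred_int.
case/intrP => n; rewrite -(ratr_int algC) => /fmorph_inj ->.
by rewrite rpred_int.
Qed.

Lemma algint_rat_int (r : rat) : algint (r%:A : Om) -> exists n : int, r%:A = n%:~R :> Om.
Proof. by case/algint_rat/intrP => n ->; exists n; rewrite scaler_int. Qed.

(** A rational relation, cleared of denominators and of common factors l. *)
Lemma int_dep (l n : nat) (X : 'I_n -> Om) : prime l -> (\dim {:Om} < n)%N ->
  exists2 c : 'I_n -> int, \sum_i (c i)%:~R * X i = 0 & exists i, ~~ (l %| c i)%Z.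
Proof.
move=> pl dX; pose T := [tuple X i | i < n].
have nfT : ~~ free T.
  apply/negP=> fT; have := dimvS (subvf <<T>>); rewrite leqNgt.
  by move/eqP: fT => ->; rewrite size_tuple dX.
have [k [i0 [k0 sk]]] : exists k : 'I_n -> rat, exists i, k i != 0 /\ \sum_i k i *: X i = 0.
  apply: NNPP => H; case/negP: nfT; apply/freeP=> k sk i; apply/eqP/negPn/negP => ki.
  apply: H; exists k, i; split=> //; rewrite -[RHS]sk; apply: eq_bigr => j _.
  by rewrite -tnth_nth tnth_mktuple.
have [c [i1 c0] sc] : exists2 c : 'I_n -> int, exists i, c i != 0 & \sum_i (c i)%:~R * X i = 0.
  pose d := \prod_i denq (k i).
  have d0 : d != 0 by apply/prodf_neq0 => j _; rewrite denq_neq0.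
  exists (fun i => numq (k i) * \prod_(j | j != i) denq (k j)).
    exists i0; rewrite mulf_neq0 ?numq_eq0 //; apply/prodf_neq0 => j _; rewrite denq_neq0 //.
  have -> : \sum_i (numq (k i) * \prod_(j | j != i) denq (k j))%:~R * X i = d%:~R *: \sum_i k i *: X i.
    rewrite scaler_sumr; apply: eq_bigr => i _.
    rewrite scalerA mulrzl -scaler_int; congr (_ *: _).
    have D0 : (denq (k i))%:~R != 0 :> rat by rewrite intr_eq0 denq_neq0.
    rewrite /d [in RHS](bigD1 i) //= !intrM -[X in _ = _ * X]divq_num_den.
    by field.
  by rewrite sk scaler0.
have [N] : exists N : nat, (`|c i1| < N)%N by exists `|c i1|.+1.
elim: N c c0 sc => // N IH c c0 sc cN.
have [h|h] := classic (exists i, ~~ (l %| c i)%Z); first by exists c.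
have {h} cl i : (l %| c i)%Z by apply/negPn/negP => hi; apply: h; exists i.
have ce i : c i = (c i %/ l)%Z * l%:Z by rewrite divzK.
apply: (IH (fun i => (c i %/ l)%Z)).
- by apply: contraNneq c0 => e; rewrite ce e mul0r.
- have l0 : l%:R != 0 :> Om by rewrite Om_nat_eq0 -lt0n prime_gt0.
  apply: (mulfI l0); rewrite mulr0 -[RHS]sc mulr_sumr; apply: eq_bigr => i _.
  by rewrite [in RHS]ce intrM mulrA [_ * _%:~R]mulrC.
- move: (ce i1) cN c0; move: (c i1 %/ l)%Z => u ->; rewrite -absz_gt0 abszM muln_gt0.
  rewrite (_ : `|l%:Z|%N = l) // => h /andP[h1 _].
  have : (`|u| * 2 <= `|u| * l)%N by rewrite leq_mul2l (prime_gt1 pl) orbT.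
  by move: h h1; clear; lia.
Qed.

(** If the chain decreases strictly, the X_i with i <= dim Om witness it.  In an
    integral relation between them, take the least i whose coefficient is prime
    to l: all the other terms lie in J_(i+1), so X_i does too. *)
Lemma chain_bound (l : nat) (J : nat -> Om -> Prop) (X : nat -> Om) : prime l ->
  (forall i x y, J i x -> J i y -> J i (x + y)) ->
  (forall i (n : int) x, J i x -> J i (n%:~R * x)) ->
  (forall i j, J j (l%:R * X i)) ->
  (forall i j x, (i <= j)%N -> J j x -> J i x) ->
  (forall i, (i <= \dim {:Om})%N -> J i (X i) /\ ~ J i.+1 (X i)) -> False.
Proof.
move=> pl JD JM Jl Jmono JX; set n := (\dim {:Om}).+1.
have [c sc [i0 ci0]] := @int_dep l n (fun i => X i) pl (ltnSn _).
case: (@arg_minnP _ i0 (fun i : 'I_n => ~~ (l %| c i)%Z) (fun i => i : nat) ci0) => i ci imin.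
have [Xi nXi] := JX i (ltn_ord i); apply: nXi.
have J0 j : J j 0 by have := JM j 0 _ (Jl 0 j); rewrite mul0r.
have Jc : J i.+1 ((c i)%:~R * X i).
  have -> : (c i)%:~R * X i = (-1)%:~R * \sum_(j | j != i) (c j)%:~R * X j.
    by move/eqP: sc; rewrite (bigD1 i) //= addr_eq0 => /eqP ->; rewrite mulrN1z mulN1r.
  apply: (JM _); apply: big_ind => [|x y|j ji]; [exact: J0 | exact: JD | ].
  case: (ltngtP j i) => [lt|gt|/val_inj e]; last by rewrite e eqxx in ji.
    have : (l %| c j)%Z by apply/negPn/negP => /imin; rewrite leqNgt lt.
    by case/dvdzP=> d ->; rewrite intrM -mulrA; apply: (JM _); apply: Jl.
  by apply: (JM _); apply: (Jmono _ j) => //; have [] := JX j (ltn_ord j).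
have : coprimez (c i) l by rewrite coprimezE coprime_sym prime_coprime // -dvdzE.
case/(coprimezP (c i) l) => -[u v] /= e.
have -> : X i = u%:~R * ((c i)%:~R * X i) + v%:~R * (l%:R * X i).
  by rewrite !mulrA -mulrDl -[l%:R]/(l%:Z%:~R) -!intrM -intrD e mul1r.
by apply: JD; apply: JM.
Qed.

End AlgInt.

(** * Ideals of rings of integers *)

Section Ideals.
Variables (Om : splittingFieldType rat) (E : {subfield Om}).
Implicit Types (x y z : Om) (I J P : Om -> Prop).
Local Notation O := (ring_of_integers E).
Lemma O_int (n : int) : O n%:~R.
Proof. by split; [exact: rpred_int | exact: algint_int]. Qed.
Lemma O_nat (n : nat) : O n%:R. Proof. exact: (O_int n). Qed.
Lemma O0 : O 0. Proof. exact: (O_nat 0). Qed.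
Lemma O1 : O 1. Proof. exact: (O_nat 1). Qed.
Lemma OD x y : O x -> O y -> O (x + y).
Proof. by move=> [? ?] [? ?]; split; [exact: rpredD | exact: algintD]. Qed.
Lemma ON x : O x -> O (- x).
Proof. by move=> [? ?]; split; [rewrite rpredN | exact: algintN]. Qed.
Lemma OB x y : O x -> O y -> O (x - y).
Proof. by move=> ? /ON; apply: OD. Qed.
Lemma OM x y : O x -> O y -> O (x * y).
Proof. by move=> [? ?] [? ?]; split; [exact: rpredM | exact: algintM]. Qed.

Lemma Oprod T (r : seq T) (P : pred T) (F : T -> Om) :
  (forall i, P i -> O (F i)) -> O (\prod_(i <- r | P i) F i).
Proof. by move=> h; apply: big_ind => //; [exact: O1 | exact: OM]. Qed.

Definition is_ideal J := [/\ forall x, J x -> O x, J 0, forall x y, J x -> J y -> J (x + y)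
  & forall r x, O r -> J x -> J (r * x)].
Lemma prime_is_ideal P : is_prime_ideal E P -> is_ideal P.
Proof. by case. Qed.
Section IdealTheory.
Variable J : Om -> Prop.
Hypothesis iJ : is_ideal J.
Lemma ideal_O x : J x -> O x. Proof. by case: iJ => h _ _ _; apply: h. Qed.
Lemma ideal0 : J 0. Proof. by case: iJ. Qed.
Lemma idealD x y : J x -> J y -> J (x + y). Proof. by case: iJ => _ _ h _; apply: h. Qed.
Lemma idealMl r x : O r -> J x -> J (r * x). Proof. by case: iJ => _ _ _ h; apply: h. Qed.
Lemma idealMr r x : O r -> J x -> J (x * r). Proof. by rewrite mulrC; apply: idealMl. Qed.
Lemma idealN x : J x -> J (- x).
Proof. by move=> h; rewrite -mulN1r; apply: idealMl => //; exact: ON O1. Qed.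
Lemma idealB x y : J x -> J y -> J (x - y).
Proof. by move=> h /idealN; apply: idealD. Qed.

Lemma ideal_sum T (r : seq T) (Q : pred T) (F : T -> Om) :
  (forall i, Q i -> J (F i)) -> J (\sum_(i <- r | Q i) F i).
Proof. by move=> h; apply: big_ind => //; [exact: ideal0 | exact: idealD]. Qed.

Lemma ideal_sub x y : J (x - y) -> J y -> J x.
Proof. by move=> h1 h2; rewrite -(subrK y x); apply: idealD. Qed.
End IdealTheory.
Lemma O_is_ideal : is_ideal O.
Proof. by split=> //; [exact: O0 | exact: OD | exact: OM]. Qed.

Lemma ideal_mul_in I J x y : I x -> J y -> ideal_mul I J (x * y).
Proof.
by move=> Ix Jy; exists [:: (x, y)]; rewrite ?big_seq1 // => u; rewrite inE => /eqP ->.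
Qed.

Lemma ideal_mulD I J x y : ideal_mul I J x -> ideal_mul I J y -> ideal_mul I J (x + y).
Proof.
move=> [s hs ->] [t ht ->]; exists (s ++ t); last by rewrite big_cat.
by move=> u; rewrite mem_cat => /orP[/hs|/ht].
Qed.

Lemma ideal_mul_sub I J (K : Om -> Prop) x : K 0 -> (forall x y, K x -> K y -> K (x + y)) ->
  (forall x y, I x -> J y -> K (x * y)) -> ideal_mul I J x -> K x.
Proof.
move=> K0 KD KM [s hs ->]; rewrite big_seq.
by apply: big_ind => // u /hs [h1 h2]; apply: KM.
Qed.

Lemma ideal_mul_ideal I J : (forall x, I x -> O x) -> is_ideal J -> is_ideal (ideal_mul I J).
Proof.
move=> IO iJ; split.
- move=> x; apply: ideal_mul_sub; [exact: O0 | exact: OD |].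
  by move=> u v /IO ? /(ideal_O iJ); apply: OM.
- by exists [::] => //; rewrite big_nil.
- exact: ideal_mulD.
- move=> r x Or [s hs ->]; exists [seq (u.1, r * u.2) | u <- s].
    by move=> u /mapP[v /hs [h1 h2] ->]; split=> //; apply: idealMl.
  by rewrite big_map mulr_sumr; apply: eq_bigr => u _; rewrite mulrCA.
Qed.

Lemma ideal_exp_ideal P n : is_ideal P -> is_ideal (ideal_exp E P n).
Proof.
move=> iP; elim: n => [|n IH]; first exact: O_is_ideal.
by apply: ideal_mul_ideal => // x; apply: ideal_O.
Qed.

Lemma ideal_expS P n x : is_ideal P -> ideal_exp E P n.+1 x -> ideal_exp E P n x.
Proof.
move=> iP; have iPn := ideal_exp_ideal n iP.
apply: ideal_mul_sub; [exact: ideal0 | exact: idealD |] => u v Pu Pv.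
by apply: idealMl => //; apply: (ideal_O iP).
Qed.

Lemma ideal_exp_le P m n x : is_ideal P -> (m <= n)%N -> ideal_exp E P n x -> ideal_exp E P m x.
Proof.
move=> iP /subnK <-; elim: (n - m)%N => // k IH h; apply: IH.
by apply: ideal_expS iP _; rewrite -addSn.
Qed.

Lemma ideal_exp1 P x : is_ideal P -> ideal_exp E P 1 x <-> P x.
Proof.
move=> iP; split=> [|Px].
  apply: ideal_mul_sub; [exact: ideal0 | exact: idealD | move=> u v Pu Ov; exact: idealMr].
by rewrite -(mulr1 x); apply: ideal_mul_in => //; exact: O1.
Qed.

Lemma ideal_exp2M P x y : is_ideal P -> P x -> P y -> ideal_exp E P 2 (x * y).
Proof. by move=> iP Px Py; apply: ideal_mul_in => //; apply/ideal_exp1. Qed.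
Section Prime.
Variable P : Om -> Prop.
Hypothesis Pp : is_prime_ideal E P.
Let iP : is_ideal P := prime_is_ideal Pp.
Lemma prime_n1 : ~ P 1. Proof. by case: Pp. Qed.
Lemma prime_mulP x y : O x -> O y -> P (x * y) -> P x \/ P y.
Proof. by case: Pp => _ _ h _; apply: h. Qed.

Lemma prime_prod T (r : seq T) (Q : pred T) (F : T -> Om) :
  (forall i, Q i -> O (F i) /\ ~ P (F i)) -> ~ P (\prod_(i <- r | Q i) F i).
Proof.
move=> h; suff : O (\prod_(i <- r | Q i) F i) /\ ~ P (\prod_(i <- r | Q i) F i) by case.
apply: (big_ind (fun x => O x /\ ~ P x)) => //; first by split; [exact: O1 | exact: prime_n1].
by move=> x y [Ox nx] [Oy ny]; split; [exact: OM | case/prime_mulP].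
Qed.

Lemma prime_expP x n : O x -> P (x ^+ n) -> P x.
Proof.
move=> Ox; elim: n => [/prime_n1 //|n IH]; rewrite exprS => /prime_mulP[] //.
by elim: (n) => [|m IHm]; [exact: O1 | rewrite exprS; exact: OM].
Qed.

Lemma prime_int_coprime (m n : int) : coprimez m n -> P m%:~R -> P n%:~R -> False.
Proof.
case/(coprimezP m n) => -[u v] /= e h1 h2; apply: prime_n1.
have -> : 1 = u%:~R * m%:~R + v%:~R * n%:~R :> Om by rewrite -!intrM -intrD e.
by apply: idealD => //; apply: idealMl => //; exact: O_int.
Qed.

Lemma O_horner (q : {poly int}) x : O x -> O (map_poly intr q).[x].
Proof.
move=> Ox; elim/poly_ind: q => [|q c IH]; first by rewrite rmorph0 horner0; exact: O0.
by rewrite rmorphD rmorphM /= map_polyX map_polyC !hornerE; apply: OD (O_int c); apply: OM.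
Qed.

(** A nonzero element divides the constant term of an integral equation for it,
    so P contains a positive integer. *)
Lemma prime_ex_prime : exists2 l : nat, prime l & P l%:R.
Proof.
case: Pp => _ _ _ [x Px x0].
have [n n0 Pn] : exists2 n : int, n != 0 & P n%:~R.
  have Ox := ideal_O iP Px; have [_ [q mq rq]] := Ox.
  have q0 : q != 0 by apply: monic_neq0.
  elim/poly_ind: q q0 rq {mq} => [|q c IH]; first by rewrite eqxx.
  have [-> |c0] := eqVneq c 0.
    rewrite addr0 mulf_eq0 negb_or => /andP[q0 _]; rewrite rmorphM /= map_polyX rootM rootX (negPf x0) orbF.
    exact: IH.
  move=> _; rewrite rmorphD rmorphM /= map_polyX map_polyC rootE !hornerE addrC addr_eq0 => /eqP e.
  by exists c => //; rewrite e; apply: idealN => //; apply: idealMl => //; exact: O_horner.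
have {n n0 Pn}[n n0 Pn] : exists2 n : nat, (0 < n)%N & P n%:R.
  exists `|n|%N; first by rewrite absz_gt0.
  case: n n0 Pn => n _ // h; have := idealN iP h; by rewrite NegzE mulrNz opprK.
have [N] : exists N, (n < N)%N by exists n.+1.
elim: N n n0 Pn => // N IH n n0 Pn nN.
case: (leqP n 1) => n1.
  have e : n = 1%N by clear -n0 n1; lia.
  by move: Pn; rewrite e => /prime_n1.
have pl := pdiv_prime n1; have /dvdnP[k ek] := pdiv_dvd n.
move: Pn; rewrite {1}ek natrM => /prime_mulP[||Pk|Pl]; [exact: O_nat | exact: O_nat | | by exists (pdiv n)].
have k0 : (0 < k)%N by move: n0; rewrite {1}ek muln_gt0 => /andP[].
apply: (IH k) => //; have := prime_gt1 pl; move: nN ek k0; move: (pdiv n) => d; clear.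
move=> h e k0 d1; have : (k * 1 < k * d)%N by rewrite ltn_pmul2l.
by move: h e; clear; lia.
Qed.

(** An integral equation for x, reduced modulo l and divided by its power of x,
    has a nonzero constant term because x is outside P; that term is invertible
    modulo l. *)
Lemma prime_inv x : O x -> ~ P x -> exists2 y, O y & P (x * y - 1).
Proof.
move=> Ox nPx; have [l pl Pl] := prime_ex_prime.
have [_ [q mq rq]] := Ox.
have inv_int (c : int) : ~~ (l %| c)%Z -> exists d : int, P (c%:~R * d%:~R - 1).
  move=> lc; have : coprimez l c by rewrite coprimezE prime_coprime // -dvdzE.
  case/(coprimezP l c) => -[u v] /= e; exists v.
  have -> : c%:~R * v%:~R - 1 = (c * v - 1)%:~R :> Om by rewrite intrB intrM.
  have -> : c * v - 1 = - u * l%:Z by rewrite -e; ring.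
  rewrite intrM -[l%:Z%:~R]/(l%:R).
  by apply: idealMl => //; exact: O_int.
have [i qi] : exists i, ~~ (l %| q`_i)%Z.
  exists (size q).-1; rewrite -/(lead_coef q) (monicP mq) dvdzE dvdn1.
  by rewrite -[`|l%:Z|%N]/l; case: eqP (prime_gt1 pl) => // ->.
have Pq : P (map_poly intr q).[x] by rewrite (rootP rq); exact: ideal0.
elim/poly_ind: q i qi Pq {mq rq} => [|q c IH] i; first by rewrite coef0 dvdz0.
rewrite rmorphD rmorphM /= map_polyX map_polyC !hornerE => qi h.
have [/dvdzP[d ed]|lc] := boolP (l %| c)%Z; last first.
  have [d hd] := inv_int c lc.
  exists (- d%:~R * (map_poly intr q).[x]).
    by apply: OM (O_horner _ Ox); apply: ON; exact: O_int.
  have -> : x * (- d%:~R * (map_poly intr q).[x]) - 1 = - d%:~R * ((map_poly intr q).[x] * x + c%:~R) + (c%:~R * d%:~R - 1) by ring.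
  by apply: idealD => //; apply: idealMl => //; apply: ON; exact: O_int.
case: i qi => [|i]; first by rewrite coefD coefMX coefC /= add0r ed dvdz_mull.
rewrite coefD coefMX coefC /= addr0 => qi; apply: (IH i qi).
have : P ((map_poly intr q).[x] * x).
  apply: (ideal_sub iP (y := - c%:~R)); first by rewrite opprK.
  by apply: idealN => //; rewrite ed intrM; apply: idealMl => //; exact: O_int.
by case/prime_mulP => //; exact: O_horner.
Qed.

End Prime.
End Ideals.

(** * Finiteness of ideals and powers of a prime ideal *)

Section Finite.
Variables (Om : splittingFieldType rat) (E : {subfield Om}).
Implicit Types (x y z : Om) (I J P : Om -> Prop).
Local Notation O := (ring_of_integers E).
Local Notation is_ideal := (is_ideal E).

(** Defined by recursion on the list, so that proofs can eliminate the
    generators one after the other. *)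
Fixpoint gen (s : seq Om) (x : Om) : Prop :=
  if s is g :: s' then exists a y, [/\ O a, gen s' y & x = a * g + y] else x = 0.

Lemma gen0 s : gen s 0.
Proof. by elim: s => //= g s IH; exists 0, 0; split; rewrite ?mul0r ?add0r //; exact: O0. Qed.

Lemma genD s x y : gen s x -> gen s y -> gen s (x + y).
Proof.
elim: s x y => [|g s IH] x y /=; first by move=> -> ->; rewrite addr0.
move=> [a [u [Oa hu ->]]] [b [v [Ob hv ->]]]; exists (a + b), (u + v).
by split; [exact: OD | exact: IH | ring].
Qed.

Lemma genM s r x : O r -> gen s x -> gen s (r * x).
Proof.
move=> Or; elim: s x => [|g s IH] x /=; first by move=> ->; rewrite mulr0.
by move=> [a [u [Oa hu ->]]]; exists (r * a), (r * u); split; [exact: OM | exact: IH | ring].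
Qed.

Lemma gen_mem s x : x \in s -> gen s x.
Proof.
elim: s => //= g s IH; rewrite inE => /orP[/eqP ->|/IH h].
  by exists 1, 0; split; [exact: O1 | exact: gen0 | ring].
by exists 0, x; split; [exact: O0 | | ring].
Qed.

Lemma gen_drop k s x : gen (drop k s) x -> gen s x.
Proof.
elim: k s => [|k IH] [|g s] //=.
by move=> /IH h; exists 0, x; split; [exact: O0 | | ring].
Qed.

(** Choosing elements outside the ideal generated by l and the previous choices
    produces a chain, which stops by [chain_bound]. *)
Lemma ideal_fg (l : nat) J : prime l -> is_ideal J -> J l%:R ->
  exists2 s, (forall g, g \in s -> J g) & forall x, J x -> gen s x.
Proof.
move=> pl iJ Jl; apply: NNPP => H.
have ext s : (forall g, g \in s -> J g) -> exists x, J x /\ ~ gen (l%:R :: s) x.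
  move=> sJ; apply: NNPP => h; apply: H; exists (l%:R :: s).
    by move=> g; rewrite inE => /orP[/eqP ->|/sJ].
  by move=> x Jx; apply: NNPP => nx; apply: h; exists x.
pose n := \dim {:Om}.
have [s ss [sJ sP]] : exists2 s, size s = n.+1 & (forall g, g \in s -> J g) /\
    forall i, (i < n.+1)%N -> ~ gen (l%:R :: drop i.+1 s) s`_i.
  elim: (n.+1) => [|m [s ss [sJ IH]]]; first by exists [::].
  have [x [Jx nx]] := ext s sJ; exists (x :: s); first by rewrite /= ss.
  split; first by move=> g; rewrite inE => /orP[/eqP ->|/sJ].
  by case=> [|i] im; [rewrite /= drop0 | exact: IH].
(* The choices are consed in front of s, so that these ideals decrease with i. *)
pose K i := gen (l%:R :: drop i s).
apply: (@chain_bound Om l K (fun i => s`_i) pl).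
- by move=> i x y; apply: genD.
- by move=> i c x; apply: genM; exact: O_int.
- move=> i j; rewrite mulrC; apply: genM; last by apply: gen_mem; rewrite mem_head.
  have [h|h] := ltnP i (size s); last by rewrite nth_default //; exact: O0.
  by apply: (ideal_O iJ); apply: sJ; exact: mem_nth.
- move=> i j x ij; rewrite /K /=; case=> a [y [Oa hy ->]]; exists a, y; split=> //.
  by apply: (@gen_drop (j - i)); rewrite drop_drop subnK.
- move=> i iN; split; last exact: sP.
  apply: gen_mem; rewrite inE; apply/orP; right.
  by rewrite (drop_nth 0) ?ss // mem_head.
Qed.

(** By induction on the generators, with a multiplier u outside P such that u J
    lies in the span of those left: writing u g with coefficient a in P gives
    (u - a) g in the span of the remaining ones, and u - a is outside P. *)
Lemma nakayama P J x0 : is_prime_ideal E P -> is_ideal J -> J x0 -> x0 != 0 ->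
  (exists2 s, (forall g, g \in s -> J g) & forall x, J x -> gen s x) ->
  ~ (forall x, J x -> ideal_mul P J x).
Proof.
move=> Pp iJ Jx0 x00 [s sJ hs] JPJ; have iP := prime_is_ideal Pp.
have [u [Ou nPu hu]] : exists u, [/\ O u, ~ P u & forall x, J x -> gen s (u * x)].
  by exists 1; split; [exact: O1 | exact: prime_n1 Pp | move=> x /hs; rewrite mul1r].
elim: s u Ou nPu hu {hs} sJ => [|g s IH] u Ou nPu hu sJ.
  have /= /eqP := hu _ Jx0; rewrite mulf_eq0 (negPf x00) orbF => /eqP u0.
  by apply: nPu; rewrite u0; exact: ideal0 iP.
have key x : J x -> exists a y, [/\ P a, gen s y & u * x = a * g + y].
  move=> /JPJ [t ht ->]; elim: t ht => [|v t IHt] ht.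
    by exists 0, 0; split; [exact: ideal0 iP | exact: gen0 | rewrite big_nil; ring].
  have [|a [y [Pa hy e]]] := IHt; first by move=> w wt; apply: ht; rewrite inE wt orbT.
  have [Pv Jv] := ht v (mem_head _ _); have [b [z [Ob hz e']]] := hu _ Jv.
  exists (v.1 * b + a), (v.1 * z + y); split.
  - by apply: (idealD iP) => //; exact: (idealMr iP).
  - by apply: genD => //; apply: genM => //; exact: (ideal_O iP).
  - by rewrite big_cons mulrDr e mulrCA e'; ring.
have [a [y [Pa hy e]]] := key g (sJ g (mem_head _ _)).
have Oa := ideal_O iP Pa; have nua : ~ P (u - a) by move=> h; apply/nPu/(ideal_sub iP h).
apply: (IH (u * (u - a))).
- by apply: OM => //; exact: OB.
- by case/(prime_mulP Pp) => //; exact: OB.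
- move=> x Jx; have [b [z [Ob hz e']]] := hu _ Jx.
  have -> : u * (u - a) * x = b * y + (u - a) * z.
    have ey : y = (u - a) * g by rewrite mulrBl e; ring.
    by rewrite ey mulrAC e'; ring.
  by apply: genD; apply: genM => //; exact: OB.
- by move=> h hh; apply: sJ; rewrite inE hh orbT.
Qed.

Lemma ideal_exp_strict (l : nat) P n : prime l -> is_prime_ideal E P -> ideal_exp E P n l%:R ->
  ~ (forall x, ideal_exp E P n x -> ideal_exp E P n.+1 x).
Proof.
move=> pl Pp Pl; have iP := prime_is_ideal Pp; have iPn := ideal_exp_ideal n iP.
apply: (nakayama Pp iPn Pl); first by rewrite Om_nat_eq0 -lt0n prime_gt0.
exact: ideal_fg pl iPn Pl.
Qed.

(** Consecutive powers of P that contain l are distinct by [nakayama], so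
    [chain_bound] applies to them. *)
Lemma ideal_exp_notin (l : nat) P : prime l -> is_prime_ideal E P -> exists n, ~ ideal_exp E P n l%:R.
Proof.
move=> pl Pp; have iP := prime_is_ideal Pp; apply: NNPP => H.
have Pl n : ideal_exp E P n l%:R by apply: NNPP => h; apply: H; exists n.
have step n : exists x, ideal_exp E P n x /\ ~ ideal_exp E P n.+1 x.
  apply: NNPP => h; apply: (ideal_exp_strict pl Pp (Pl n)) => x hx.
  by apply: NNPP => nx; apply: h; exists x.
have [X hX] : exists X : nat -> Om, forall n, (n <= \dim {:Om})%N -> ideal_exp E P n (X n) /\ ~ ideal_exp E P n.+1 (X n).
  have /fin_all_exists[Y hY] : forall n : 'I_(\dim {:Om}).+1, exists x, ideal_exp E P n x /\ ~ ideal_exp E P n.+1 x.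
    by move=> n; apply: step.
  by exists (fun n => Y (inord n)) => n hn; have := hY (inord n); rewrite inordK.
have XO n : (n <= \dim {:Om})%N -> O (X n).
  by move=> hn; have [h _] := hX n hn; apply: ideal_O h; apply: ideal_exp_ideal.
pose X' n := if (n <= \dim {:Om})%N then X n else 0.
apply: (@chain_bound Om l (ideal_exp E P) X' pl).
- by move=> i x y; apply: idealD; apply: ideal_exp_ideal.
- by move=> i n x; apply: idealMl (O_int E n); apply: ideal_exp_ideal.
- move=> i j; rewrite mulrC; apply: idealMl (Pl j); first exact: ideal_exp_ideal.
  by rewrite /X'; case: ifP => [/XO //|_]; exact: O0.
- by move=> i j x ij; apply: ideal_exp_le.
- by move=> i hi; rewrite /X' hi; apply: hX.
Qed.

(** An ideal that is maximal among the proper ones containing l; it exists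
    because ascending chains are bounded by [chain_bound]. *)
Lemma prime_above (l : nat) : prime l -> exists2 P, is_prime_ideal E P & P l%:R.
Proof.
move=> pl; pose proper J := [/\ is_ideal J, J l%:R & ~ J 1].
have l_proper : proper (fun x => exists2 y, O y & x = l%:R * y).
  split.
  - split.
    + by move=> x [y Oy ->]; apply: OM => //; exact: O_nat.
    + by exists 0; [exact: O0 | rewrite mulr0].
    + by move=> x y [u Ou ->] [v Ov ->]; exists (u + v); [exact: OD | rewrite mulrDr].
    + by move=> r x Or [y Oy ->]; exists (r * y); [exact: OM | rewrite mulrCA].
  - by exists 1; [exact: O1 | rewrite mulr1].
  - case=> y [_ iy] e; have l0 : l%:R != 0 :> Om by rewrite Om_nat_eq0 -lt0n prime_gt0.
    have ey : y = (l%:R^-1 : rat)%:A.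
      apply: (mulfI l0); rewrite -e mulr_natl -scaler_nat scalerA divff ?scale1r // pnatr_eq0 -lt0n prime_gt0 //.
    rewrite ey in iy; have /intrP[n en] := algint_rat iy.
    have : (1 : rat) = (l%:Z * n)%:~R by rewrite intrM -en -[l%:Z%:~R]/(l%:R) divff // pnatr_eq0 -lt0n prime_gt0.
    move/eqP; rewrite -[1]/(1%:~R) eqr_int => /eqP/(congr1 absz); rewrite abszM.
    by move/esym/eqP; rewrite muln_eq1 => /andP[/eqP h _]; have := prime_gt1 pl; rewrite -[l]/(`|l%:Z|%N) h.
have [J Jp Jmax] : exists2 J, proper J & forall K, proper K -> (forall x, J x -> K x) -> forall x, K x -> J x.
  apply: NNPP => H.
  have up J : proper J -> exists K x, [/\ proper K, forall y, J y -> K y, K x & ~ J x].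
    move=> Jp; apply: NNPP => h; apply: H; exists J => // K Kp JK x Kx; apply: NNPP => nx.
    by apply: h; exists K, x.
  pose n := (\dim {:Om}).+1.
  have [Js [X hX]] : exists Js : nat -> Om -> Prop, exists X : nat -> Om, [/\ forall i, proper (Js i),
      forall i y, Js i.+1 y -> Js i y & forall i, (i < n)%N -> Js i (X i) /\ ~ Js i.+1 (X i)].
    (* The index 0 is that of the largest ideal: each extension is put in front. *)
    elim: n => [|n [Js [X [h1 h2 h3]]]].
      by exists (fun _ x => exists2 y, O y & x = l%:R * y), (fun _ => 0).
    have [K [x [Kp JK Kx nx]]] := up _ (h1 0%N).
    exists (fun i => if i is j.+1 then Js j else K), (fun i => if i is j.+1 then X j else x).
    by split; [case | case=> [|i] y; [exact: JK | exact: h2] | case=> [|i] hi; [ | exact: h3]].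
  case: hX => h1 h2 h3; have iJs i : is_ideal (Js i) by case: (h1 i).
  pose X' i := if (i < n)%N then X i else 0.
  apply: (@chain_bound Om l Js X' pl).
  - by move=> i x y; apply: idealD.
  - by move=> i c x; apply: idealMl => //; exact: O_int.
  - move=> i j; rewrite mulrC; apply: idealMl => //; last by case: (h1 j).
    by rewrite /X'; case: ifP => [/h3 [h _]|_]; [exact: ideal_O h | exact: O0].
  - move=> i j x /subnK <-; elim: (j - i)%N => // k IH; rewrite addSn => /h2; exact: IH.
  - by move=> i hi; rewrite /X' ltnS hi; apply: h3.
case: Jp => iJ Jl nJ1; exists J => //; split; [exact: iJ | exact: nJ1 | | ]; last first.
  by exists l%:R => //; rewrite Om_nat_eq0 -lt0n prime_gt0.
move=> x y Ox Oy Jxy; have [Jx|nJx] := classic (J x); [by left | right].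
pose K z := exists a b, [/\ J a, O b & z = a + x * b].
have iK : is_ideal K.
  split.
  - by move=> z [a [b [Ja Ob ->]]]; apply: OD; [exact: ideal_O Ja | exact: OM].
  - by exists 0, 0; split; [exact: ideal0 iJ | exact: O0 | ring].
  - move=> z w [a [b [Ja Ob ->]]] [c [d [Jc Od ->]]]; exists (a + c), (b + d).
    by split; [exact: (idealD iJ) | exact: OD | ring].
  - move=> r z Or [a [b [Ja Ob ->]]]; exists (r * a), (r * b).
    by split; [exact: (idealMl iJ) | exact: OM | ring].
have JK z : J z -> K z by move=> Jz; exists z, 0; split=> //; [exact: O0 | ring].
have K1 : K 1.
  apply: NNPP => nK1; apply: nJx; apply: (Jmax K) => //; first by split=> //; exact: JK.
  by exists 0, 1; split; [exact: ideal0 iJ | exact: O1 | ring].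
case: K1 => a [b [Ja Ob e]].
have -> : y = y * a + b * (x * y) by rewrite -[LHS]mulr1 e; ring.
by apply: (idealD iJ); apply: (idealMl iJ).
Qed.

End Finite.

(** * Trivial inertia and ramification *)

Section Inertia.
Variables (Om : splittingFieldType rat) (k K : {subfield Om}).
Implicit Types (x y z : Om) (P : Om -> Prop).
Local Notation O := (ring_of_integers K).
Local Notation G := 'Gal(K / k)%g.
Hypothesis galK : galois k K.
Lemma O_gal (s : gal_of K) x : O x -> O (s x).
Proof. by move=> [xK ix]; split; [exact: memv_gal | exact: algint_rmorph]. Qed.
Variable P : Om -> Prop.
Hypothesis Pp : is_prime_ideal K P.
Let iP : is_ideal K P := prime_is_ideal Pp.
Hypothesis trivial_inertia : forall s, s \in G -> s != 1%g -> exists2 x, O x & ~ P (s x - x).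

(** Expand the product over s <> 1 of t(x_s) - s(x_s), where s moves x_s modulo
    P: it vanishes at each t <> 1 and is outside P at t = 1. *)
Lemma galois_coordinates : exists2 T : seq (Om * Om), forall u, u \in T -> O u.1 /\ O u.2 &
  (forall t, t \in G -> t != 1%g -> \sum_(u <- T) u.1 * t u.2 = 0)
  /\ ~ P (\sum_(u <- T) u.1 * u.2).
Proof.
have /fin_all_exists[x hx] : forall s : gal_of K, exists x, s \in G -> s != 1%g -> O x /\ ~ P (s x - x).
  move=> s; case: (classic (s \in G /\ s != 1%g)) => [[sG s1]|h].
    by have [x Ox nx] := trivial_inertia sG s1; exists x.
  by exists 0 => sG s1; case: h.
pose S := [seq s <- enum G | s != 1%g].
have expand (L : seq (gal_of K)) : (forall s, s \in L -> O (x s)) ->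
   exists2 T : seq (Om * Om), forall u, u \in T -> O u.1 /\ O u.2 &
   forall t : gal_of K, \prod_(s <- L) (t (x s) - s (x s)) = \sum_(u <- T) u.1 * t u.2.
  elim: L => [|s L IH] hL.
    exists [:: (1, 1)]; first by move=> u; rewrite inE => /eqP ->; split; exact: O1.
    by move=> t; rewrite big_nil big_seq1 /= rmorph1 mulr1.
  have [|T hT eT] := IH; first by move=> s' h; apply: hL; rewrite inE h orbT.
  have Os := hL s (mem_head _ _).
  (* In the factor for s, t acts on x s but not on s (x s). *)
  exists ([seq (u.1, x s * u.2) | u <- T] ++ [seq (- s (x s) * u.1, u.2) | u <- T]).
    move=> u; rewrite mem_cat => /orP[] /mapP[v /hT [h1 h2] ->] /=; split=> //.
      exact: OM.
    by apply: OM => //; apply: ON; exact: O_gal.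
  move=> t; rewrite big_cons eT big_cat !big_map mulrBl !mulr_sumr -sumrN -!big_split /=.
  rewrite -big_split; apply: eq_bigr => u _; rewrite rmorphM /=; ring.
have SP s : s \in S -> s \in G /\ s != 1%g by rewrite mem_filter mem_enum => /andP[].
have [|T hT eT] := expand S; first by move=> s /SP[sG s1]; case: (hx s sG s1).
exists T => //; split=> [t tG t1|].
  rewrite -eT (big_rem t) /=; last by rewrite mem_filter t1 mem_enum.
  by rewrite subrr mul0r.
have <- : \prod_(s <- S) (x s - s (x s)) = \sum_(u <- T) u.1 * u.2.
  have := eT 1%g; under eq_bigr do rewrite gal_id.
  by move=> ->; apply: eq_bigr => u _; rewrite gal_id.
rewrite big_seq; apply: (prime_prod Pp) => s /SP[sG s1]; have [Ox nx] := hx s sG s1.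
split; first by apply: OB => //; exact: O_gal.
by rewrite -opprB => h; apply: nx; rewrite -[_ - _]opprK; exact: (idealN iP).
Qed.

(** With D the value at t = 1, z D is the sum of X_j Tr(z Y_j), and these traces
    are elements of k in P.  Since D is invertible modulo P, the
    membership of z D passes to z. *)
Lemma conjugates_in_square z : O z -> (forall t, t \in G -> P (t z)) ->
  (forall x, extended_prime k K P x -> ideal_exp K P 2 x) -> ideal_exp K P 2 z.
Proof.
move=> Oz hz h2; have [T hT [T0 T1]] := galois_coordinates.
have iP2 := ideal_exp_ideal 2 iP.
have Pz : P z by have := hz 1%g (group1 _); rewrite gal_id.
set D := \sum_(u <- T) u.1 * u.2 in T1.
have OD' : O D by rewrite /D big_seq; apply: (ideal_sum (O_is_ideal K)) => u /hT [? ?]; exact: OM.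
have zD : ideal_exp K P 2 (z * D).
  apply: h2.
  have -> : z * D = \sum_(u <- T) galTrace k K (z * u.2) * u.1.
    under eq_bigr do rewrite mulr_suml.
    (* Exchanging the sum with the trace, only t = 1 contributes. *)
    rewrite exchange_big (bigD1 1%g) ?group1 //= [X in _ = _ + X]big1 ?addr0.
      by rewrite mulr_sumr; apply: eq_bigr => u _; rewrite gal_id; ring.
    move=> t /andP[tG t1].
    transitivity (t z * \sum_(u <- T) u.1 * t u.2); last by rewrite (T0 t tG t1) mulr0.
    by rewrite mulr_sumr; apply: eq_bigr => u _; rewrite rmorphM /=; ring.
  exists [seq (galTrace k K (z * u.2), u.1) | u <- T]; last by rewrite big_map.
  move=> _ /mapP[u /hT [O1 O2] ->] /=; split=> //; split; last first.
    by apply: mem_galTrace => //; case: (OM Oz O2).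
  apply: (ideal_sum iP) => t tG; rewrite rmorphM /=; apply: (idealMr iP); [exact: O_gal | exact: hz].
have [v Ov hv] := prime_inv Pp OD' T1.
have -> : z = v * (z * D) - z * (D * v - 1) by ring.
by apply: (idealB iP2); [exact: (idealMl iP2) | exact: ideal_exp2M].
Qed.

(** Otherwise P^2 would contain P, against [ideal_exp_strict].  For each
    automorphism s that does not preserve P there is c_s outside P with s(c_s)
    in P; multiplied by all the c_s, an element of P lies in every conjugate of
    P, and so in P^2 by [conjugates_in_square].  The factors c_s are invertible
    modulo P. *)
Lemma unramified_at_prime : ramification_index k K P 1.
Proof.
split.
  move=> x h; apply/(ideal_exp1 _ iP); apply: ideal_mul_sub h; [exact: ideal0 iP | exact: (idealD iP)|].
  by move=> u v [Pu _] Ov; exact: (idealMr iP).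
move=> h2; have iP2 := ideal_exp_ideal 2 iP.
have [l pl Pl] := prime_ex_prime Pp.
have Pl1 : ideal_exp K P 1 l%:R by apply/(ideal_exp1 _ iP).
apply: (ideal_exp_strict pl Pp Pl1) => z0 /(ideal_exp1 _ iP) Pz0.
have /fin_all_exists[c hc] : forall s : gal_of K, exists c, [/\ O c, ~ P c & s \in G ->
    P (s c) \/ forall x, P x -> P (s x)].
  move=> s; case: (classic (exists c, [/\ O c, ~ P c & P (s c)])) => [[c [Oc nc Pc]]|h].
    by exists c; split=> // _; left.
  exists 1; split; [exact: O1 | exact: prime_n1 Pp | move=> sG; right].
  have sP x : P x -> P (s^-1%g x).
    move=> Px; apply: NNPP => nx; apply: h; exists (s^-1%g x).
    have Ox := ideal_O iP Px; have xK : x \in K by case: Ox.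
    by split=> //; [exact: O_gal | rewrite -galM // mulVg gal_id].
  have sPn n x : P x -> P ((s^-1 ^+ n)%g x).
    elim: n x => [|n IH] x Px; first by rewrite expg0 gal_id.
    have [xK _] := ideal_O iP Px.
    by rewrite expgSr galM //; apply: sP; exact: IH.
  move=> x Px; have -> : s = ((s^-1) ^+ #[s^-1].-1)%g by rewrite -invg_expg invgK.
  exact: sPn.
pose C := \prod_(s in G) c s.
have OC : O C by apply: Oprod => s _; case: (hc s).
have nC : ~ P C by apply: (prime_prod Pp) => s _; case: (hc s).
have Oz0 := ideal_O iP Pz0.
have hC : ideal_exp K P 2 (z0 * C).
  apply: conjugates_in_square => //; first exact: OM.
  move=> t tG; rewrite rmorphM /=; have [Oc nc /(_ tG) [Ptc|tP]] := hc t.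
    apply: (idealMl iP); first exact: O_gal.
    rewrite /C (bigD1 t) //= rmorphM /=; apply: (idealMr iP) => //.
    by apply: O_gal; apply: Oprod => s _; case: (hc s).
  by apply: (idealMr iP); [exact: O_gal | exact: tP].
have [v Ov hv] := prime_inv Pp OC nC.
have -> : z0 = v * (z0 * C) - z0 * (C * v - 1) by ring.
by apply: (idealB iP2); [exact: (idealMl iP2) | exact: ideal_exp2M].
Qed.

End Inertia.

(** High powers of P do not contain l, while the extended prime does. *)
Lemma ramification_index_exists (Om : splittingFieldType rat) (k K : {subfield Om}) (l : nat) P :
  prime l -> is_prime_ideal K P -> P l%:R -> (forall x, extended_prime k K P x -> ideal_exp K P 2 x) ->
  exists2 e, (1 < e)%N & ramification_index k K P e.
Proof.
move=> pl Pp Pl h2; have iP := prime_is_ideal Pp.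
have [n nn] := ideal_exp_notin pl Pp.
have ln : ~ (forall x, extended_prime k K P x -> ideal_exp K P n x).
  move=> h; apply: nn; apply: h; rewrite -[l%:R]mulr1; apply: ideal_mul_in (O1 _).
  by split=> //; exact: rpred_nat.
have : exists e, ~ (forall x, extended_prime k K P x -> ideal_exp K P e.+2 x).
  by exists n => h; apply: ln => x /h hx; apply: ideal_exp_le hx => //; rewrite -addn2 leq_addr.
case=> m; elim: m => [//|m IH] hm.
case: (classic (forall x, extended_prime k K P x -> ideal_exp K P m.+2 x)) => [h|]; last exact: IH.
by exists m.+2.
Qed.

(** * Quadratic extensions and their automorphisms *)

Section Quadratic.
Variable Om : splittingFieldType rat.
Implicit Types (x y z w : Om) (F M : {subfield Om}).
Lemma Om_pchar0 : [pchar Om] =i pred0.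
Proof. by move=> l; rewrite !inE Om_nat_eq0; case: l => // l; rewrite andbF. Qed.

Lemma galois_criterion F M : (F <= M)%VS ->
  (forall f : 'AEnd(Om), (forall x, x \in F -> f x = x) -> forall x, x \in M -> f x \in M) ->
  galois F M.
Proof.
move=> FM H; apply/and3P; split=> //.
  by apply/separableP => y _; apply: (pcharf0_separable _ Om_pchar0).
apply/forall_inP => f; rewrite inE kAutfE => /kAHomP hf.
rewrite eqEdim limg_dim_eq ?leqnn ?andbT; last first.
  by rewrite (eqP (AEnd_lker0 f)) capv0.
by apply/subvP => _ /memv_imgP[x xM ->]; apply: H.
Qed.

Lemma galois_full F : galois F {:Om}.
Proof. by apply: galois_criterion => [|f _ x _]; [exact: subvf | exact: memvf]. Qed.
Lemma sqr_eq x y : x ^+ 2 = y ^+ 2 -> x = y \/ x = - y.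
Proof. by move/eqP; rewrite eqf_sqr => /orP[] /eqP ->; [left|right]. Qed.

(** Every automorphism fixes or negates z; if none negated it, z would lie in F. *)
Lemma gal_flip F M z : galois F M -> z \in M -> z ^+ 2 \in F -> z \notin F ->
  exists2 g, g \in 'Gal(M / F)%g & g z = - z.
Proof.
move=> gFM zM z2 zF; have FM : (F <= M)%VS by case/and3P: gFM.
apply: NNPP => H; case/negP: zF.
rewrite -{1}(galois_fixedField gFM); apply/fixedFieldP => // g gG.
have : (g z) ^+ 2 = z ^+ 2 by rewrite -rmorphXn /= (fixed_gal FM gG z2).
by case/sqr_eq => // h; case: H; exists g.
Qed.

Lemma quad_adjoin F w x : w ^+ 2 \in F -> x \in <<F; w>>%VS ->
  exists u v, [/\ u \in F, v \in F & x = u + v * w].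
Proof.
move=> w2 /Fadjoin_polyP[q qF ->]; pose d : {poly Om} := 'X^2 - (w ^+ 2)%:P.
have dF : d \is a polyOver F by rewrite rpredB ?polyOverXn ?polyOverC.
have sd : size d = 3%N by rewrite size_XnsubC.
have rF := modp_polyOver qF dF; set r := q %% d in rF.
have sr : (size r <= 2)%N by rewrite -ltnS -sd ltn_modp -size_poly_eq0 sd.
exists r`_0, r`_1; split; [exact: (polyOverP rF) | exact: (polyOverP rF) |].
have dw : d.[w] = 0 by rewrite /d hornerD hornerN hornerC hornerXn subrr.
have -> : q.[w] = r.[w] by rewrite {1}(divp_eq q d) hornerD hornerM dw mulr0 add0r.
rewrite (horner_coef_wide _ sr) !big_ord_recl big_ord0 /= expr0 expr1; ring.
Qed.

(** The square of u + v w lies in F only if u v w does. *)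
Lemma quad_descent F w z : w ^+ 2 \in F -> z ^+ 2 \in F -> z \in <<F; w>>%VS ->
  z \in F \/ z * w \in F.
Proof.
move=> w2 z2 /(quad_adjoin w2) [u [v [uF vF e]]].
have n2 : 2%:R != 0 :> Om by rewrite Om_nat_eq0.
have : u * v * w \in F.
  have -> : u * v * w = (z ^+ 2 - u ^+ 2 - v ^+ 2 * w ^+ 2) / 2%:R by rewrite e; field.
  by apply: rpred_div; [apply: rpredB; [apply: rpredB => //; exact: rpredX | apply: rpredM => //; exact: rpredX] | exact: rpred_nat].
have [v0|v0] := eqVneq v 0; first by left; rewrite e v0 mul0r addr0.
have [u0|u0] := eqVneq u 0; first by right; rewrite e u0 add0r -mulrA rpredM.
move=> uvw; left; have wF : w \in F.
  have -> : w = u * v * w / (u * v) by rewrite mulrAC divff ?mul1r // mulf_neq0.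
  by apply: rpred_div => //; exact: rpredM.
by rewrite e; apply: rpredD => //; exact: rpredM.
Qed.

Lemma sqrt_int_notin1 (n : int) z : z ^+ 2 = n%:~R -> (forall m : int, m ^+ 2 <> n) ->
  z \notin 1%VS.
Proof.
move=> e nn; apply/negP => /vlineP[r zr].
have iz : algint z.
  apply: (@algint_quadratic _ z 0 n%:~R); [exact: algint0 | exact: algint_int | by rewrite e mul0r add0r].
rewrite zr in iz; have [m em] := algint_rat_int iz.
apply: (nn m); apply/eqP; rewrite -subr_eq0 -(Om_int_eq0 Om) intrB subr_eq0 -e zr em rmorphXn.
by [].
Qed.

End Quadratic.
Section Rational.
Variable Om : splittingFieldType rat.
Implicit Types x y w : Om.

Lemma algint_sqr x y : algint y -> x ^+ 2 = y -> algint x.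
Proof.
by move=> iy e0; apply: (@algint_quadratic _ _ 0 y); rewrite ?mul0r ?add0r //; exact: algint0.
Qed.

Lemma rational_algint x : x \in 1%VS -> algint x -> exists n : int, x = n%:~R.
Proof. by move=> /vlineP[c ->]; exact: algint_rat_int. Qed.

Lemma rational_fixed (f : {rmorphism Om -> Om}) x : x \in 1%VS -> f x = x.
Proof.
by move=> /vlineP[u ->]; rewrite -in_algE -[LHS]/((f \o in_alg Om) u) !fmorph_eq_rat.
Qed.

(** The integers t, N and c are the trace and the norm of x, and (x~ - x) w for
    the conjugate x~; the second relation expresses the discriminant t^2 - 4 N
    in terms of c. *)
Lemma quadratic_integer (n : int) w x : w ^+ 2 = n%:~R -> (forall m : int, m ^+ 2 <> n) ->
  x \in <<1; w>>%VS -> algint x -> exists t c N : int,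
  [/\ 2%:R * n%:~R * x = (n * t)%:~R - c%:~R * w, c ^+ 2 = n * (t ^+ 2 - 4%:Z * N)
    & x * (t%:~R - x) = N%:~R].
Proof.
move=> w2 nsq xw ix.
have w21 : w ^+ 2 \in (1%AS : {subfield Om}) by rewrite w2 rpred_int.
have [u [v [u1 v1 ex]]] := quad_adjoin w21 xw.
have [g _ gw] := gal_flip (galois_full 1) (memvf w) w21 (sqrt_int_notin1 w2 nsq).
have gx : g x = u - v * w.
  rewrite ex (rmorphD g u) (rmorphM g v) /= gw mulrN.
  by congr (_ + - (_ * _)); exact: rational_fixed.
have igx : algint (g x) by apply: algint_rmorph.
have iw : algint w by apply: (algint_sqr _ w2); exact: algint_int.
have [t et] : exists t : int, x + g x = t%:~R.
  by apply: rational_algint; [rewrite gx ex addrACA subrr addr0 rpredD | exact: algintD].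
have [N eN] : exists N : int, x * g x = N%:~R.
  apply: rational_algint; last exact: algintM.
  have -> : x * g x = u ^+ 2 - v ^+ 2 * w ^+ 2 by rewrite gx ex; ring.
  by apply: rpredB; [exact: rpredX | apply: rpredM => //; exact: rpredX].
have [c ec] : exists c : int, (g x - x) * w = c%:~R.
  apply: rational_algint; last by apply: algintM => //; apply: algintB.
  have -> : (g x - x) * w = - 2%:R * v * w ^+ 2 by rewrite gx ex; ring.
  by apply: rpredM => //; apply: rpredM => //; rewrite rpredN rpred_nat.
exists t, c, N; split.
- by rewrite intrM -w2 -et -ec; ring.
- apply/eqP; rewrite -subr_eq0 -(Om_int_eq0 Om) intrB subr_eq0; apply/eqP.
  rewrite intrM intrB intrM rmorphXn rmorphXn /= -w2 -et -ec -eN -[4%:Z%:~R]/(4%:R).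
  by ring.
- by rewrite -et addrAC subrr add0r.
Qed.

End Rational.

(** * Gaussian integers in a number field *)

Section Embedding.
Variables (Om : splittingFieldType rat) (ii : Om).
Hypothesis ii2 : ii ^+ 2 = -1.
Definition gphi (x : gint) : Om := (re x)%:~R + (im x)%:~R * ii.
Lemma gphiD x y : gphi (x + y) = gphi x + gphi y.
Proof. by rewrite /gphi reD imD !intrD; ring. Qed.
Lemma gphiN x : gphi (- x) = - gphi x.
Proof. by rewrite /gphi reN imN !intrN; ring. Qed.
Lemma gphiB x y : gphi (x - y) = gphi x - gphi y.
Proof. by rewrite gphiD gphiN. Qed.

Lemma gphiM x y : gphi (x * y) = gphi x * gphi y.
Proof.
rewrite /gphi reM imM intrB intrD !intrM.
transitivity ((re x)%:~R * (re y)%:~R + (im x)%:~R * (im y)%:~R * ii ^+ 2 + ((re x)%:~R * (im y)%:~R + (im x)%:~R * (re y)%:~R) * ii); last by ring.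
by rewrite ii2; ring.
Qed.

Lemma gphi_int n : gphi n%:~R = n%:~R.
Proof. by rewrite /gphi re_int im_int mul0r addr0. Qed.
Lemma gphi_nat n : gphi n%:R = n%:R.
Proof. exact: (gphi_int n). Qed.
Lemma gphi1 : gphi 1 = 1. Proof. exact: (gphi_int 1). Qed.
Lemma gphi0 : gphi 0 = 0. Proof. exact: (gphi_int 0). Qed.
Lemma gphiX x n : gphi (x ^+ n) = gphi x ^+ n.
Proof. by elim: n => [|n IH]; rewrite ?expr0 ?gphi1 // !exprS gphiM IH. Qed.
Lemma gphi_gi : gphi gi = ii.
Proof. by rewrite /gphi /= add0r mul1r. Qed.
Definition gphiE := (gphiD, gphiN, gphiX, gphiM, gphi_nat, gphi1, gphi0, gphi_gi).
Lemma gphi_norm x : gphi x * gphi (conj x) = (norm x)%:~R.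
Proof. by rewrite -gphiM mul_conj gphi_int. Qed.

Lemma gphi_eq0 x : (gphi x == 0) = (x == 0).
Proof.
apply/eqP/eqP => [h|->]; last exact: gphi0.
apply/eqP; rewrite -norm_eq0 -(Om_int_eq0 Om) -gphi_norm h mul0r //.
Qed.

Lemma gphi_inj : injective gphi.
Proof. by move=> x y e; apply/eqP; rewrite -subr_eq0 -gphi_eq0 gphiB e subrr. Qed.
Lemma gphi_conj (f : {rmorphism Om -> Om}) x : f ii = - ii -> f (gphi x) = gphi (conj x).
Proof. by move=> h; rewrite /gphi rmorphD rmorphM /= h !rmorph_int intrN; ring. Qed.
Lemma gphi_fix (f : {rmorphism Om -> Om}) x : f ii = ii -> f (gphi x) = gphi x.
Proof. by move=> h; rewrite /gphi rmorphD rmorphM /= h !rmorph_int. Qed.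

Lemma gphi_fix_lin (f : {rmorphism Om -> Om}) a b c x : f ii = ii ->
  f (gphi a * (gphi b + gphi c * x)) = gphi a * (gphi b + gphi c * f x).
Proof. by move=> h; rewrite (rmorphM f (gphi a)) (rmorphD f (gphi b)) (rmorphM f (gphi c)) !gphi_fix. Qed.

Lemma gphi_conj_lin (f : {rmorphism Om -> Om}) a b c x : f ii = - ii ->
  f (gphi a * (gphi b + gphi c * x)) = gphi (conj a) * (gphi (conj b) + gphi (conj c) * f x).
Proof. by move=> h; rewrite (rmorphM f (gphi a)) (rmorphD f (gphi b)) (rmorphM f (gphi c)) !gphi_conj. Qed.

Lemma algint_ii : algint ii.
Proof.
apply: (@algint_quadratic _ ii 0 (-1)); [exact: algint0 | exact: (algint_int _ (-1)) |].
by rewrite ii2 mul0r add0r.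
Qed.

Lemma algint_gphi x : algint (gphi x).
Proof. by apply: algintD; [|apply: algintM algint_ii]; exact: algint_int. Qed.
Lemma gphi_mem (F : {subfield Om}) x : ii \in F -> gphi x \in F.
Proof. by move=> h; rewrite rpredD ?rpredM ?rpred_int. Qed.

Lemma gaussint_gphi x : gaussint ii x <-> exists y, x = gphi y.
Proof.
by split=> [[c [d ->]]|[[c d] ->]]; [exists (Gint c d) | exists c, d].
Qed.

End Embedding.

(** An element whose norm is an odd prime is coprime to its conjugate, and their
    sum is twice the real part. *)
Lemma sum_two_squares_coprime (l : nat) x : prime l -> odd l -> norm x = l%:Z ->
  coprimez (2%:Z * re x) l%:Z.
Proof.
move=> pl ol; rewrite /norm => h.
rewrite coprimezE abszM coprimeMl -[`|l%:Z|%N]/l [coprime _ l]coprime_sym prime_coprime // dvdn_prime2 //.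
rewrite (_ : (l == 2)%N = false) /=; last by apply: contraTF ol => /eqP ->.
rewrite coprime_sym prime_coprime //; apply/negP=> lx.
have /dvdzP[a ea] : (l %| re x)%Z by rewrite dvdzE.
have : (l %| im x ^+ 2)%Z.
  have -> : im x ^+ 2 = (1 - a ^+ 2 * l%:Z) * l%:Z.
    by rewrite mulrBl mul1r -{1}h ea; ring.
  exact: dvdz_mull.
rewrite dvdzE abszX Euclid_dvdX // andbT => ly.
have /dvdzP[b eb] : (l %| im x)%Z by rewrite dvdzE.
have l0 : l%:Z != 0 by have := prime_gt0 pl; clear; lia.
have : l%:Z * (l%:Z * (a ^+ 2 + b ^+ 2)) = l%:Z * 1 by rewrite mulr1 -[RHS]h ea eb; ring.
move/(mulfI l0)/(congr1 absz); rewrite abszM => /eqP; rewrite muln_eq1 => /andP[/eqP].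
by have := prime_gt1 pl; clear; lia.
Qed.

Section MuCoprime.
Variables (Om : splittingFieldType rat) (ii r : Om) (K : {subfield Om}) (P : Om -> Prop).
Variables (p : nat) (pi1 A B C : gint).
Hypotheses (ii2 : ii ^+ 2 = -1) (iiK : ii \in K) (Pp : is_prime_ideal K P).
Local Notation phi := (gphi ii).
Local Notation O := (ring_of_integers K).
Let iP : is_ideal K P := prime_is_ideal Pp.
Lemma O_gphi x : O (phi x).
Proof. by split; [exact: gphi_mem | exact: algint_gphi]. Qed.

Lemma gprime_in t x : gprime t -> P (phi t) -> P (phi x) -> gdvd t x.
Proof.
move=> tp Pt Px; have [g [u [v [eg [t1 et] gx]]]] := gint_bezout t x.
have [t0 _ tP] := tp.
have tgt : gdvd t (g * t1) by rewrite -et; exact: gdvdr.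
have [tg|[w ew]] := tP g t1 tgt.
  exact: gdvd_trans gx.
have gw : g * w = 1 by apply: (mulfI t0); rewrite mulr1 {2}et ew; ring.
case: (prime_n1 Pp); rewrite -(gphi1 ii) -gw gphiM //.
apply: (idealMr iP); first exact: O_gphi.
by rewrite eg gphiD !gphiM //; apply: (idealD iP); apply: (idealMl iP) => //; exact: O_gphi.
Qed.

Hypotheses (pp : prime p) (op : odd p) (npi : norm (1 + 4%:R * pi1) = p%:Z).
Hypotheses (cABC : conic pi1 A B C) (co : coprime3 A B C) (r2 : r ^+ 2 = phi (1 + 4%:R * pi1)) (Or : O r).

Lemma pi_pi'_coprime : P (phi (1 + 4%:R * pi1)) -> P (phi (conj (1 + 4%:R * pi1))) -> False.
Proof.
move=> h1 h2; apply: (prime_int_coprime Pp (sum_two_squares_coprime pp op npi)).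
  by rewrite -(gphi_int ii) -add_conj gphiD; exact: (idealD iP).
by rewrite -npi -(gphi_norm ii2); apply: (idealMl iP) => //; exact: O_gphi.
Qed.

(** A prime ideal that contains mu and its conjugate over Q(i) contains A and B
    r, and thus pi' C^2.  It either contains all of A, B, C, or contains pi or
    pi' and leads to a common divisor of the three. *)
Lemma mu_coprime : ~ P 2%:R -> P (phi A + phi B * r) -> P (phi A - phi B * r) -> False.
Proof.
move=> P2 h1 h2; have O2 := O_nat K 2.
have PA : P (phi A).
  have : P (2%:R * phi A) by have -> : 2%:R * phi A = (phi A + phi B * r) + (phi A - phi B * r) by [ring]; exact: (idealD iP).
  by case/(prime_mulP Pp O2 (O_gphi A)).
have PBr : P (phi B * r) by apply: (ideal_sub iP (y := - phi A)); [rewrite opprK addrC | exact: (idealN iP)].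
have Psq x : P (phi (x ^+ 2)) -> P (phi x).
  by rewrite gphiX // => h; exact: (prime_expP Pp (O_gphi x) h).
have eC : phi (conj (1 + 4%:R * pi1) * C ^+ 2) = phi A * phi A - phi B * r * (phi B * r).
  by rewrite -cABC gphiB (gphiM ii2 (1 + 4%:R * pi1)) -r2 !gphiX //; ring.
have no t : gprime t -> gdvd t A -> gdvd t B -> gdvd t C -> False.
  by move=> [_ t1 _] tA tB tC; case/eqP: t1; apply: co.
have gp := gprime_pi pp npi; have gp' := gprime_pi' pp npi.
have [pi0 _ piP] := gp; have [pi'0 _ pi'P] := gp'.
have [PB|nPB] := classic (P (phi B)).
  have : P (phi (conj (1 + 4%:R * pi1) * C ^+ 2)).
    by rewrite eC; apply: (idealB iP); apply: (idealMr iP) => //; [exact: O_gphi | apply: OM => //; exact: O_gphi].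
  rewrite gphiM // => /(prime_mulP Pp (O_gphi _) (O_gphi _)) [Ppi'|/Psq PC].
    have [a ea] := gprime_in gp' Ppi' PA; have [b eb] := gprime_in gp' Ppi' PB.
    apply: (no _ gp'); [by exists a | by exists b |].
    have : gdvd (conj (1 + 4%:R * pi1)) (C ^+ 2).
      exists (a ^+ 2 - (1 + 4%:R * pi1) * b ^+ 2); apply: (mulfI pi'0); rewrite -cABC ea eb; ring.
    by rewrite expr2 => /pi'P[].
  have [u [v [w e]]] := bezout3 co; apply: (prime_n1 Pp); rewrite -(gphi1 ii) -e !gphiE //.
  by apply: (idealD iP); [apply: (idealD iP)|]; apply: (idealMl iP) => //; exact: O_gphi.
have Ppi : P (phi (1 + 4%:R * pi1)).
  case: (prime_mulP Pp (O_gphi B) Or PBr) => // Pr.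
  by rewrite -r2 expr2; exact: (idealMl iP).
have [a ea] := gprime_in gp Ppi PA.
have dC : gdvd (1 + 4%:R * pi1) C.
  have : gdvd (1 + 4%:R * pi1) (conj (1 + 4%:R * pi1) * C ^+ 2).
    by rewrite -cABC; apply: gdvdB; [rewrite ea; apply/gdvdMr/gdvdMr/gdvdr | apply/gdvdMr/gdvdr].
  case/piP => [[x ex]|]; last by rewrite expr2 => /piP[].
  case: pi_pi'_coprime => //; rewrite ex gphiM //; apply: (idealMr iP) => //; exact: O_gphi.
have [c ec] := dC; apply: (no _ gp) => //; first by exists a.
have : gdvd (1 + 4%:R * pi1) (B ^+ 2).
  exists (a ^+ 2 - conj (1 + 4%:R * pi1) * c ^+ 2); apply: (mulfI pi0).
  have /eqP := cABC; rewrite subr_eq addrC -subr_eq => /eqP <-.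
  by rewrite {1}ea {1}ec; ring.
by rewrite expr2 => /piP[].
Qed.

End MuCoprime.
Section Half.
Variables (Om : splittingFieldType rat) (E : {subfield Om}) (P : Om -> Prop) (z y : Om).
Hypotheses (zE : z \in E) (z2 : z ^+ 2 = 1 + 4%:R * y) (iy : algint y).

Lemma half_integer : ring_of_integers E ((1 + z) / 2%:R).
Proof.
have n2 : 2%:R != 0 :> Om by rewrite Om_nat_eq0.
split; first by rewrite rpred_div ?rpredD ?rpred1 ?rpred_nat.
apply: (@algint_quadratic _ _ 1 y) => //; first exact: (algint_int _ 1).
apply: (mulIf (_ : 2%:R ^+ 2 != 0 :> Om)); first by rewrite sqrf_eq0.
by rewrite -exprMn divfK // sqrrD z2 expr1n; field.
Qed.

(** Sending z to - z changes the integer (1 + z) / 2 by - z. *)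
Lemma half_moved (g : {rmorphism Om -> Om}) :
  (forall x, ring_of_integers E x -> P (g x - x)) -> g z = - z -> P (- z).
Proof.
move=> /(_ _ half_integer); rewrite fmorph_div rmorphD rmorph1 rmorph_nat /= => h gz; move: h.
have n2 : 2%:R != 0 :> Om by rewrite Om_nat_eq0.
by rewrite gz (_ : (1 - z) / 2%:R - (1 + z) / 2%:R = - z) //; field.
Qed.

End Half.

(** * The field generated by the conjugates of mu *)

Section Tower.
Variables (Om : splittingFieldType rat) (ii sk sp r m : Om).
Variables (p q : nat) (pi1 kap A B C : gint) (twist : bool) (e : nat) (n : int).
Hypotheses (pp : prime p) (qp : prime q) (p8 : (p = 1 %[mod 8])%N) (q8 : (q = 5 %[mod 8])%N).
Local Notation pi := (1 + 4%:R * pi1).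
Local Notation phi := (gphi ii).
Hypotheses (npi : norm pi = p%:Z) (ii2 : ii ^+ 2 = -1) (sk2 : sk ^+ 2 = - (p * q)%:R)
  (sp2 : sp ^+ 2 = p%:R) (r2 : r ^+ 2 = phi pi).
Hypotheses (cABC : conic pi1 A B C) (co : coprime3 A B C).
Hypotheses (nkap : norm kap = (if twist then q else 1%N)%:Z).
Hypotheses (m2 : m ^+ 2 = phi kap * (phi A + phi B * r)).
Hypotheses (R0 : Rval pi1 A B C != 0) (eR : Rval pi1 A B C = p%:Z ^+ e * n ^+ 2).
Local Notation k := (<<1; sk>>%AS : {subfield Om}).
Local Notation E := (<<k & [:: sp; r; m]>>%AS : {subfield Om}).
Variables (sR r' th mt : Om).
Hypotheses (sRd : sR = sp ^+ e * n%:~R) (r'd : r' = sp / r)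
  (thd : th = if twist then sk / (ii * sp) else 1) (mtd : mt = phi kap * phi C * r' / m).

(** The element 2 X = R + r (A' B + A C') + s (A B' + A' C) + r s (B B' - C C'),
    with (2 X)^2 = 4 mu mu' R for s = r'; automorphisms may also lead to
    s = - r'. *)
Definition dbl_root (s : Om) : Om := (Rval pi1 A B C)%:~R + r * phi (conj A * B + A * conj C)
  + s * phi (A * conj B + conj A * C) + r * s * phi (B * conj B - C * conj C).

(** A square root of kappa' (A' + B' s), the complex conjugate of m^2. *)
Definition conj_root (s : Om) : Om := dbl_root s * th / (2%:R * m * sR).

Lemma two_neq0 : 2%:R != 0 :> Om. Proof. by rewrite Om_nat_eq0. Qed.
Lemma sp_neq0 : sp != 0.
Proof. by rewrite -sqrf_eq0 sp2 Om_nat_eq0 -lt0n prime_gt0. Qed.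
Lemma ii_neq0 : ii != 0.
Proof. by rewrite -sqrf_eq0 ii2 oppr_eq0 oner_neq0. Qed.
Lemma pi_neq0 : pi != 0.
Proof. by rewrite -norm_eq0 npi; have := prime_gt0 pp; lia. Qed.
Lemma r_neq0 : r != 0.
Proof. by rewrite -sqrf_eq0 r2 gphi_eq0 // pi_neq0. Qed.
Lemma rr' : r * r' = sp.
Proof. by rewrite r'd mulrC divfK // r_neq0. Qed.

Lemma r'2 : r' ^+ 2 = phi (conj pi).
Proof.
apply: (mulfI (_ : phi pi != 0)); first by rewrite gphi_eq0 // pi_neq0.
by rewrite gphi_norm // npi -r2 -exprMn rr' sp2.
Qed.

Lemma C_neq0 : C != 0.
Proof.
apply/eqP=> C0; move: cABC; rewrite /conic C0 expr0n mulr0 => /eqP; rewrite subr_eq0 => /eqP h.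
have := congr1 norm h; rewrite normM npi !expr2 !normM -!expr2 => h2.
have /eqP := prime_sqr_mul pp h2; rewrite norm_eq0 => /eqP B0.
apply: (nz3 co); split=> //; apply/eqP; rewrite -sqrf_eq0 h B0 expr0n mulr0 //.
Qed.

Lemma kap_neq0 : kap != 0.
Proof. by rewrite -norm_eq0 nkap; case: twist => //; have := prime_gt0 qp; clear; lia. Qed.

Lemma mu_mul : (phi A + phi B * r) * (phi A - phi B * r) = phi (conj pi) * phi C ^+ 2.
Proof.
transitivity (phi A ^+ 2 - r ^+ 2 * phi B ^+ 2); first by ring.
by rewrite r2 -!gphiX // -!gphiM // -gphiB cABC.
Qed.

Lemma m_neq0 : m != 0.
Proof.
rewrite -sqrf_eq0 m2 mulf_neq0 ?gphi_eq0 ?kap_neq0 //.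
have : phi (conj pi) * phi C ^+ 2 != 0.
  by rewrite mulf_neq0 ?sqrf_eq0 ?gphi_eq0 ?C_neq0 // -norm_eq0 norm_conj norm_eq0 pi_neq0.
by rewrite -mu_mul mulf_eq0 negb_or => /andP[].
Qed.

Lemma mt2 : mt ^+ 2 = phi kap * (phi A - phi B * r).
Proof.
have k0 : phi kap != 0 by rewrite gphi_eq0 // kap_neq0.
have m0 : m ^+ 2 != 0 by rewrite sqrf_eq0 m_neq0.
rewrite mtd expr_div_n; apply: (mulIf m0); rewrite divfK // !exprMn r'2 m2.
transitivity (phi kap ^+ 2 * (phi (conj pi) * phi C ^+ 2)); first by ring.
by rewrite -mu_mul; ring.
Qed.

Lemma sR2 : sR ^+ 2 = (Rval pi1 A B C)%:~R.
Proof. by rewrite sRd eR exprMn -exprM mulnC exprM sp2 intrM !rmorphXn. Qed.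
Lemma sR_neq0 : sR != 0.
Proof. by rewrite -sqrf_eq0 sR2 Om_int_eq0. Qed.

Lemma th2 : th ^+ 2 = phi kap * phi (conj kap).
Proof.
rewrite gphi_norm // nkap thd; case: twist; last by rewrite expr1n.
rewrite expr_div_n exprMn ii2 sk2 sp2 natrM mulN1r invrN mulrNN mulrAC divff ?mul1r //.
by rewrite Om_nat_eq0 -lt0n prime_gt0.
Qed.

(** The difference of the two sides is a combination of the equation of the
    conic and of its conjugate. *)
Lemma dbl_root_sqr s : s ^+ 2 = phi (conj pi) ->
  dbl_root s ^+ 2 = 4%:R * (phi A + phi B * r) * (phi (conj A) + phi (conj B) * s) * (Rval pi1 A B C)%:~R.
Proof.
move=> s2; have c1 : phi A ^+ 2 = r ^+ 2 * phi B ^+ 2 + s ^+ 2 * phi C ^+ 2.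
  by move/eqP: cABC; rewrite subr_eq addrC => /eqP /(congr1 phi); rewrite !gphiE // r2 s2 !gphiE.
have c2 : phi (conj A) ^+ 2 = s ^+ 2 * phi (conj B) ^+ 2 + r ^+ 2 * phi (conj C) ^+ 2.
  have /eqP := conic_conj cABC; rewrite subr_eq addrC => /eqP /(congr1 phi).
  by rewrite !gphiE // r2 s2 !gphiE.
have eR' : (Rval pi1 A B C)%:~R = phi A * phi (conj A) + s ^+ 2 * phi (conj B) * phi C + r ^+ 2 * phi B * phi (conj C).
  by rewrite -(gphi_int ii) RvalE !gphiE // r2 s2 !gphiE.
rewrite /dbl_root eR' !gphiE //; clear eR'.
move: (phi A) (phi (conj A)) (phi B) (phi (conj B)) (phi C) (phi (conj C)) c1 c2 => a a' b b' c c' c1 c2.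
apply/eqP; rewrite -subr_eq0; apply/eqP.
(* A combination of c1 and c2 with explicit cofactors. *)
transitivity ((a ^+ 2 - (r ^+ 2 * b ^+ 2 + s ^+ 2 * c ^+ 2)) * ((a' + r * c' + s * b') ^+ 2 - 4%:R * a' * (a' + s * b'))
 + (a' ^+ 2 - (s ^+ 2 * b' ^+ 2 + r ^+ 2 * c' ^+ 2)) * (- 3%:R * (r ^+ 2 * b ^+ 2 + s ^+ 2 * c ^+ 2) + a * (2%:R * s * c - 2%:R * r * b) + (r * b + s * c) ^+ 2)); first by ring.
by rewrite c1 c2 !subrr !mul0r addr0.
Qed.

Lemma conj_root_sqr s : s ^+ 2 = phi (conj pi) ->
  conj_root s ^+ 2 = phi (conj kap) * (phi (conj A) + phi (conj B) * s).
Proof.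
move=> s2; have d0 : 2%:R * m * sR != 0 by rewrite !mulf_neq0 ?two_neq0 ?m_neq0 ?sR_neq0.
rewrite /conj_root expr_div_n; apply: (mulIf (_ : (2%:R * m * sR) ^+ 2 != 0)); first by rewrite sqrf_eq0.
rewrite divfK ?sqrf_eq0 // !exprMn th2 dbl_root_sqr // sR2 m2; ring.
Qed.

Lemma skE : sk \in E.
Proof. by apply: (subvP (subv_adjoin_seq _ _)); exact: memv_adjoin. Qed.
Lemma gensE x : x \in [:: sp; r; m] -> x \in E.
Proof. exact: seqv_sub_adjoin. Qed.
Lemma spE : sp \in E. Proof. by apply: gensE; rewrite inE eqxx. Qed.
Lemma rE : r \in E. Proof. by apply: gensE; rewrite !inE eqxx orbT. Qed.
Lemma mE : m \in E. Proof. by apply: gensE; rewrite !inE eqxx !orbT. Qed.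
Lemma r'E : r' \in E. Proof. by rewrite r'd; apply: rpred_div; [exact: spE | exact: rE]. Qed.

(** Since pi is not real, i is a rational combination of 1 and r^2. *)
Lemma iiE : ii \in E.
Proof.
have b0 : im pi != 0.
  apply/eqP=> b0; move: npi; rewrite /norm b0 expr0n addr0 => h.
  by have := @prime_sqr_mul p (re pi) 1 pp; rewrite h expr1n mulr1 => /(_ erefl).
have -> : ii = (r ^+ 2 - (re pi)%:~R) / (im pi)%:~R.
  by rewrite r2 /gphi addrAC subrr add0r mulrAC divff ?mul1r // Om_int_eq0.
apply: rpred_div; last exact: rpred_int.
by apply: rpredB; [apply: rpredX; exact: rE | exact: rpred_int].
Qed.

Lemma sRE : sR \in E.
Proof. by rewrite sRd; apply: rpredM; [apply: rpredX; exact: spE | exact: rpred_int]. Qed.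

Lemma thE : th \in E.
Proof.
rewrite thd; case: twist; last exact: rpred1.
by apply: rpred_div; [exact: skE | apply: rpredM; [exact: iiE | exact: spE]].
Qed.

Lemma mtE : mt \in E.
Proof.
rewrite mtd; apply: rpred_div; last exact: mE; apply: rpredM; last exact: r'E.
by apply: rpredM; apply: gphi_mem; exact: iiE.
Qed.

Lemma conj_rootE s : s \in E -> conj_root s \in E.
Proof.
move=> sE; have phiE x : phi x \in E by apply: gphi_mem; exact: iiE.
apply: rpred_div; last by apply: rpredM; [apply: rpredM; [exact: rpred_nat | exact: mE] | exact: sRE].
apply: rpredM; last exact: thE.
by rewrite /dbl_root; repeat first [exact: phiE | exact: sE | exact: rE | exact: rpred_int | apply: rpredD | apply: rpredM].
Qed.

Section Action.
Variable f : {rmorphism Om -> Om}.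
Lemma f_ii : f ii = ii \/ f ii = - ii.
Proof. by apply: sqr_eq; rewrite -rmorphXn ii2 rmorphN rmorph1. Qed.
Lemma f_sp : f sp = sp \/ f sp = - sp.
Proof. by apply: sqr_eq; rewrite -rmorphXn sp2 rmorph_nat. Qed.
Lemma f_r : f ii = ii -> f r = r \/ f r = - r.
Proof. by move=> h; apply: sqr_eq; rewrite -rmorphXn r2 /= gphi_fix. Qed.
Lemma f_r_conj : f ii = - ii -> f r = r' \/ f r = - r'.
Proof. by move=> h; apply: sqr_eq; rewrite -rmorphXn r2 r'2 /= gphi_conj. Qed.
Lemma f_m : f ii = ii -> f r = r -> f m = m \/ f m = - m.
Proof. by move=> hi hr; apply: sqr_eq; rewrite -rmorphXn m2 /= gphi_fix_lin // hr. Qed.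

Lemma f_mt : f ii = ii -> f r = - r -> f m = mt \/ f m = - mt.
Proof.
by move=> hi hr; apply: sqr_eq; rewrite -rmorphXn m2 mt2 /= gphi_fix_lin // hr mulrN.
Qed.

Lemma f_m_conj s : f ii = - ii -> f r = s -> f m = conj_root s \/ f m = - conj_root s.
Proof.
move=> hi hr; have s2 : s ^+ 2 = phi (conj pi) by rewrite -hr -rmorphXn r2 /= gphi_conj.
by apply: sqr_eq; rewrite -rmorphXn m2 conj_root_sqr //= gphi_conj_lin // hr.
Qed.

(** Each generator is a square root, so its images are determined up to sign by
    the action on i and r. *)
Lemma f_gens x : x \in [:: sp; r; m] -> f x \in E.
Proof.
have NE y : f x = y \/ f x = - y -> y \in E -> f x \in E by case=> -> //; rewrite rpredN.
rewrite !inE => /or3P[] /eqP ex; rewrite ex in NE *.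
- by apply: NE f_sp spE.
- by case: f_ii => h; [apply: NE (f_r h) rE | apply: NE (f_r_conj h) r'E].
- case: f_ii => h.
    case: (f_r h) => hr; first exact: NE (f_m h hr) mE.
    exact: NE (f_mt h hr) mtE.
  apply: NE (f_m_conj h erefl) _; apply: conj_rootE.
  by case: (f_r_conj h) => ->; rewrite ?rpredN r'E.
Qed.

End Action.
Lemma k_sub_E : (k <= E)%VS. Proof. exact: subv_adjoin_seq. Qed.

Lemma galois_kE : galois k E.
Proof.
apply: galois_criterion => [|f fk x xE]; first exact: k_sub_E.
have sub : (f @: E <= E)%VS.
  rewrite aimg_adjoin_seq; have fkk : (f @: k)%VS = k.
    by apply: fixedSpace_limg; apply/fixedSpacesP.
  rewrite fkk; apply/Fadjoin_seqP; split; first exact: k_sub_E.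
  by move=> _ /mapP[y yS ->]; exact: f_gens.
by apply: (subvP sub); apply: memv_img.
Qed.

Lemma sqr_mod8 (x y : int) : (y %% 8)%Z = 5%:Z -> x ^+ 2 <> y.
Proof using.
move=> y5 h; move: y5; rewrite -h expr2; clear.
have [u [->|->]] := int_parity x; last by have [v [->|->]] := int_parity u; lia.
by have [v [->|->]] := int_parity u; lia.
Qed.

Lemma notin_k z (c : int) : z ^+ 2 = c%:~R -> (forall x : int, x ^+ 2 <> c) ->
  (forall x : int, x ^+ 2 <> - (p%:Z * q%:Z) * c) -> z \notin k.
Proof.
move=> z2 h1 h2; apply/negP => zk.
have sk1 : sk ^+ 2 \in (1%AS : {subfield Om}) by rewrite sk2 rpredN rpred_nat.
have z21 : z ^+ 2 \in (1%AS : {subfield Om}) by rewrite z2 rpred_int.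
case: (quad_descent sk1 z21 zk) => h.
  by rewrite (negPf (sqrt_int_notin1 z2 h1)) in h.
have e2 : (z * sk) ^+ 2 = (- (p%:Z * q%:Z) * c)%:~R; last first.
  by rewrite (negPf (sqrt_int_notin1 e2 h2)) in h.
by rewrite exprMn z2 sk2 natrM intrM intrN intrM; ring.
Qed.

Lemma pmod : exists j : int, p%:Z = 8%:Z * j + 1.
Proof using p8. by exists (p %/ 8)%N; move: p8; clear; lia. Qed.
Lemma qmod : exists j : int, q%:Z = 8%:Z * j + 5%:Z.
Proof using q8. by exists (q %/ 8)%N; move: q8; clear; lia. Qed.

Lemma ii_notin_k : ii \notin k.
Proof.
have [j ej] := pmod; have [l el] := qmod.
apply: (@notin_k ii (-1)); first by rewrite ii2.
  by move=> x h; have := sqr_ge0 x; rewrite h.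
by move=> x; apply: sqr_mod8; rewrite ej el mulrN1 opprK; clear; lia.
Qed.

Lemma sp_notin_k : sp \notin k.
Proof.
apply: (@notin_k sp p%:Z); first by rewrite sp2.
  by move=> x h; have := @prime_sqr_mul p x 1 pp; rewrite h expr1n mulr1 => /(_ erefl).
move=> x h; have := sqr_ge0 x; rewrite h mulNr oppr_ge0 leNgt !pmulr_rgt0 ?ltz_nat ?prime_gt0 //.
Qed.

Lemma iisp_notin_k : ii * sp \notin k.
Proof.
have [j ej] := pmod; have [l el] := qmod.
apply: (@notin_k (ii * sp) (- p%:Z)); first by rewrite exprMn ii2 sp2 mulN1r intrN.
  by move=> x h; have := sqr_ge0 x; rewrite h oppr_ge0 leNgt ltz_nat prime_gt0.
by move=> x; apply: sqr_mod8; rewrite ej el mulrNN; clear; lia.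
Qed.

Lemma ii_notin : ii \notin <<k; ii * sp>>%VS.
Proof.
apply/negP=> h; case: (@quad_descent Om k (ii * sp) ii _ _ h).
- by rewrite exprMn ii2 sp2 rpredM // ?rpredN ?rpred1 ?rpred_nat.
- by rewrite ii2 rpredN rpred1.
- exact/negP/ii_notin_k.
- by rewrite mulrA -expr2 ii2 mulN1r rpredN; exact/negP/sp_notin_k.
Qed.

Lemma sp_notin : sp \notin <<k; ii>>%VS.
Proof.
apply/negP=> h; case: (@quad_descent Om k ii sp _ _ h).
- by rewrite ii2 rpredN rpred1.
- by rewrite sp2 rpred_nat.
- exact/negP/sp_notin_k.
- by rewrite mulrC; exact/negP/iisp_notin_k.
Qed.

(** * The Galois group *)

Local Notation G := 'Gal(E / k)%g.
Implicit Types g h : gal_of E.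
Lemma gal_sk g : g \in G -> g sk = sk.
Proof. by move=> gG; apply: (fixed_gal k_sub_E gG); exact: memv_adjoin. Qed.

Lemma gal_gens_id g : g \in G -> g sp = sp -> g r = r -> g m = m -> g = 1%g.
Proof.
move=> gG e1 e2 e3; apply/eqP/gal_eqP => x xE; rewrite gal_id.
have sub : (E <= fixedSpace g)%VS.
  apply/(@Fadjoin_seqP _ _ k _ (fixedSpace_aspace g)); split.
    by apply/fixedSpacesP => y; apply: fixed_gal k_sub_E gG.
  by move=> y; rewrite !inE => /or3P[] /eqP -> /=; apply/fixedSpaceP.
by apply/fixedSpaceP; apply: (subvP sub).
Qed.

Lemma gal_eq g h : g \in G -> h \in G -> g sp = h sp -> g r = h r -> g m = h m -> g = h.
Proof.
move=> gG hG e1 e2 e3; apply: (mulIg h^-1%g); rewrite mulgV.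
have key x : x \in E -> g x = h x -> (g * h^-1)%g x = x.
  by move=> xE e0; rewrite galM // e0 -galM // mulgV gal_id.
by apply: gal_gens_id; rewrite ?groupM ?groupV // key ?spE ?rE ?mE.
Qed.

Section Sigma.
Variable s : gal_of E.
Hypotheses (sG : s \in G) (s_ii : s ii = - ii) (s_sp : s sp = - sp).
Let h := (s * s)%g.
Let hG : h \in G. Proof. exact: groupM. Qed.
Lemma s2_ii : h ii = ii. Proof. by rewrite galM ?iiE // s_ii rmorphN /= s_ii opprK. Qed.
Lemma s2_sp : h sp = sp. Proof. by rewrite galM ?spE // s_sp rmorphN /= s_sp opprK. Qed.

(** Whether s sends r to r' or to - r', the product r r' = sqrt p changes sign
    under s. *)
Lemma s2_r : h r = - r.
Proof.
have r'0 : r' != 0 by rewrite r'd mulf_neq0 ?invr_eq0 ?sp_neq0 ?r_neq0.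
have sr' : s r' = - sp / s r by rewrite r'd fmorph_div /= s_sp.
have er : sp / r' = r by rewrite -rr' mulfK.
rewrite galM ?rE //; case: (f_r_conj s_ii) => /= e1; rewrite e1 ?rmorphN /= sr' e1.
  by rewrite mulNr er.
by rewrite invrN mulrNN er.
Qed.

Lemma s2_r' : h r' = - r'.
Proof. by rewrite r'd fmorph_div /= s2_sp s2_r invrN mulrN. Qed.

(** Whether s^2 sends m to m~ or to - m~, the product m m~ = kappa C r' changes
    sign under s^2. *)
Lemma s4_m : (h * h)%g m = - m.
Proof.
have k0 : phi kap * phi C * r' != 0.
  by rewrite !mulf_neq0 ?gphi_eq0 ?kap_neq0 ?C_neq0 // r'd mulf_neq0 ?invr_eq0 ?sp_neq0 ?r_neq0.
have mm : mt * m = phi kap * phi C * r' by rewrite mtd divfK ?m_neq0.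
have mt0 : mt != 0 by apply: contraNneq k0 => mt0; rewrite -mm mt0 mul0r.
have hmt : h mt = - (phi kap * phi C * r') / h m.
  by rewrite mtd fmorph_div /= !rmorphM /= s2_r' !(gphi_fix _ s2_ii) // mulrN.
rewrite galM ?mE //; case: (f_mt s2_ii s2_r) => /= e1; rewrite e1 ?rmorphN /= hmt e1 -mm mulrC.
  by rewrite mulrN mulKf.
by rewrite invrN mulrNN mulKf.
Qed.

Lemma s4_sp : (h * h)%g sp = sp. Proof. by rewrite galM ?spE // !s2_sp. Qed.
Lemma s4_r : (h * h)%g r = r. Proof. by rewrite galM ?rE // s2_r rmorphN /= s2_r opprK. Qed.

Lemma order_s : #[s]%g = 8%N.
Proof.
have s4 : (s ^+ 4 = h * h)%g by rewrite /h !expgS expg0 mulg1 !mulgA.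
have s4n : (s ^+ 4 != 1)%g.
  apply/eqP=> s41; have := s4_m; rewrite -s4 s41 gal_id => /eqP.
  rewrite -subr_eq0 opprK -mulr2n -mulr_natl mulf_eq0 (negPf two_neq0) /=.
  by rewrite (negPf m_neq0).
have s_pow8 : (s ^+ 8 = 1)%g.
  rewrite (expgM s 4 2) s4 !expgS expg0 mulg1; apply: gal_gens_id; rewrite ?groupM //.
  - by rewrite galM ?spE // !s4_sp.
  - by rewrite galM ?rE // !s4_r.
  - by rewrite galM ?mE // s4_m rmorphN /= s4_m opprK.
have : (#[s]%g %| 2 ^ 3)%N by rewrite order_dvdn s_pow8.
case/(dvdn_pfactor _ _ (isT : prime 2)) => j j3 ej; move: s4n; rewrite -order_dvdn ej.
by move: j j3 {ej} => [|[|[|[|]]]].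
Qed.

(** Multiplying by s^2 one may assume that r is fixed, and then m is fixed up to
    sign, as by s^4. *)
Lemma cycle_fix_ii g : g \in G -> g ii = ii -> g sp = sp -> g \in <[s]>%g.
Proof.
move=> gG g_ii g_sp.
have hs : h \in <[s]>%g by rewrite groupM ?cycle_id.
wlog g_r : g gG g_ii g_sp / g r = r => [H|].
  case: (f_r g_ii) => /= e1; first exact: H.
  have : (g * h)%g \in <[s]>%g.
    apply: H; rewrite ?groupM // galM ?iiE ?spE ?rE //= ?g_ii ?g_sp ?e1 ?s2_ii ?s2_sp //.
    by rewrite rmorphN /= s2_r opprK.
  by rewrite groupMr.
case: (f_m g_ii g_r) => /= e1.
  by rewrite (_ : g = 1%g) ?group1 //; apply: gal_gens_id.
have -> : g = (h * h)%g by apply: gal_eq; rewrite ?groupM // ?s4_sp ?s4_r ?s4_m ?g_sp ?g_r.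
exact: groupM.
Qed.

(** Multiplying by s reduces to the case that i is fixed. *)
Lemma cycle_fix g : g \in G -> g (ii * sp) = ii * sp -> g \in <[s]>%g.
Proof.
move=> gG; rewrite rmorphM /=; case: (f_ii g) => /= e1; rewrite e1.
  by move/(mulfI ii_neq0); exact: cycle_fix_ii.
rewrite mulNr -mulrN => /(mulfI ii_neq0)/eqP; rewrite eqr_oppLR => /eqP e2.
have : (g * s)%g \in <[s]>%g.
  apply: cycle_fix_ii; rewrite ?groupM // galM ?iiE ?spE // ?e1 ?e2 rmorphN /= ?s_ii ?s_sp opprK //.
by rewrite groupMr ?cycle_id.
Qed.

End Sigma.
Local Notation k' := (<<k; ii * sp>>%AS : {subfield Om}).
Lemma k_sub_k' : (k <= k')%VS. Proof. exact: subv_adjoin. Qed.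
Lemma k'_sub_E : (k' <= E)%VS.
Proof. by apply/FadjoinP; split; [exact: k_sub_E | apply: rpredM; [exact: iiE | exact: spE]]. Qed.
Lemma galois_k'E : galois k' E.
Proof. by apply: galoisS galois_kE; rewrite k_sub_k' k'_sub_E. Qed.

(** The element i sqrt p of the base field is fixed, while i, which does not
    belong to k(i sqrt p), can be negated. *)
Lemma ex_sigma : exists s : gal_of E, [/\ s \in 'Gal(E / k')%g, s \in G, s ii = - ii & s sp = - sp].
Proof.
have ii2k : ii ^+ 2 \in k' by rewrite ii2 rpredN rpred1.
have [s sG' s_ii] := gal_flip galois_k'E iiE ii2k ii_notin.
have sG : s \in G by apply: (subsetP (galS _ k_sub_k')).
exists s; split=> //.
have : s (ii * sp) = ii * sp by apply: (fixed_gal k'_sub_E sG'); exact: memv_adjoin.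
by rewrite rmorphM /= s_ii mulNr -mulrN => /(mulfI ii_neq0)/eqP; rewrite eqr_oppLR => /eqP.
Qed.

Lemma gal_cycle s : s \in 'Gal(E / k')%g -> s \in G -> s ii = - ii -> s sp = - sp ->
  'Gal(E / k')%g = <[s]>%g.
Proof.
move=> sG' sG s_ii s_sp; apply/eqP; rewrite eqEsubset cycle_subG sG' andbT.
apply/subsetP => g gG'; have gG : g \in G by apply: (subsetP (galS _ k_sub_k')).
by apply: cycle_fix => //; apply: (fixed_gal k'_sub_E gG'); exact: memv_adjoin.
Qed.

Lemma cyclic_extension : G_extension k' E [set: 'Z_8].
Proof.
split; first exact: galois_k'E.
have [s [sG' sG s_ii s_sp]] := ex_sigma.
have cZ : cyclic [set: 'Z_8] by apply/cyclicP; exists Zp1; exact: Zp_cycle.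
rewrite (gal_cycle sG' sG s_ii s_sp) (isog_cyclic_card _ (cycle_cyclic s)) cZ /=.
by rewrite -orderE order_s // cardsT card_ord.
Qed.

(** Over k(i), sqrt p can be negated; composing with s^2 then adjusts the sign
    of r. *)
Lemma ex_tau s : s \in G -> s ii = - ii -> s sp = - sp ->
  exists t : gal_of E, [/\ t \in G, t ii = ii, t sp = - sp & t r = r].
Proof.
move=> sG s_ii s_sp; pose kii := (<<k; ii>>%AS : {subfield Om}).
have kki : (k <= kii)%VS by exact: subv_adjoin.
have kiE : (kii <= E)%VS by apply/FadjoinP; split; [exact: k_sub_E | exact: iiE].
have gki : galois kii E by apply: galoisS galois_kE; rewrite kki kiE.
have sp2k : sp ^+ 2 \in kii by rewrite sp2 rpred_nat.
have [t tG' t_sp] := gal_flip gki spE sp2k sp_notin.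
have tG : t \in G by apply: (subsetP (galS _ kki)).
have t_ii : t ii = ii by apply: (fixed_gal kiE tG'); exact: memv_adjoin.
case: (f_r t_ii) => /= e1; first by exists t.
have [h [hG h_i h_s h_rN]] : exists h : gal_of E, [/\ h \in G, h ii = ii, h sp = sp & h r = - r].
  by exists (s * s)%g; rewrite groupM // s2_ii // s2_sp // s2_r.
exists (t * h)%g; rewrite groupM // !galM ?iiE ?spE ?rE // t_ii t_sp e1.
by rewrite !rmorphN /= h_i h_s h_rN opprK.
Qed.

Section Relations.
Variables s t : gal_of E.
Hypotheses (sG : s \in G) (s_ii : s ii = - ii) (s_sp : s sp = - sp).
Hypotheses (tG : t \in G) (t_ii : t ii = ii) (t_sp : t sp = - sp) (t_r : t r = r).

Lemma t_involution : (t * t = 1)%g.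
Proof.
apply: gal_gens_id; rewrite ?groupM ?galM ?spE ?rE ?mE //= ?t_sp ?t_r //.
  by rewrite rmorphN /= t_sp opprK.
by case: (f_m t_ii t_r) => /= e1; rewrite e1 ?rmorphN /= e1 ?opprK.
Qed.

Let u := (s * t)%g.
Let uG : u \in G. Proof. exact: groupM. Qed.
Lemma u_ii : u ii = - ii. Proof. by rewrite galM ?iiE // s_ii rmorphN /= t_ii. Qed.
Lemma u_sp : u sp = sp. Proof. by rewrite galM ?spE // s_sp rmorphN /= t_sp opprK. Qed.

Lemma u_sqr_r : u (u r) = r.
Proof.
have ur' : u r' = sp / u r by rewrite r'd fmorph_div /= u_sp.
have er : sp / r' = r by rewrite -rr' mulfK // r'd mulf_neq0 ?invr_eq0 ?sp_neq0 ?r_neq0.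
case: (f_r_conj u_ii) => /= e1; rewrite e1 ?rmorphN /= ur' e1 ?invrN ?mulrN ?opprK er //.
Qed.

(** The element s t fixes sqrt p and exchanges r and its image, hence it fixes
    sqrt R and the root of 4 mu mu' R.  Therefore m times its image, being theta
    times an element fixed by s t, changes as theta does. *)
Lemma u_sqr_m : u (u m) = (if twist then -1 else 1) * m.
Proof.
have s2 : (u r) ^+ 2 = phi (conj pi) by rewrite -rmorphXn r2 /= (gphi_conj _ u_ii).
have uX2 : u (dbl_root (u r)) = dbl_root (u r).
  have := u_sqr_r; rewrite /dbl_root.
  have : u (phi (conj A * B + A * conj C)) = phi (A * conj B + conj A * C).
    by rewrite (gphi_conj _ u_ii) rmorphD !rmorphM /= !conjK.
  have : u (phi (A * conj B + conj A * C)) = phi (conj A * B + A * conj C).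
    by rewrite (gphi_conj _ u_ii) rmorphD !rmorphM /= !conjK.
  have : u (phi (B * conj B - C * conj C)) = phi (B * conj B - C * conj C).
    by rewrite (gphi_conj _ u_ii) rmorphB !rmorphM /= !conjK [conj B * B]mulrC [conj C * C]mulrC.
  move: (phi _) (phi _) (phi _) => a3 a1 a2 h3 h1 h2 hr.
  by rewrite 3!rmorphD 4!rmorphM /= rmorph_int h1 h2 h3 hr; ring.
have uth : u th = (if twist then -1 else 1) * th.
  rewrite thd; case: twist; last by rewrite rmorph1 mulr1.
  by rewrite fmorph_div rmorphM /= gal_sk // u_ii u_sp (mulNr ii) invrN mulrN mulN1r.
move: (if twist then -1 else 1 : Om) uth => d uth.
have usR : u sR = sR by rewrite sRd rmorphM rmorphXn /= rmorph_int u_sp.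
have m0 := m_neq0; have sR0 := sR_neq0; have n20 := two_neq0.
have um0 : u m != 0 by rewrite fmorph_eq0.
have d0 : 2%:R * m * sR != 0 by rewrite !mulf_neq0.
(* The sign c tells which of the two square roots of the conjugate of m^2 is u m. *)
have X2E : exists2 c : Om, c = 1 \/ c = -1 & u m * (2%:R * m * sR) = c * (dbl_root (u r) * th).
  case: (f_m_conj u_ii erefl) => /= e1; rewrite e1.
    by exists 1; [left | rewrite /conj_root divfK // mul1r].
  by exists (-1); [right | rewrite mulNr /conj_root divfK // mulN1r].
case: X2E => c hc eX; have uc : u c = c by case: hc => ->; rewrite ?rmorphN rmorph1.
have /= := congr1 u eX; rewrite !rmorphM /= rmorph_nat usR uX2 uth uc => eX'.
apply: (mulIf um0); apply: (mulIf (_ : 2%:R * sR != 0)); first by rewrite mulf_neq0.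
transitivity (u (u m) * (2%:R * u m * sR)); first by ring.
rewrite eX'; transitivity (d * (c * (dbl_root (u r) * th))); first by ring.
by rewrite -eX; ring.
Qed.

Lemma u_sqr : (u * u)%g = if twist then (s ^+ 4)%g else 1%g.
Proof.
have uu_sp : (u * u)%g sp = sp by rewrite galM ?spE // !u_sp.
have uu_r' : (u * u)%g r = r by rewrite galM ?rE // u_sqr_r.
have s4 : (s ^+ 4 = (s * s) * (s * s))%g by rewrite !expgS expg0 mulg1 !mulgA.
have := u_sqr_m; rewrite -galM ?mE //; case: twist => h.
  have sssG : ((s * s) * (s * s))%g \in G by rewrite !groupM.
  have uuG : (u * u)%g \in G by rewrite groupM.
  rewrite s4; apply: gal_eq => //; first by rewrite uu_sp s4_sp.
    by rewrite uu_r' s4_r.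
  by rewrite s4_m // h mulN1r.
by apply: gal_gens_id; rewrite ?groupM // h mul1r.
Qed.

(** Any automorphism fixes i sqrt p, possibly after composition with t. *)
Lemma gal_decomp g : g \in G -> g \in <[s]>%g \/ (g * t)%g \in <[s]>%g.
Proof.
move=> gG; have := f_sp g; have := f_ii g.
have fix_or g' : g' \in G -> g' (ii * sp) = ii * sp -> g' \in <[s]>%g by apply: cycle_fix.
case=> /= e1; case=> /= e2.
- by left; apply: fix_or; rewrite // rmorphM /= e1 e2.
- right; apply: fix_or; rewrite ?groupM // rmorphM /= !galM ?iiE ?spE // e1 e2 t_ii.
  by rewrite rmorphN /= t_sp opprK.
- right; apply: fix_or; rewrite ?groupM // rmorphM /= !galM ?iiE ?spE // e1 e2.
  by rewrite rmorphN /= t_ii t_sp mulrNN.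
- by left; apply: fix_or; rewrite // rmorphM /= e1 e2 mulrNN.
Qed.

Lemma t_notin : t \notin <[s]>%g.
Proof.
apply/negP=> /cycleP[j ej].
have : (s ^+ j)%g (ii * sp) = ii * sp.
  elim: j {ej} => [|j IH]; first by rewrite expg0 gal_id.
  by rewrite expgSr galM ?IH ?rpredM ?iiE ?spE // rmorphM /= s_ii s_sp mulrNN.
rewrite -ej rmorphM /= t_ii t_sp mulrN => /eqP.
rewrite eq_sym -subr_eq0 opprK -mulr2n -mulr_natl !mulf_eq0.
by rewrite (negPf two_neq0) (negPf ii_neq0) (negPf sp_neq0).
Qed.

Lemma gal_gen : (<[s]> <*> <[t]>)%g = G.
Proof.
apply/eqP; rewrite eqEsubset join_subG !cycle_subG sG tG /=.
have tj : t \in (<[s]> <*> <[t]>)%g by rewrite mem_gen // inE cycle_id orbT.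
have sj g : g \in <[s]>%g -> g \in (<[s]> <*> <[t]>)%g by move=> h; rewrite mem_gen // inE h.
by apply/subsetP => g /gal_decomp [/sj //|/sj]; rewrite groupMr.
Qed.

Lemma gal_card : #|G| = 16%N.
Proof.
have c8 : #|<[s]>%g| = 8%N by rewrite -orderE order_s.
have sub : (<[s]>%g \subset G) by rewrite cycle_subG.
have h1 : (8 %| #|G|)%N by rewrite -c8 cardSg.
have h2 : (8 < #|G|)%N.
  rewrite -c8 proper_card // properE sub; apply/subsetPn; exists t => //; exact: t_notin.
have sub2 : G \subset (<[s]> :|: <[s]> :* t^-1)%g.
  apply/subsetP => g /gal_decomp [h|h]; rewrite inE; first by rewrite h.
  by rewrite mem_rcoset invgK h orbT.
have h3 : (#|G| <= 8 + 8)%N.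
  apply: leq_trans (subset_leq_card sub2) _.
  by apply: leq_trans (leq_card_setU _ _) _; rewrite card_rcoset c8.
by case/dvdnP: h1 h2 h3 => j ->; clear; lia.
Qed.

Lemma s_pow8 : (s ^+ 8 = 1)%g.
Proof. by rewrite -(order_s sG s_ii s_sp) expg_order. Qed.
Lemma t_sqr : (t ^+ 2 = 1)%g. Proof. by rewrite expgS expg1 t_involution. Qed.
Lemma t_inv : (t^-1 = t)%g. Proof. by apply: (mulgI t); rewrite mulgV t_involution. Qed.
Lemma s_conj_t : (s ^ t)%g = (s^-1 * (u * u))%g.
Proof. by rewrite /u conjgE t_inv !mulgA mulVg mul1g. Qed.

Lemma isog_dihedral : twist = false -> (G \isog 'D_16)%g.
Proof.
move=> tw; apply/(isoGrpP _ (@Grp_dihedral 8 isT)).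
rewrite (@card_dihedral 8 isT) gal_card; split=> //.
apply/existsP; exists (s, t); rewrite /= !xpair_eqE gal_gen s_pow8 t_sqr s_conj_t u_sqr tw mulg1 !eqxx //.
Qed.

Lemma isog_semidihedral : twist = true -> (G \isog 'SD_16)%g.
Proof.
move=> tw; apply/(isoGrpP _ SD16_presentation).
rewrite (@card_semidihedral 4 isT) gal_card; split=> //.
apply/existsP; exists (s, t); rewrite /= !xpair_eqE gal_gen s_pow8 t_sqr s_conj_t u_sqr tw !eqxx /=.
by rewrite !expgS mulKg eqxx.
Qed.

End Relations.

Lemma ex_generators : exists s t : gal_of E,
  [/\ s \in G, s ii = - ii, s sp = - sp & [/\ t \in G, t ii = ii, t sp = - sp & t r = r]].
Proof.
have [s [_ sG s_ii s_sp]] := ex_sigma; have [t ht] := ex_tau sG s_ii s_sp.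
by exists s, t.
Qed.

Lemma dihedral_extension : twist = false -> G_extension k E 'D_16.
Proof.
move=> tw; split; first exact: galois_kE.
by have [s [t [? ? ? [? ? ? ?]]]] := ex_generators; apply: (@isog_dihedral s t).
Qed.

Lemma semidihedral_extension : twist = true -> G_extension k E 'SD_16.
Proof.
move=> tw; split; first exact: galois_kE.
by have [s [t [? ? ? [? ? ? ?]]]] := ex_generators; apply: (@isog_semidihedral s t).
Qed.

(** * Ramification in the field generated by the conjugates of mu *)

Lemma r'_primary : r' ^+ 2 = 1 + 4%:R * phi (conj pi1).
Proof. by rewrite r'2 conj_primary !gphiE. Qed.

Lemma dbl_root_fix (f : {rmorphism Om -> Om}) s : f ii = ii -> f r = r -> f s = s -> f (dbl_root s) = dbl_root s.
Proof.
move=> hi hr hs; have ph x : f (phi x) = phi x by exact: gphi_fix.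
rewrite /dbl_root ; do 3 rewrite (rmorphD f).
by rewrite (rmorphM f (r * s)) (rmorphM f r) (rmorphM f s) (rmorphM f r) !ph hr hs rmorph_int.
Qed.

Lemma conj_root_flip (f : {rmorphism Om -> Om}) s : f ii = ii -> f sk = sk -> f sp = sp -> f r = r ->
  f m = - m -> f s = s -> f (conj_root s) = - conj_root s.
Proof.
move=> hi hk hp hr hm hs; rewrite /conj_root (fmorph_div f) (rmorphM f (dbl_root s)) dbl_root_fix //.
rewrite (rmorphM f _ sR) (rmorphM f _ m) rmorph_nat hm.
have -> : f sR = sR by rewrite sRd rmorphM rmorphXn rmorph_int /= hp.
have -> : f th = th by rewrite thd; case: twist; rewrite ?rmorph1 // fmorph_div rmorphM /= hk hi hp.
by rewrite mulrN mulNr invrN mulrN.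
Qed.

Lemma mt_flip (f : {rmorphism Om -> Om}) : f ii = ii -> f sp = sp -> f r = r ->
  f m = - m -> f mt = - mt.
Proof.
move=> hi hp hr hm; rewrite mtd r'd (fmorph_div f) (rmorphM f _ (sp / r)) (rmorphM f (phi kap)).
by rewrite !(gphi_fix _ hi) (fmorph_div f) hm hp hr invrN mulrN.
Qed.

Local Notation O := (ring_of_integers E).
Lemma O_r : O r.
Proof. by split; [exact: rE | apply: (algint_sqr _ r2); exact: algint_gphi]. Qed.
Lemma O_r' : O r'.
Proof. by split; [exact: r'E | apply: (algint_sqr _ r'2); exact: algint_gphi]. Qed.

Lemma O_m : O m.
Proof.
split; [exact: mE | apply: (algint_sqr _ m2); apply: algintM; first exact: algint_gphi].
by apply: algintD; [|apply: algintM; [|by case: O_r]]; exact: algint_gphi.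
Qed.

Local Notation sq := (sk / (ii * sp)).

Lemma sq2 : sq ^+ 2 = q%:R.
Proof.
rewrite expr_div_n exprMn ii2 sk2 sp2 natrM mulN1r invrN mulrNN mulrAC divff ?mul1r //.
by rewrite Om_nat_eq0 -lt0n prime_gt0.
Qed.

Lemma sqE : sq \in E.
Proof. by apply: rpred_div; [exact: skE | apply: rpredM; [exact: iiE | exact: spE]]. Qed.

Lemma primary_nat (l : nat) : (l = 1 %[mod 4])%N -> exists2 y : Om, algint y & l%:R = 1 + 4%:R * y.
Proof using.
move=> l4; exists (l %/ 4)%N%:R; first exact: algint_nat.
by rewrite -natrM -[1]/(1%:R) -natrD; congr (_ %:R); move: l4; clear; lia.
Qed.

Lemma sq_primary : exists2 y : Om, algint y & sq ^+ 2 = 1 + 4%:R * y.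
Proof. by rewrite sq2; apply: primary_nat; move: q8; clear; lia. Qed.
Lemma sp_primary : exists2 y : Om, algint y & sp ^+ 2 = 1 + 4%:R * y.
Proof. by rewrite sp2; apply: primary_nat; move: p8; clear; lia. Qed.

(** The generators are treated in the order i, sqrt p, r, m, each one being
    fixed by g once the previous ones are.  A moved generator puts in P: 2 and
    one of p, q for i; p and q for sqrt p; pi and pi' for r.  For m, a prime
    above 2 is excluded by integrality of (1 + m) / 2, and any other one would
    contain kappa mu, kappa mu~ and their complex conjugates, where kappa and
    kappa' are coprime. *)
Lemma inertia_trivial (P : Om -> Prop) (g : gal_of E) (y : Om) :
  algint y -> m ^+ 2 = 1 + 4%:R * y -> is_prime_ideal E P -> g \in G ->
  (forall x, O x -> P (g x - x)) -> g = 1%g.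
Proof.
move=> iy my Pp gG hP; have iP := prime_is_ideal Pp; have gsk := gal_sk gG.
have [j ej] := pmod; have [l el] := qmod.
have Ophi x : O (phi x) by exact: O_gphi iiE x.
have PN x : P (- x) -> P x by move=> h; rewrite -(opprK x); exact: (idealN iP).
have Psq x t : O x -> P (- x) -> x ^+ 2 = t -> P t.
  by move=> Ox /PN Px <-; rewrite expr2; exact: (idealMl iP).
have iiE' := iiE; have spE' := spE; have skE' := skE.
have sq2 := sq2; have sqE := sqE.
have sqP : g sq = - sq -> P q%:R.
  move=> gs; have [y0 iy0 ey] := sq_primary.
  apply: (Psq sq) => //; first by split=> //; apply: (algint_sqr _ sq2); exact: algint_nat.
  exact: (half_moved sqE ey iy0 hP gs).
have spP : g sp = - sp -> P p%:R.
  move=> gs; have [y0 iy0 ey] := sp_primary.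
  apply: (Psq sp) => //; first by split=> //; apply: (algint_sqr _ sp2); exact: algint_nat.
  exact: (half_moved spE' ey iy0 hP gs).
have cop (u v : int) : P u%:~R -> P v%:~R -> coprimez u v -> False.
  by move=> Pu Pv c; exact: (prime_int_coprime Pp c).
have g_sq : g sq = sk / (g ii * g sp) by rewrite fmorph_div rmorphM /= gsk.
have gi_ii : g ii = ii.
  case: (f_ii g) => // /= gii; exfalso.
  have P2 : P 2%:Z%:~R.
    have -> : 2%:Z%:~R = ii * (g ii - ii) :> Om.
      by rewrite gii; have -> : ii * (- ii - ii) = - (2%:R * ii ^+ 2) by [ring]; rewrite ii2 mulrN1 opprK.
    apply: (idealMl iP); first by split=> //; exact: algint_ii.
    by apply: hP; split=> //; exact: algint_ii.
  case: (f_sp g) => /= gsp.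
    have Pq : P q%:Z%:~R by apply: sqP; rewrite g_sq gii gsp mulNr invrN mulrN.
    by apply: (cop _ _ P2 Pq); rewrite coprimezE /= coprime2n; move: q8; clear; lia.
  apply: (cop _ p P2 (spP gsp)).
  by rewrite coprimezE /= coprime2n; move: p8; clear; lia.
have g_sp : g sp = sp.
  case: (f_sp g) => // /= gsp; exfalso.
  have P1 := spP gsp; have P2 : P q%:R by apply: sqP; rewrite g_sq gi_ii gsp mulrN invrN mulrN.
  apply: (cop p q P1 P2); rewrite coprimezE /= prime_coprime // dvdn_prime2 //.
  by apply/eqP=> epq; move: p8 q8; rewrite epq; clear; lia.
have op : odd p by move: p8; clear; lia.
have oq : odd q by move: q8; clear; lia.
have g_r : g r = r.
  case: (f_r gi_ii) => // /= gr; exfalso.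
  apply: (pi_pi'_coprime ii2 iiE' Pp pp op npi).
    apply: (Psq r) => //; first exact: O_r.
    apply: (half_moved rE _ _ hP gr (y := phi pi1)); last exact: algint_gphi.
    by rewrite r2 !gphiE.
  apply: (Psq r') => //; [exact: O_r' | | exact: r'2].
  apply: (half_moved r'E r'_primary _ hP); first exact: algint_gphi.
  by rewrite r'd fmorph_div /= g_sp gr invrN mulrN.
apply: gal_gens_id => //; case: (f_m gi_ii g_r) => // /= gm; exfalso.
have O2 := O_nat E 2; have P1 := prime_n1 Pp.
have [P2|nP2] := classic (P 2%:R).
  have Pm := half_moved mE my iy hP gm; have := Psq _ _ O_m Pm my => h.
  apply: P1; apply: (ideal_sub iP (y := - (4%:R * y))); first by rewrite opprK.
  apply: (idealN iP); have -> : 4%:R * y = 2%:R * y * 2%:R by ring.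
  apply: (idealMl iP) => //; split; last by apply: algintM => //; exact: algint_nat.
  have -> : 2%:R * y = (m ^+ 2 - 1) / 2%:R by rewrite my; field; exact: two_neq0.
  by apply: rpred_div; [apply: rpredB; [apply: rpredX; exact: mE | exact: rpred1] | exact: rpred_nat].
have flip x : O x -> g x = - x -> P (x ^+ 2).
  move=> Ox gx; have := hP x Ox; rewrite gx => h.
  have : P (2%:R * x) by apply: PN; have -> : - (2%:R * x) = - x - x by ring.
  by case/(prime_mulP Pp O2 Ox) => // Px; rewrite expr2; exact: (idealMl iP).
have O_A x y' s : O s -> O (phi x + phi y' * s).
  by move=> Os; apply: OD => //; apply: OM.
have O_A' x y' s : O s -> O (phi x - phi y' * s).
  by move=> Os; apply: OB => //; apply: OM.
have h1 := flip _ O_m gm; rewrite m2 in h1.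
have Omt : O mt.
  split; [exact: mtE | apply: (algint_sqr _ mt2); apply: algintM; first exact: algint_gphi].
  by case: (O_A' A B r O_r).
have h2 := flip _ Omt (mt_flip gi_ii g_sp g_r gm); rewrite mt2 in h2.
have g_r' : g r' = r' by rewrite r'd fmorph_div /= g_sp g_r.
have hm' s : O s -> s ^+ 2 = phi (conj pi) -> g s = s ->
    P (phi (conj kap) * (phi (conj A) + phi (conj B) * s)).
  move=> Os s2 gs; rewrite -conj_root_sqr //; apply: flip; last exact: conj_root_flip.
  split; [by apply: conj_rootE; case: Os | apply: (algint_sqr _ (conj_root_sqr s2)); apply: algintM; first exact: algint_gphi].
  by case: (O_A (conj A) (conj B) s Os).
have [Pk|nPk] := classic (P (phi kap)); last first.
  case: (prime_mulP Pp (Ophi _) (O_A _ _ _ O_r) h1) => // h1'.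
  case: (prime_mulP Pp (Ophi _) (O_A' _ _ _ O_r) h2) => // h2'.
  exact: (mu_coprime ii2 iiE' Pp pp op npi cABC co r2 O_r nP2 h1' h2').
have nPk' : ~ P (phi (conj kap)).
  move=> Pk'; have PN' : P (norm kap)%:~R by rewrite -(gphi_norm ii2); exact: (idealMl iP).
  move: nkap; case: twist => nk; last by rewrite nk in PN'.
  apply: (cop _ _ _ PN'); last by rewrite nk; exact: (sum_two_squares_coprime qp oq nk).
  by rewrite -(gphi_int ii) -add_conj gphiD; exact: (idealD iP).
have gNr' : g (- r') = - r' by rewrite rmorphN /= g_r'.
have h3 := hm' r' O_r' r'2 g_r'.
have h4 := hm' (- r') (ON O_r') (etrans (sqrrN _) r'2) gNr'.
case: (prime_mulP Pp (Ophi _) (O_A _ _ _ O_r') h3) => // h3'.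
case: (prime_mulP Pp (Ophi _) (O_A _ _ _ (ON O_r')) h4) => // h4'.
have cop' : coprime3 (conj A) (conj B) (conj C).
  by move=> t /gdvd_conj + /gdvd_conj + /gdvd_conj; rewrite !conjK -norm_conj; exact: co.
have npi' : norm (1 + 4%:R * conj pi1) = p%:Z by rewrite -conj_primary norm_conj.
have cc : conic (conj pi1) (conj A) (conj B) (conj C).
  by rewrite /conic -conj_primary conjK; exact: conic_conj cABC.
apply: (mu_coprime ii2 iiE' Pp pp op npi' cc cop' _ O_r' nP2 h3').
  by rewrite r'2 conj_primary.
by rewrite -mulrN.
Qed.

Lemma unramified_kE (y : Om) : algint y -> m ^+ 2 = 1 + 4%:R * y -> unramified k E.
Proof.
move=> iy my; split=> [P Pp|f fk].
  apply: (unramified_at_prime galois_kE Pp) => g gG g1; apply: NNPP => H.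
  case/eqP: g1; apply: (inertia_trivial iy my Pp gG) => x Ox; apply: NNPP => nP.
  by apply: H; exists x.
have : f sk \is Num.real by apply: fk; exact: memv_adjoin.
move=> /real_exprn_even_ge0 -/(_ 2%N isT); rewrite -rmorphXn sk2 rmorphN rmorph_nat oppr_ge0.
by rewrite lern0 muln_eq0 => /orP[] /eqP h; move: pp qp; rewrite h.
Qed.

(** Modulo 8 the left-hand side is t^2 + 5 c^2. *)
Lemma even_prime_norm (t c N : int) : t ^+ 2 + (p * q)%:Z * c ^+ 2 = 8%:Z * N ->
  exists t1 c1 : int, t = 2%:Z * (2%:Z * t1 + c1) /\ c = 2%:Z * c1.
Proof using p8 q8.
have [j ej] := pmod; have [l el] := qmod.
rewrite PoszM ej el => h.
have {h} : exists M, t ^+ 2 + 5%:Z * c ^+ 2 = 8%:Z * M.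
  by exists (N - (8%:Z * j * l + 5%:Z * j + l) * c ^+ 2); rewrite mulrBr -h; ring.
case=> M; rewrite !expr2; clear.
have [u [->|->]] := int_parity t; have [v [->|->]] := int_parity c; [|lia|lia|]; last first.
  have [u' [->|->]] := int_parity u; have [v' [->|->]] := int_parity v; lia.
have [u' [->|->]] := int_parity u; have [v' [->|->]] := int_parity v; move=> h; try (exfalso; lia).
  by exists (u' - v'), (2%:Z * v'); clear; split; lia.
by exists (u' - v'), (2%:Z * v' + 1); clear; split; lia.
Qed.

Lemma sk_sqr_int : sk ^+ 2 = (- (p * q)%:Z)%:~R. Proof. by rewrite sk2 intrN. Qed.
Lemma neg_pq_nonsqr (x : int) : x ^+ 2 <> - (p * q)%:Z.
Proof. by move=> h; have := sqr_ge0 x; rewrite h oppr_ge0 leNgt ltz_nat muln_gt0 !prime_gt0. Qed.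

(** An element of k above 2 has even norm; by [even_prime_norm] its product with
    p q is then a combination of 2 and 1 + sqrt(-p q), and the latter is 1 + i
    modulo 2 since sqrt p and sqrt q are 1 modulo 2.  As 2 lies in J, the odd
    factor p q can be removed. *)
Lemma even_prime_sub (P J : Om -> Prop) x : is_prime_ideal E P -> is_ideal E J ->
  P 2%:R -> J 2%:R -> J (1 + ii) -> P x -> x \in k -> J x.
Proof.
move=> Pp iJ P2 J2 Jl Px xk; have iP := prime_is_ideal Pp.
have [xE ix] := ideal_O iP Px.
have [t [c [N [ex ec eN]]]] := quadratic_integer sk_sqr_int neg_pq_nonsqr xk ix.
have gE : t%:~R - x \in E by rewrite rpredB ?rpred_int.
have iy : algint (t%:~R - x) by apply: algintB => //; exact: algint_int.
have PN : P N%:~R by rewrite -eN; apply: (idealMr iP).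
have [N1 eN1] : exists N1 : int, N = 2%:Z * N1.
  have [d [->|eN']] := int_parity N; first by exists d.
  exfalso; apply: (prime_int_coprime Pp _ (P2 : P 2%:Z%:~R) PN).
  by rewrite coprimezE /= coprime2n eN'; clear; lia.
pose D := (p * q)%:Z.
have eq2 : (D * t) ^+ 2 + D * c ^+ 2 = 8%:Z * (D ^+ 2 * N1) by rewrite ec eN1 -/D; ring.
have [t1 [c1 [e1 e2]]] := even_prime_norm eq2.
have eDx : D%:~R * x = 2%:R * t1%:~R + c1%:~R * (1 + sk).
  have d2 : 2%:R * (D%:~R * x) = (D * t)%:~R + c%:~R * sk.
    move: ex; rewrite -/D mulNr !intrN => /(congr1 -%R) h.
    by transitivity (- (2%:R * - D%:~R * x)); [ring | rewrite h; ring].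
  apply: (mulfI two_neq0); rewrite d2 e1 e2 !intrM intrD intrM; ring.
have Jsk : J (1 + sk).
  have [y1 iy1 ey1] := sp_primary; have [y2 iy2 ey2] := sq_primary.
  have O1 := half_integer spE ey1 iy1; have O2 := half_integer sqE ey2 iy2.
  move: O1 O2; set a1 := (1 + sp) / _; set a2 := (1 + sq) / _ => O1 O2.
  have esp : sp = 2%:R * a1 - 1 by rewrite /a1 [2%:R * _]mulrC divfK ?two_neq0 // addrAC subrr add0r.
  have esq : sq = 2%:R * a2 - 1 by rewrite /a2 [2%:R * _]mulrC divfK ?two_neq0 // addrAC subrr add0r.
  have -> : 1 + sk = (1 + ii) + 2%:R * (ii * (2%:R * a1 * a2 - a1 - a2)).
    have -> : sk = ii * sp * sq by rewrite [RHS]mulrC divfK // mulf_neq0 ?ii_neq0 ?sp_neq0.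
    by rewrite esq esp; ring.
  apply: (idealD iJ) => //; apply: (idealMr iJ) => //; apply: OM.
    by split; [exact: iiE | exact: algint_ii].
  by apply: OB => //; apply: OB => //; apply: OM => //; apply: OM => //; exact: O_nat.
have JDx : J (D%:~R * x).
  by rewrite eDx; apply: (idealD iJ); [apply: (idealMr iJ) | apply: (idealMl iJ)] => //; exact: O_int.
have [w ew] : exists w : nat, (p * q = 2 * w + 1)%N.
  exists (p * q)./2; rewrite -[LHS]odd_double_half addnC mul2n oddM (_ : odd p && odd q) //.
  by apply/andP; split; [move: p8 | move: q8]; clear; lia.
apply: (ideal_sub iJ (y := - (2%:R * (w%:R * x)))).
  have -> : x - - (2%:R * (w%:R * x)) = D%:~R * x by rewrite /D ew PoszD intrD PoszM intrM; ring.
  exact: JDx.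
apply: (idealN iJ); apply: (idealMr iJ) => //; apply: OM => //; exact: O_nat.
Qed.

(** Let lam = 1 + i and h = (m - 1) / lam.  Then h^2 = i lam h - i lam
    (1 + lam y), so h lies in a prime P above 2, and lam = i h^2 +
    lam (h - lam y) lies in P^2.  With [even_prime_sub], the prime of k below P
    is contained in P^2. *)
Lemma ramified_kE (y : Om) : algint y -> m ^+ 2 = 1 + 2%:R * (1 + ii) * (1 + (1 + ii) * y) ->
  ramified_at_2 k E.
Proof.
move=> iy my; pose l := 1 + ii.
have l2 : l ^+ 2 = 2%:R * ii by rewrite /l sqrrD ii2; ring.
have l0 : l != 0 by rewrite -sqrf_eq0 l2 mulf_neq0 ?two_neq0 ?ii_neq0.
have e2 : 2%:R = - ii * l ^+ 2 by rewrite l2 mulrCA mulNr -expr2 ii2 opprK mulr1.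
have Oii : O ii by split; [exact: iiE | exact: algint_ii].
have Ol : O l by apply: OD Oii; exact: O1.
have yE : y \in E.
  have -> : y = ((m ^+ 2 - 1) / (2%:R * l) - 1) / l.
    by rewrite my -/l; field; rewrite l0 two_neq0.
  have [lE mE'] : l \in E /\ m \in E by split; [case: Ol | exact: mE].
  by rewrite rpred_div // rpredB ?rpred1 // rpred_div ?rpredM ?rpredB ?rpredX ?rpred1 ?rpred_nat.
have Oy : O y by [].
pose h := (m - 1) / l.
have em : m = 1 + l * h by rewrite /h mulrC divfK // addrC subrK.
have h2 : h ^+ 2 = - ii * l * (1 + l * y - h).
  apply: (mulfI (_ : l ^+ 2 != 0)); first by rewrite sqrf_eq0.
  transitivity (m ^+ 2 - 1 - 2%:R * l * h); first by rewrite em; ring.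
  by rewrite my -/l e2; ring.
have Oh : O h.
  split; first by rewrite /h rpred_div ?rpredB ?rpred1 ?mE //; case: Ol.
  apply: (@algint_quadratic _ _ (ii * l) (- ii * l * (1 + l * y))).
  - by case: (OM Oii Ol).
  - by case: (OM (OM (ON Oii) Ol) (OD (O1 E) (OM Ol Oy))).
  - by rewrite h2; ring.
have [P Pp P2] := prime_above E (erefl : prime 2); have iP := prime_is_ideal Pp.
have Pl : P l by apply: (prime_expP Pp (n := 2) Ol); rewrite l2; exact: (idealMr iP).
have Ph : P h.
  apply: (prime_expP Pp (n := 2) Oh); rewrite h2; apply: (idealMr iP).
    by apply: OB Oh; apply: OD (O1 E) _; exact: OM.
  by apply: (idealMl iP) => //; exact: ON.
have iJ := ideal_exp_ideal 2 iP.
have Jl : ideal_exp E P 2 l.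
  have -> : l = h * (ii * h) + (l * (h - l * y)).
    have -> : h * (ii * h) = - (ii ^+ 2) * l * (1 + l * y - h).
      by transitivity (ii * h ^+ 2); [ring | rewrite h2; ring].
    by rewrite ii2; ring.
  apply: (idealD iJ); apply: ideal_exp2M => //; first exact: (idealMl iP).
  by apply: (idealB iP) => //; apply: (idealMr iP).
have J2 : ideal_exp E P 2 2%:R.
  by rewrite e2; apply: (idealMl iJ); [exact: ON | rewrite expr2; apply: (idealMl iJ)].
exists P; split=> //; apply: (ramification_index_exists (l := 2)) => // x.
apply: ideal_mul_sub; [exact: (ideal0 iJ) | exact: (idealD iJ) |] => u v [Pu uk] Ov.
by apply: (idealMr iJ) => //; apply: (even_prime_sub Pp iJ).
Qed.

End Tower.

(** * Integral closedness of the Gaussian integers *)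

Section GaussIntegers.
Variables (Om : splittingFieldType rat) (ii : Om).
Hypothesis ii2 : ii ^+ 2 = -1.
Local Notation phi := (gphi ii).
Local Notation Qi := (<<1; ii>>%AS : {subfield Om}).
Lemma ii_Qi : ii \in Qi. Proof. exact: memv_adjoin. Qed.
Lemma gphi_Qi x : phi x \in Qi. Proof. exact/gphi_mem/ii_Qi. Qed.

Lemma integral_gauss x : x \in Qi -> algint x -> exists y, x = phi y.
Proof.
move=> xQ ix.
have ii2' : ii ^+ 2 = (-1)%:~R by rewrite ii2.
have nsq (z : int) : z ^+ 2 <> -1 by move=> h; have := sqr_ge0 z; rewrite h.
have [t [c [N [ex ec _]]]] := quadratic_integer ii2' nsq xQ ix.
have n2 : 2%:R != 0 :> Om by rewrite Om_nat_eq0.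
have [t1 [c1 [e1 e2]]] : exists t1 c1, t = 2%:Z * t1 /\ c = 2%:Z * c1.
  move: ec; rewrite !expr2; clear.
  have [t1 [->|->]] := int_parity t; have [c1 [->|->]] := int_parity c; [|lia..].
  by exists t1, c1.
exists (Gint t1 c1); rewrite /gphi /=; apply: (mulfI n2).
transitivity (- (2%:R * (-1)%:~R * x)); first by rewrite intrN; ring.
by rewrite ex e1 e2 !intrM intrN -[2%:Z%:~R]/(2%:R); ring.
Qed.

Lemma coprime_gaussP A B C : coprime_gauss ii (phi A) (phi B) (phi C) <-> coprime3 A B C.
Proof.
split=> [co t [a ea] [b eb] [c ec]|co t A1 B1 C1].
  have gp x : gaussint ii (phi x) by apply/gaussint_gphi; exists x.
  have [|||u /gaussint_gphi[v ->] tu] := co (phi t) (phi a) (phi b) (phi c) (gp _) (gp _) (gp _) (gp _).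
  - by rewrite -gphiM // -ea.
  - by rewrite -gphiM // -eb.
  - by rewrite -gphiM // -ec.
  by apply: gdvd1; exists v; apply: (gphi_inj ii2); rewrite gphi1 gphiM.
move=> /gaussint_gphi[t0 ->] /gaussint_gphi[a ->] /gaussint_gphi[b ->] /gaussint_gphi[c ->].
rewrite -!gphiM // => /(gphi_inj ii2) ea /(gphi_inj ii2) eb /(gphi_inj ii2) ec.
exists (phi (conj t0)); first by apply/gaussint_gphi; exists (conj t0).
by rewrite gphi_norm // co //; [exists a | exists b | exists c].
Qed.

Lemma conic_solutionP pi1 A B C :
  conic_solution ii (phi (1 + 4%:R * pi1)) (phi (conj (1 + 4%:R * pi1))) (phi A) (phi B) (phi C)
  <-> conic pi1 A B C.
Proof.
have gp x : gaussint ii (phi x) by apply/gaussint_gphi; exists x.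
rewrite /conic_solution /conic; split=> [[_ _ _]|e].
  by rewrite -!gphiX // -!gphiM // -gphiB => /(gphi_inj ii2).
by split; rewrite // -!gphiX // -!gphiM // -gphiB e.
Qed.

Lemma sqrt_nat_Qi (l : nat) s : prime l -> s ^+ 2 = l%:R -> s \notin Qi.
Proof.
move=> pl s2; apply/negP => sQ.
have l0 : (0 < l)%N by exact: prime_gt0.
have ii21 : ii ^+ 2 \in (1%AS : {subfield Om}) by rewrite ii2 rpredN rpred1.
have s21 : s ^+ 2 \in (1%AS : {subfield Om}) by rewrite s2 rpred_nat.
case: (quad_descent ii21 s21 sQ); apply/negP.
  apply: (@sqrt_int_notin1 _ l%:Z) => // x h.
  by have := @prime_sqr_mul l x 1 pl; rewrite h expr1n mulr1 => /(_ erefl).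
apply: (@sqrt_int_notin1 _ (- l%:Z)); first by rewrite exprMn s2 ii2 mulrN1 intrN.
by move=> x h; have := sqr_ge0 x; rewrite h oppr_ge0 leNgt ltz_nat l0.
Qed.

End GaussIntegers.

(** * The extensions attached to a point of the conic *)

Section Assembly.
Variables (Om : splittingFieldType rat) (ii sk sp r : Om) (p q : nat) (pi1 : gint).
Hypotheses (pp : prime p) (qp : prime q) (p8 : (p = 1 %[mod 8])%N) (q8 : (q = 5 %[mod 8])%N).
Local Notation phi := (gphi ii).
Local Notation pi := (1 + 4%:R * pi1).
Hypotheses (npi : norm pi = p%:Z) (ii2 : ii ^+ 2 = -1) (sk2 : sk ^+ 2 = - (p * q)%:R)
  (sp2 : sp ^+ 2 = p%:R) (r2 : r ^+ 2 = phi pi).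
Local Notation Qi := (<<1; ii>>%AS : {subfield Om}).
Local Notation k := (<<1; sk>>%AS : {subfield Om}).

(** If A = 0, then p is the square of i pi B / C. *)
Lemma conic_A_neq0 A B C : conic pi1 A B C -> coprime3 A B C -> A != 0.
Proof.
move=> cA co; apply/eqP => A0.
have C0 : C != 0.
  apply/eqP => C0; move: cA; rewrite /conic A0 C0 !expr0n mulr0 sub0r => /eqP.
  rewrite oppr_eq0 mulf_eq0 sqrf_eq0 => /orP[/eqP h|/eqP B0]; last by apply: (nz3 co).
  by case: (gprime_pi pp npi); rewrite h eqxx.
have e : (ii * phi (pi * B) / phi C) ^+ 2 = sp ^+ 2.
  have C20 : phi C ^+ 2 != 0 by rewrite sqrf_eq0 gphi_eq0.
  rewrite expr_div_n; apply: (mulIf C20); rewrite divfK // exprMn ii2 sp2.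
  move/(congr1 (fun x => pi * x)): cA; rewrite /conic A0 expr0n sub0r [RHS]mulrA mul_conj npi.
  move=> /(congr1 phi); rewrite !(gphiM ii2 _ (C ^+ 2)) gphi_int gphiX // => <-.
  by rewrite mulN1r -gphiX // -gphiN; congr phi; ring.
have : ii * phi (pi * B) / phi C \in Qi.
  by rewrite rpred_div ?rpredM ?gphi_Qi //; exact: ii_Qi.
case: (sqr_eq e) => ->; rewrite ?rpredN; exact/negP/(sqrt_nat_Qi ii2 pp sp2).
Qed.

(** The fields depend on C only through C^2, so the sign of C can be chosen with
    R nonzero: the values of R at C and -C have sum 2 A A'. *)
Lemma tower_facts (kap A B C : gint) (rho : bool) (m : Om) :
  conic pi1 A B C -> coprime3 A B C -> norm kap = (if rho then q else 1%N)%:Z ->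
  m ^+ 2 = phi kap * (phi A + phi B * r) ->
  let E : {subfield Om} := <<k & [:: sp; r; m]>>%AS in
  [/\ rho = false -> G_extension k E 'D_16 /\ G_extension <<k; ii * sp>>%AS E [set: 'Z_8],
      rho = true -> G_extension k E 'SD_16
    & forall y, algint y -> m ^+ 2 = 1 + 4%:R * y -> unramified k E].
Proof.
move=> + + nk m2.
wlog R0 : C / Rval pi1 A B C != 0.
  move=> IH cA co; have [R0|R0] := eqVneq (Rval pi1 A B C) 0; last exact: (IH _ R0 cA co).
  apply: (IH (- C)).
  - have := Rval_add pi1 A B C; rewrite R0 add0r => ->.
    by rewrite mulf_neq0 // norm_eq0 (conic_A_neq0 cA co).
  - by move: cA; rewrite /conic sqrrN.
  - by move=> t tA tB /gdvdN; rewrite opprK; exact: co.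
move=> cA co; have [n [e eR]] := Rval_square pp p8 npi cA co R0 => E.
split.
- move=> h; split.
    exact: (dihedral_extension pp qp p8 q8 npi ii2 sk2 sp2 r2 cA co nk m2 R0 eR erefl erefl erefl erefl h).
  exact: (cyclic_extension pp qp p8 q8 npi ii2 sk2 sp2 r2 cA co nk m2 R0 eR erefl erefl erefl erefl).
- move=> h.
  exact: (semidihedral_extension pp qp p8 q8 npi ii2 sk2 sp2 r2 cA co nk m2 R0 eR erefl erefl erefl erefl h).
move=> y iy my.
exact: (unramified_kE pp qp p8 q8 npi ii2 sk2 sp2 r2 cA co nk m2 R0 eR erefl erefl erefl erefl iy my).
Qed.

Lemma r_notin_Qi : r \notin Qi.
Proof.
apply/negP => rQ; have ir : algint r by apply: (algint_sqr _ r2); exact: algint_gphi.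
have [y ey] := integral_gauss ii2 rQ ir.
have /(congr1 norm) : y ^+ 2 = pi by apply: (gphi_inj ii2); rewrite gphiX // -ey.
by rewrite npi expr2 normM -expr2 => h; have := @prime_sqr_mul p (norm y) 1 pp; rewrite h expr1n mulr1 => /(_ erefl).
Qed.

Lemma m22E : 2%:R + 2%:R * ii = phi (2%:R * lam).
Proof. by rewrite /gphi gint_simp /= ; ring. Qed.

Lemma half_r : exists2 w : Om, algint w & r = 1 + 2%:R * w.
Proof.
have ey : r ^+ 2 = 1 + 4%:R * phi pi1 by rewrite r2 !gphiE.
have [_ h] := half_integer (memvf r) ey (algint_gphi ii2 pi1).
have n2 : 2%:R != 0 :> Om by rewrite Om_nat_eq0.
exists ((1 + r) / 2%:R - 1); first by apply: algintB => //; exact: algint1.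
by field.
Qed.

Lemma mu_expansion T1 B1 s w : B1 + gi * T1 = lam * s -> r = 1 + 2%:R * w ->
  phi (1 + 2%:R * gi * T1) + phi (2%:R * B1) * r = 1 + 2%:R * phi lam * phi s + 4%:R * (phi B1 * w).
Proof.
move=> es ->; rewrite -(mulrA 2%:R (phi lam)) -gphiM // -es !gphiE //; ring.
Qed.

(** The conjugate of (mu - 1) / (2 + 2 i) over Q(i) is also integral; the trace
    and the norm are then Gaussian integers, to which [conic_normal_form]
    applies. *)
Lemma normal_form A B C : conic pi1 A B C -> coprime3 A B C ->
  eqmod_int (phi A + phi B * r) 1 (2%:R + 2%:R * ii) ->
  exists T1 B1 s, [/\ A = 1 + 2%:R * gi * T1, B = 2%:R * B1 & B1 + gi * T1 = lam * s].
Proof.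
move=> cA co; rewrite /eqmod_int m22E; set d := _ / _ => id.
have m0 : phi (2%:R * lam) != 0 by rewrite gphi_eq0.
have l0 : phi lam != 0 by rewrite gphi_eq0.
have r2Q : r ^+ 2 \in Qi by rewrite r2 gphi_Qi.
have [g gG gr] := gal_flip (galois_full Qi) (memvf r) r2Q r_notin_Qi.
have gQ x : g (phi x) = phi x by apply: (fixed_gal (subvf _) gG); exact: gphi_Qi.
have gd : g d = (phi A - phi B * r - 1) / phi (2%:R * lam).
  rewrite /d (fmorph_div g) (rmorphB g _ 1) (rmorphD g (phi A)) (rmorphM g (phi B)) rmorph1.
  by rewrite /= !gQ gr mulrN.
have igd : algint (g d) by apply: algint_rmorph.
have n2 : 2%:R != 0 :> Om by rewrite Om_nat_eq0.
have eT : d + g d = phi (A - 1) / phi lam.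
  by rewrite gd /d gphiB !gphiE //; field; rewrite l0 n2.
have eN : d * g d = phi ((A - 1) ^+ 2 - pi * B ^+ 2) / phi (8%:R * gi).
  have e8 : 8%:R * gi = (2%:R * lam) ^+ 2 by exact: gintP.
  rewrite gd /d e8 gphiB (gphiM ii2 pi) -r2 !gphiX // gphiB gphi1.
  by field.
have [T eT1] : exists T, d + g d = phi T.
  by apply: (integral_gauss ii2); [rewrite eT rpred_div // gphi_Qi | exact: algintD].
have [N eN1] : exists N, d * g d = phi N.
  by apply: (integral_gauss ii2); [rewrite eN rpred_div // gphi_Qi | exact: algintM].
apply: (conic_normal_form p8 npi cA co (T := T) (N := N)); apply: (gphi_inj ii2).
  by rewrite gphiM // -eT1 eT mulrC divfK.
by rewrite [RHS]gphiM // -eN1 eN [RHS]mulrC divfK // gphi_eq0.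
Qed.

Lemma residue_form A B C T1 B1 s : conic pi1 A B C -> coprime3 A B C ->
  A = 1 + 2%:R * gi * T1 -> B = 2%:R * B1 -> B1 + gi * T1 = lam * s ->
  (forall x y : int, p%:Z = x ^+ 2 + 32%:Z * y ^+ 2 -> gdvd lam s) /\
  (forall x y : int, p%:Z = 4%:Z * x ^+ 2 + 4%:Z * x * y + 9%:Z * y ^+ 2 -> exists t, s = 1 + lam * t).
Proof.
move=> cA co eA eB es.
have pE : p%:Z = (1 + 4%:Z * re pi1) ^+ 2 + (4%:Z * im pi1) ^+ 2.
  by rewrite -npi /norm !gint_simp /=; ring.
have par : ((re s + im s) %% 2)%Z = ((re pi1 + im pi1) %% 2)%Z.
  by move: cA co; rewrite eA eB => cA co; exact: (conic_congruence pp p8 npi cA co es).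
split=> x y /[dup] e _; first by apply/gdvd_lamP; rewrite par (form32_parity pp pE e).
have [t et] : gdvd lam (s - 1).
  apply/gdvd_lamP; rewrite !gint_simp /=.
  by move: par; rewrite (form9_parity pp pE e); clear; lia.
by exists t; rewrite -et addrC subrK.
Qed.

(** Writing rho = 1 + 2 lam u, the norm is 1 + 4 Re(lam u) modulo 8, and it
    is 5 modulo 8 only for u odd. *)
Lemma rho_expansion rho : norm rho = q%:Z -> eqmod_int (phi rho) 1 (2%:R + 2%:R * ii) ->
  exists t, rho = 1 + 2%:R * lam * (1 + lam * t).
Proof.
rewrite /eqmod_int m22E => nr ir.
have [u eu] : exists u, (phi rho - 1) / phi (2%:R * lam) = phi u.
  by apply: (integral_gauss ii2) => //; rewrite rpred_div ?rpredB ?rpred1 // gphi_Qi.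
have er : rho = 1 + 2%:R * lam * u.
  apply: (gphi_inj ii2); rewrite gphiD gphiM // -eu gphi1 mulrC divfK; first by rewrite addrC subrK.
  by rewrite gphi_eq0.
have [t et] : gdvd lam (u - 1); last first.
  by exists t; rewrite er; congr (1 + _ * _); rewrite -et addrC subrK.
move: nr; rewrite gdvd_lamP er /norm !gint_simp /= => nr.
have [l el] : exists l : int, q%:Z = 8%:Z * l + 5%:Z by exists (q %/ 8)%N; move: q8; clear; lia.
move: nr; rewrite el; move: (re u) (im u) => x y; rewrite !expr2; clear.
have [x1 [->|->]] := int_parity x; have [y1 [->|->]] := int_parity y; lia.
Qed.

End Assembly.

Theorem proposition20 (p q : nat) (a b : int)
    (Om : splittingFieldType rat) (im sk sp spi : Om)
    (p_prime : prime p) (q_prime : prime q)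
    (p_mod8 : (p = 1 %[mod 8])%N) (q_mod8 : (q = 5 %[mod 8])%N)
    (leg_pq : legendre p q = -1)
    (p_eq : p%:Z = a ^+ 2 + b ^+ 2)
    (im_eq : im ^+ 2 = -1)
    (pi_mod4 : eqmod_int (a%:~R + b%:~R * im) 1 4%:R)
    (sk_eq : sk ^+ 2 = - (p * q)%:R)
    (sp_eq : sp ^+ 2 = p%:R)
    (spi_eq : spi ^+ 2 = a%:~R + b%:~R * im) :
  let pi : Om := a%:~R + b%:~R * im in
  let pi' : Om := a%:~R - b%:~R * im in
  let m22 : Om := 2%:R + 2%:R * im in
  let k : {subfield Om} := <<1; sk>>%AS in
  [/\ exists A B C : Om,
        conic_solution im pi pi' A B C /\ ~ [/\ A = 0, B = 0 & C = 0],
      forall A B C smu : Om,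
        conic_solution im pi pi' A B C -> coprime_gauss im A B C ->
        smu ^+ 2 = A + B * spi ->
        let K : {subfield Om} := <<k & [:: sp; spi; smu]>>%AS in
        G_extension k K 'D_16 /\
        G_extension <<k; im * sp>>%AS K [set: 'Z_8],
      exists A B C : Om,
        [/\ conic_solution im pi pi' A B C, coprime_gauss im A B C
          & eqmod_int (A + B * spi) 1 m22]
    & forall A B C : Om,
        conic_solution im pi pi' A B C -> coprime_gauss im A B C ->
        eqmod_int (A + B * spi) 1 m22 ->
        ((exists x y : int, p%:Z = x ^+ 2 + 32%:Z * y ^+ 2) ->
         forall smu : Om, smu ^+ 2 = A + B * spi ->
         unramified k <<k & [:: sp; spi; smu]>>%AS)
        /\
        ((exists x y : int,
            p%:Z = 4%:Z * x ^+ 2 + 4%:Z * x * y + 9%:Z * y ^+ 2) ->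
         (forall smu : Om, smu ^+ 2 = A + B * spi ->
          ramified_at_2 k <<k & [:: sp; spi; smu]>>%AS)
         /\
         (forall (c d : int) (srho : Om),
            q%:Z = c ^+ 2 + d ^+ 2 ->
            eqmod_int (c%:~R + d%:~R * im) 1 m22 ->
            srho ^+ 2 = (c%:~R + d%:~R * im) * (A + B * spi) ->
            let L : {subfield Om} := <<k & [:: sp; spi; srho]>>%AS in
            G_extension k L 'SD_16 /\ unramified k L))].
Proof.
have [pi1 epi1] : exists pi1, Gint a b = 1 + 4%:R * pi1.
  have n4 : 4%:R != 0 :> Om by rewrite Om_nat_eq0.
  have [y ey] : exists y, (gphi im (Gint a b) - 1) / 4%:R = gphi im y.
    apply: (integral_gauss im_eq) => //.
    by rewrite rpred_div ?rpredB ?rpred1 ?rpred_nat // gphi_Qi.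
  exists y; apply: (gphi_inj im_eq); rewrite !gphiE // -ey mulrC divfK //.
  by rewrite addrC subrK.
have npi : norm (1 + 4%:R * pi1) = p%:Z by rewrite -epi1 p_eq.
have r2 : spi ^+ 2 = gphi im (1 + 4%:R * pi1) by rewrite -epi1.
move=> pi pi' m22 k.
have epi : pi = gphi im (1 + 4%:R * pi1) by rewrite -epi1.
have epi' : pi' = gphi im (conj (1 + 4%:R * pi1)).
  by rewrite -epi1 /pi' /gphi /= intrN mulNr.
have gp x : gaussint im (gphi im x) by apply/gaussint_gphi; exists x.
have coords A B C : conic_solution im pi pi' A B C -> exists A0 B0 C0,
    [/\ A = gphi im A0, B = gphi im B0, C = gphi im C0 & conic pi1 A0 B0 C0].
  move=> h; have [/gaussint_gphi[A0 eA] /gaussint_gphi[B0 eB] /gaussint_gphi[C0 eC] _] := h.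
  by exists A0, B0, C0; split=> //; move: h; rewrite eA eB eC epi epi' => /(conic_solutionP im_eq).
have facts := tower_facts p_prime q_prime p_mod8 q_mod8 npi im_eq sk_eq sp_eq r2.
have norm1 : norm 1 = 1%N%:Z by [].
split.
- have [A [B [C [cA A0]]]] := conic_exists p_prime p_mod8 npi.
  exists (gphi im A), (gphi im B), (gphi im C); rewrite epi epi'.
  split; first exact/conic_solutionP.
  by case=> /eqP; rewrite gphi_eq0 // (negPf A0).
- move=> A B C smu /coords[A0 [B0 [C0 [-> -> -> cA]]]] /(coprime_gaussP im_eq) co m2 K.
  rewrite -[gphi im A0 + _]mul1r -(gphi1 im) in m2.
  by have [h _ _] := facts 1 A0 B0 C0 false smu cA co norm1 m2; apply: h.
- have [T1 [B1 [C [s [cA co es]]]]] := conic_normal_exists p_prime p_mod8 npi.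
  exists (gphi im (1 + 2%:R * gi * T1)), (gphi im (2%:R * B1)), (gphi im C); split.
  + by rewrite epi epi'; apply/conic_solutionP.
  + exact/coprime_gaussP.
  have [w iw ew] := half_r im_eq r2.
  rewrite /eqmod_int /m22 m22E (mu_expansion im_eq es ew) -(addrA 1) [1 + (_ + _)]addrC addrK.
  have l0 : gphi im lam != 0 by rewrite gphi_eq0.
  have n2 : 2%:R != 0 :> Om by rewrite Om_nat_eq0.
  have e4 : 4%:R = gphi im (2%:R * lam) * gphi im (- gi * lam).
    by rewrite -gphiM // -(gphi_nat im); congr gphi; exact: gintP.
  have -> : (2%:R * gphi im lam * gphi im s + 4%:R * (gphi im B1 * w)) / gphi im (2%:R * lam)
      = gphi im s + gphi im (- gi * lam) * (gphi im B1 * w).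
    by rewrite e4 gphiM // gphi_nat; field; rewrite l0.
  by apply: algintD; [|apply: algintM; [|apply: algintM]]; rewrite //; exact: algint_gphi.
move=> A B C /coords[A0 [B0 [C0 [-> -> -> cA]]]] /(coprime_gaussP im_eq) co mu_mod.
have [T1 [B1 [s [eA eB es]]]] := normal_form p_prime p_mod8 npi im_eq r2 cA co mu_mod.
have [w iw ew] := half_r im_eq r2.
have emu : gphi im A0 + gphi im B0 * spi = 1 + 2%:R * gphi im lam * gphi im s + 4%:R * (gphi im B1 * w).
  by rewrite eA eB; exact: mu_expansion.
have [even_s odd_s] := residue_form p_prime p_mod8 npi cA co eA eB es.
have iB : algint (gphi im B1 * w) by apply: algintM => //; exact: algint_gphi.
split.
  move=> [x [y e32]] smu m2.
  have [t et] := even_s _ _ e32.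
  have m2' : smu ^+ 2 = gphi im 1 * (gphi im A0 + gphi im B0 * spi) by rewrite gphi1 mul1r.
  have [_ _ h] := facts 1 A0 B0 C0 false smu cA co norm1 m2'.
  apply: (h (gphi im (gi * t) + gphi im B1 * w)).
    by apply: algintD => //; exact: algint_gphi.
  have e2 : 2%:R * gphi im lam * gphi im s = 4%:R * gphi im (gi * t).
    rewrite -(gphi_nat im 2) -(gphi_nat im 4) -!gphiM // et.
    by congr gphi; rewrite !mulrA -(mulrA 2%:R lam lam) lam2; ring.
  by rewrite m2 emu e2; ring.
move=> [x [y e9]].
have [s' es'] := odd_s _ _ e9.
pose y0 := gphi im s' - im * (gphi im B1 * w).
have iim : algint im by exact: algint_ii.
have iy0 : algint y0.
  by apply: algintB; [exact: algint_gphi | exact: algintM].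
have el : gphi im lam = 1 + im by rewrite lamE !gphiE.
have mu_y0 : gphi im A0 + gphi im B0 * spi = 1 + 2%:R * (1 + im) * (1 + (1 + im) * y0).
  rewrite emu es' !gphiE // /y0 el.
  have e4 : 4%:R = - 2%:R * im * (1 + im) ^+ 2 :> Om.
    by rewrite sqrrD im_eq; transitivity (- 4%:R * im ^+ 2); [rewrite im_eq | ]; ring.
  by rewrite e4; ring.
split=> [smu m2|c d srho eq rho_mod m2 L].
  by apply: (ramified_kE p_prime q_prime p_mod8 q_mod8 npi im_eq sk_eq sp_eq r2 iy0); rewrite m2.
have nrho : norm (Gint c d) = (if true then q else 1%N)%:Z by rewrite eq.
have [h1 h2 h3] := facts (Gint c d) A0 B0 C0 true srho cA co nrho m2.
split; first exact: h2.
have [t et] := rho_expansion q_mod8 im_eq nrho rho_mod.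
have m2t : srho ^+ 2 = gphi im (Gint c d) * (gphi im A0 + gphi im B0 * spi) by exact: m2.
apply: (h3 ((1 + im) + im * (gphi im t + y0)
  + (1 + im) ^+ 2 * (1 + (1 + im) * gphi im t) * (1 + (1 + im) * y0))); last first.
  have e4 : (1 + im) ^+ 2 = 2%:R * im by rewrite sqrrD im_eq; ring.
  rewrite m2t mu_y0 et !gphiE // el.
  transitivity (1 + 4%:R * (1 + im) + 2%:R * (1 + im) ^+ 2 * (gphi im t + y0)
    + 4%:R * ((1 + im) ^+ 2 * (1 + (1 + im) * gphi im t) * (1 + (1 + im) * y0))); first by ring.
  by rewrite {1}e4; ring.
have i1 : algint (1 + im) by apply: algintD => //; exact: algint1.
have it : algint (gphi im t) by exact: algint_gphi.
have i11 : algint ((1 + im) ^+ 2) by rewrite expr2; apply: algintM.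
apply: algintD; first by apply: algintD => //; apply: algintM => //; apply: algintD.
by do !apply: algintM => //; apply: algintD; rewrite //; (exact: algint1 || exact: algintM).
Qed.
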